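(* Let $\mathbb{K}$ be a field of characteristic zero and let $0\le n\le m$ be integers. The Hochschild homology $HH_*(K^{\mathrm{alg}}_{n,m})$ of the extended arc algebra vanishes in degrees $*\neq 0$, and in degree zero is free (over $\mathbb{K}$) of rank $\binom{m}{n}$.
   Context: $HH_*(K)$ denotes the Hochschild homology of $K$ with coefficients in its diagonal bimodule, where the graded algebra $K=K^{\mathrm{alg}}_{n,m}$ is regarded as a dg algebra with zero differential (so $*$ is the total degree). Convention: $K^{\mathrm{alg}}_{0,m}:=\mathbb{K}$ and $K^{\mathrm{alg}}_{m,m}=\mathbb{K}$. **Extended arc algebra.** A weight of type $(n,m)$ is a function $\lambda:\{1,\dots,m\}\to\{\wedge,\vee\}$ with $|\lambda^{-1}(\vee)|=n$; $\Lambda_{n,m}$ is the set of these. Given $\lambda$, join each $c$ with $\lambda(c)=\vee$ to the smallest $c'>c$ with $\lambda(c')=\wedge$ such that strictly between $c$ and $c'$ there are equally many $\vee$'s and $\wedge$'s, if such $c'$ exists. The cup diagram $\underline{\lambda}$ consists of these pairs drawn as non-crossing cups below a horizontal line, and of downward rays at all other points of $\{1,\dots,m\}$; the cap diagram $\overline{\lambda}$ is its mirror image above the line. A weight $\eta\in\Lambda_{n,m}$ orients a cup or cap diagram if the two ends of each cup/cap have different labels, and whenever $a<b$ lie on rays and $\eta(a)=\vee$ then $\eta(b)=\vee$. An oriented circle diagram $\underline{b}\,\eta\,\overline{a}$ is a triple $a,b,\eta\in\Lambda_{n,m}$ such that $\eta$ orients both $\underline{b}$ and $\overline{a}$; its degree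 is the number of clockwise cups and caps, i.e. those with left end labelled $\wedge$ and right end labelled $\vee$. $K^{\mathrm{alg}}_{n,m}$ is the graded $\mathbb{K}$-vector space with basis the oriented circle diagrams. Multiplication. Let $\Lambda^c_{m,2m}\subset\Lambda_{m,2m}$ be the weights whose cup diagram has no rays, and let $H^{\mathrm{alg}}_{m,2m}$ have basis the oriented circle diagrams $\underline{b}\,\eta\,\overline{a}$ with $a,b\in\Lambda^c_{m,2m}$, $\eta\in\Lambda_{m,2m}$; for fixed $a,b$ its span is identified with $(\mathbb{K}[x]/x^2)^{\otimes\{\text{circles of }\underline{b}\cup\overline{a}\}}$, an anticlockwise circle (rightmost vertex labelled $\wedge$) corresponding to $1$ and a clockwise one to $x$. The product $(\underline{d}\lambda\overline{c})(\underline{b}\mu\overline{a})$ is $0$ if $b\ne c$; if $b=c$, stack $\underline{b}\mu\overline{a}$ above $\underline{d}\lambda\overline{b}$ and successively replace each cup of $\underline{b}$ and the facing cap of $\overline{b}$ by two vertical segments, applying for each merge of circles $1\otimes1\mapsto1,\ 1\otimes x\mapsto x,\ x\otimes1\mapsto x,\ x\otimes x\mapsto0$ and for each splitting $1\mapsto1\otimes x+x\otimes1,\ x\mapsto x\otimes x$. For $\lambda\in\Lambda_{n,m}$ define $\mathrm{cl}(\lambda)\in\Lambda^c_{m,2m}$ by $\mathrm{cl}(\lambda)(a)=\vee$ if $a\le m-n$, $\lambda(a-(m-n))$ if $m-n<a\le 2m-n$, and $\wedge$ if $a>2m-n$. The span $I$ of all $\underline{b}\,\eta\,\overline{a}\in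 H^{\mathrm{alg}}_{m,2m}$ with $\eta\notin\mathrm{cl}(\Lambda_{n,m})$ is a two-sided ideal, and $\underline{b}\,\eta\,\overline{a}\mapsto\underline{\mathrm{cl}(b)}\,\mathrm{cl}(\eta)\,\overline{\mathrm{cl}(a)}+I$ is a graded linear isomorphism $K^{\mathrm{alg}}_{n,m}\to H^{\mathrm{alg}}_{m,2m}/I$, which defines the algebra structure on $K^{\mathrm{alg}}_{n,m}$. *)

(* Defs.v *)
From HB Require Import structures.
From mathcomp Require Import all_boot all_order all_algebra.
From mathcomp Require Import finmap boolp.
From mathcomp Require Import monalg.

Set Implicit Arguments.
Unset Strict Implicit.
Unset Printing Implicit Defensive.

Import GRing.Theory.
Local Open Scope ring_scope.

Section CircleDiagrams.
Variable m : nat.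

(* [true] stands for the label \vee and [false] for \wedge; the vertices
   1, ..., m of the line are numbered from 0. *)
Definition weight := {ffun 'I_m -> bool}.

Implicit Types (l eta : weight) (i j k : 'I_m).

Definition balanced l i j : bool :=
  #|[set k : 'I_m | (i < k < j)%N && l k]|
    == #|[set k : 'I_m | (i < k < j)%N && ~~ l k]|.

Definition closes l i j : bool := [&& (i < j)%N, ~~ l j & balanced l i j].

Definition cup l i j : bool :=
  [&& l i, closes l i j & [forall k : 'I_m, closes l i k ==> (j <= k)%N]].

(* The symmetric closure of [cup]: as [cup l] is also the set of caps of the
   mirror image of the diagram, both kinds of diagrams share these notions. *)
Definition arc l i j : bool := cup l i j || cup l j i.

Definition ray l i : bool := [forall j, ~~ arc l i j].

Definition orients eta l : bool :=
  [forall i, forall j, cup l i j ==> (eta i != eta j)]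
  && [forall i, forall j, [&& ray l i, ray l j, (i < j)%N & eta i] ==> eta j].

Definition nb_clockwise eta l : nat :=
  #|[set p : 'I_m * 'I_m | [&& cup l p.1 p.2, ~~ eta p.1 & eta p.2]]|.

(* The rightmost vertex of the circle through the vertex i in the union of the
   cup diagram of b and the cap diagram of a. *)
Definition rightmost b a i : 'I_m :=
  [arg max_(j > i | connect (fun u v => arc b u v || arc a u v) i j) (j : nat)].

(* The circle through i is clockwise, that is, it carries x rather than 1. *)
Definition clockwise b eta a i : bool := eta (rightmost b a i).

(* Two copies of the line: (false, i) is the vertex i of the lower diagram and
   (true, i) that of the upper one. *)
Definition point := (bool * 'I_m)%type.

(* A tensor product of 1's and x's, one for each circle of a stacked diagram,
   is encoded by the function on vertices whose value at p is [true] iff the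
   factor of the circle through p is x.  A list of labellings encodes the sum
   of its members. *)
Definition labelling := {ffun point -> bool}.

(* The diagram of b and a stacked above that of d and b, once the cups and
   caps of b with ends in S have been replaced by vertical segments. *)
Definition stacked (d b a : weight) (S : {set 'I_m}) : rel point :=
  fun p q =>
    match p.1, q.1 with
    | false, false => arc d p.2 q.2 || (arc b p.2 q.2 && (p.2 \notin S))
    | true, true => arc a p.2 q.2 || (arc b p.2 q.2 && (p.2 \notin S))
    | _, _ => (p.2 == q.2) && (p.2 \in S)
    end.

Definition relabel (e : rel point) (p : point) (c : bool) (s : labelling)
    : labelling :=
  [ffun q => if connect e p q then c else s q].

(* The merge or split along the arcs of b joining i and j; e and e' are the
   diagrams before and after the replacement. *)
Definition surgery (e e' : rel point) (i j : 'I_m) (s : labelling)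
    : seq labelling :=
  let lo := (false, i) in let up := (true, i) in
  if ~~ connect e lo up then
    if s lo && s up then [::] else [:: relabel e' lo (s lo || s up) s]
  else
    if s lo then [:: s]
    else [:: relabel e' lo true s; relabel e' (false, j) true s].

Fixpoint surgeries (d b a : weight) (S : {set 'I_m})
    (cs : seq ('I_m * 'I_m)) (s : labelling) : seq labelling :=
  if cs is (i, j) :: cs' then
    let S' := i |: (j |: S) in
    flatten [seq surgeries d b a S' cs' t
            | t <- surgery (stacked d b a S) (stacked d b a S') i j s]
  else [:: s].

(* The cups in lexicographic order, hence an outer cup before the ones nested
   inside it. *)
Definition cups b : seq ('I_m * 'I_m) :=
  [seq p <- enum [set: 'I_m * 'I_m] | cup b p.1 p.2].

(* For d, b, a without rays: the coefficient of (d, eta, a) in the product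
   (d, l, b) * (b, mu, a), where (b, eta, a) stands for the circle diagram with
   cup diagram b, weight eta and cap diagram a. *)
Definition arc_coef (d l b mu a eta : weight) : nat :=
  let s0 : labelling :=
    [ffun p => if p.1 then clockwise b mu a p.2 else clockwise d l b p.2] in
  let s1 : labelling := [ffun p => clockwise d eta a p.2] in
  count (pred1 s1) (surgeries d b a set0 (cups b) s0).

End CircleDiagrams.

Section ExtendedArcAlgebra.
Variables n m : nat.

Definition Lambda := {l : weight m | #|[set i | l i]| == n}.

Definition circle_diagram :=
  {x : Lambda * Lambda * Lambda
  | orients (val x.1.2) (val x.1.1) && orients (val x.1.2) (val x.2)}.

Definition dcup (x : circle_diagram) : Lambda := (val x).1.1.
Definition dweight (x : circle_diagram) : Lambda := (val x).1.2.
Definition dcap (x : circle_diagram) : Lambda := (val x).2.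

Definition degree (x : circle_diagram) : nat :=
  (nb_clockwise (val (dweight x)) (val (dcup x))
   + nb_clockwise (val (dweight x)) (val (dcap x)))%N.

Definition label_at (l : weight m) (k : nat) : bool :=
  if insub k is Some i then l i else false.

(* Meaningful for n <= m. *)
Definition cl (l : weight m) : weight m.*2 :=
  [ffun i : 'I_m.*2 =>
    if (i < m - n)%N then true
    else if (i < m.*2 - n)%N then label_at l (i - (m - n)) else false].

(* The coefficient of z in x * y: the basis elements of H_{m,2m} whose weight
   is not in the image of [cl] vanish modulo I, and the others are the images
   of the basis elements of K_{n,m}. *)
Definition K_coef (x y z : circle_diagram) : nat :=
  if [&& dcap x == dcup y, dcup z == dcup x & dcap z == dcap y] then
    arc_coef (cl (val (dcup x))) (cl (val (dweight x))) (cl (val (dcap x)))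
      (cl (val (dweight y))) (cl (val (dcap y))) (cl (val (dweight z)))
  else 0%N.

End ExtendedArcAlgebra.

Section QuotientModule.
Variables (R : nzRingType) (V : lmodType R) (S : {pred V}).
Hypothesis closedS : submod_closed S.

Definition quotient_zmod : zmodClosed V :=
  HB.pack S (GRing.isZmodClosed.Build V S (GRing.submod_closedB closedS)).

Definition quotient : Type := Quotient.quot quotient_zmod.

HB.instance Definition _ := GRing.Zmodule.on quotient.

Local Open Scope quotient_scope.

Definition quotient_pi (v : V) : quotient := \pi_(Quotient.quot quotient_zmod) v.

Definition quotient_scale (a : R) (x : quotient) : quotient :=
  quotient_pi (a *: repr (x : Quotient.quot quotient_zmod)).

Lemma quotient_piP (u v : V) : quotient_pi u = quotient_pi v <-> u - v \in S.
Proof.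
rewrite -[u - v \in S]/(u - v \in quotient_zmod) Quotient.idealrBE.
by split=> [/eqP|/eqP].
Qed.

Lemma quotient_pi_surj (x : quotient) : exists v, x = quotient_pi v.
Proof.
by exists (repr (x : Quotient.quot quotient_zmod)); rewrite /quotient_pi reprK.
Qed.

Lemma quotient_piD (u v : V) :
  quotient_pi (u + v) = quotient_pi u + quotient_pi v.
Proof. exact: (raddfD (\pi_(Quotient.quot quotient_zmod))). Qed.

Lemma quotient_piZ (a : R) (v : V) :
  quotient_scale a (quotient_pi v) = quotient_pi (a *: v).
Proof.
apply/quotient_piP; rewrite -scalerBr.
rewrite -[_ *: _]addr0; apply: closedS.2; last exact: closedS.1.
by apply/quotient_piP; rewrite /quotient_pi reprK.
Qed.

Fact quotient_scaleA a b x :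
  quotient_scale a (quotient_scale b x) = quotient_scale (a * b) x.
Proof. by case: (quotient_pi_surj x) => v ->; rewrite !quotient_piZ scalerA. Qed.

Fact quotient_scale1 : left_id 1 quotient_scale.
Proof.
by move=> x; case: (quotient_pi_surj x) => v ->; rewrite quotient_piZ scale1r.
Qed.

Fact quotient_scaleDr : right_distributive quotient_scale +%R.
Proof.
move=> a x y.
case: (quotient_pi_surj x) => u ->; case: (quotient_pi_surj y) => v ->.
by rewrite -quotient_piD !quotient_piZ scalerDr quotient_piD.
Qed.

Fact quotient_scaleDl x :
  {morph quotient_scale^~ x : a b / a + b >-> a + b}.
Proof.
move=> a b; case: (quotient_pi_surj x) => v ->.
by rewrite !quotient_piZ scalerDl quotient_piD.
Qed.

HB.instance Definition _ := GRing.Zmodule_isLmodule.Build R quotient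
  quotient_scaleA quotient_scale1 quotient_scaleDr quotient_scaleDl.
End QuotientModule.

(* The Hochschild homology of the graded K-algebra with finite homogeneous
   basis B, degrees |.| and structure constants mul (mul x y z is the
   coefficient of z in x y), seen as a dg algebra with zero differential. *)
Section Hochschild.
Variables (K : fieldType) (B : finType) (deg : B -> nat).
Variable mul : B -> B -> B -> K.

(* A nonempty sequence [:: a_0; ...; a_p] stands for the elementary tensor
   a_0 \otimes ... \otimes a_p. *)
Definition chain := {malg K[seq B]}.

Definition face (a0 : B) (w : seq B) (i : nat) : chain :=
  \sum_(z : B) mul (nth a0 w i) (nth a0 w i.+1) z
                 *: << take i w ++ z :: drop i.+2 w >>.

Definition last_face (a0 : B) (w : seq B) : chain :=
  let p := (size w).-1 in
  \sum_(z : B) mul (nth a0 w p) a0 z *: << z :: behead (take p w) >>.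

(* b (a_0 ... a_p) = \sum_(i < p) (-1)^i (a_0 ... a_i a_(i+1) ... a_p)
     + (-1)^(p + |a_p| (|a_0| + ... + |a_(p-1)|)) (a_p a_0, a_1 ... a_(p-1)),
   with the Koszul sign of moving a_p to the front; b is 0 for p = 0. *)
Definition hochschild_word (w : seq B) : chain :=
  if w is a0 :: _ :: _ then
    let p := (size w).-1 in
    let k := (deg (nth a0 w p) * (\sum_(a <- take p w) deg a))%N in
    \sum_(i < p) (-1) ^+ i *: face a0 w i + (-1) ^+ (p + k) *: last_face a0 w
  else 0.

Definition hochschild_d (c : chain) : chain :=
  \sum_(w <- msupp c) c@_w *: hochschild_word w.

(* The homological total degree p - (|a_0| + ... + |a_p|). *)
Definition total_degree (w : seq B) : int :=
  (size w).-1%:Z - (\sum_(a <- w) deg a)%N%:Z.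

Definition homogeneous (t : int) : {pred chain} :=
  fun c => all (fun w => (w != [::]) && (total_degree w == t)) (msupp c).

Definition cycle (t : int) : {pred chain} :=
  fun c => (c \in homogeneous t) && (hochschild_d c == 0).

Fact hochschild_d_linear : linear hochschild_d.
Proof.
have E (D : {fset seq B}) c : (msupp c `<=` D)%fset ->
    hochschild_d c = \sum_(w <- D) c@_w *: hochschild_word w.
  move=> cD; rewrite [RHS](big_fsetID _ (mem (msupp c))) /=.
  rewrite [X in _ + X]big1_fset ?addr0; last first.
    by move=> w; rewrite !inE /= => /andP[_ wc] _; rewrite mcoeff_outdom ?scale0r.
  by apply: eq_fbigl => w; rewrite !inE /= andb_idl // => /(fsubsetP cD).
move=> a u v; set D := (msupp u `|` msupp v)%fset.
rewrite (E D) ?(E D u) ?(E D v) ?fsubsetUl ?fsubsetUr //; last first.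
  apply: fsubset_trans (msuppD_le _ _) _.
  exact: fsetSU (msuppZ_le _ _).
rewrite scaler_sumr -big_split /=; apply: eq_bigr => w _.
by rewrite mcoeffD mcoeffZ scalerDl scalerA.
Qed.

HB.instance Definition _ := GRing.isLinear.Build K chain chain *:%R
  hochschild_d hochschild_d_linear.

Fact cycle_closed t : submod_closed (cycle t).
Proof.
split=> [|a u v /andP[/allP hu /eqP du] /andP[/allP hv /eqP dv]].
  by rewrite unfold_in raddf0 eqxx andbT unfold_in msupp0.
rewrite unfold_in linearP /= du dv scaler0 addr0 eqxx andbT.
apply/allP => w /(fsubsetP (msuppD_le _ _)); rewrite inE => /orP[|/hv //].
by move=> /(fsubsetP (msuppZ_le _ _)) /hu.
Qed.

HB.instance Definition _ t := GRing.isSubmodClosed.Build K chain (cycle t)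
  (cycle_closed t).

Definition cycles (t : int) := {c : chain | c \in cycle t}.

HB.instance Definition _ t := SubChoice.on (cycles t).
HB.instance Definition _ t := [SubChoice_isSubLmodule of cycles t by <:].

(* A predicate on cycles, so that the quotient below is Z_t / (Z_t \cap B_t). *)
Definition boundary (t : int) : {pred cycles t} :=
  fun c => `[< exists2 c' : chain,
                 c' \in homogeneous (t + 1) & hochschild_d c' = val c >].

Fact homogeneous_closed t : submod_closed (homogeneous t).
Proof.
split=> [|a u v /allP hu /allP hv]; first by rewrite unfold_in msupp0.
apply/allP => w /(fsubsetP (msuppD_le _ _)); rewrite inE => /orP[|/hv //].
by move=> /(fsubsetP (msuppZ_le _ _)) /hu.
Qed.

Fact boundary_closed t : submod_closed (@boundary t).
Proof.
split=> [|a u v /asboolP[u' hu du] /asboolP[v' hv dv]]; apply/asboolP.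
  by exists 0; [exact: (homogeneous_closed _).1 | rewrite raddf0].
exists (a *: u' + v'); first exact: (homogeneous_closed _).2.
by rewrite linearP /= du dv.
Qed.

Definition HH (t : int) : lmodType K := quotient (@boundary_closed t).

End Hochschild.

Definition HH_arc (K : fieldType) (n m : nat) (t : int) : lmodType K :=
  HH (@degree n m) (fun x y z => (K_coef x y z)%:R : K) t.

(* Main.v *)
(** Deform x^2 = 0 to x^2 = t^2.  A basis element then becomes a function on
    weights with values in K[t]: at the weight eta, the generator x of the circle
    through the vertex i takes the value t or -t according to the parity of i and
    the label eta(i).  A merge is a pointwise product and a split multiplies by the
    sum of the two values involved, so the product of two functions f, g on
    (d, b) and (b, a) is f g G, where G = G(d, b, a) is the product of the factors
    of the splits.  Counting splits shows that G is a cocycle, whence the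
    associativity of the product.  The function of the diagram (d, nu, a), normalized
    as a product of x + (value at nu) over the clockwise circles of nu, vanishes at
    eta unless nu <= eta in the Bruhat order; by triangularity the coefficients of a
    product are determined at t = 0, and multiplying can only raise the weight.  Turning
    numbers of circles relate the numbers of circles to the numbers of clockwise
    cups, which gives additivity of degrees and the identity
    (b, eta, eta) (eta, eta, a) = (b, eta, a) + terms of higher weight.

    For the Hochschild complex, let h split the first letter (b, eta, a) of maximal
    weight of a word into the two letters (b, eta, eta), (eta, eta, a).  Modulo words
    of higher maximal weight, or of the same maximal weight but with fewer letters of
    lower weight, d h + h d is the identity minus the projection onto the words made
    of a single idempotent e_lambda = (lambda, lambda, lambda).  Hence every cycle is
    homologous to a combination of the e_lambda, which have degree 0; and the
    coefficients of the e_lambda vanish on boundaries. *)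

From Pilot Require Import Defs.
From HB Require Import structures.
From mathcomp Require Import all_boot all_order all_algebra all_fingroup.
From mathcomp Require Import finmap boolp monalg.
From mathcomp Require Import zify ring.
Import Pilot.Defs.

Set Implicit Arguments.
Unset Strict Implicit.
Unset Printing Implicit Defensive.

Import Order.TTheory GRing.Theory Num.Theory.
Local Open Scope ring_scope.

(** * Turning numbers of circles *)

(** The surgery procedure depends on an order of the cups and says little about coefficients. After
    the deformation the algebra of a circle becomes an algebra of functions on two points, separated
    because 2t is not zero; this is where the characteristic enters. That a surgery merges or
    splits, and never turns one circle into one circle, rests on a bicolouring of the vertices by
    parity. The quotient by I becomes the restriction of functions to the weights in the image of
    [cl]. This set is closed downwards for the order on heights, and a class is nonzero only at
    points above its weight, so the restricted functions expand in the remaining classes alone. The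
    Hochschild part keeps only formal properties of the basis: three labels per element, products
    that never lower the middle label, and a factorization of each element into two halves with
    leading coefficient 1. Associativity then gives the cellular property, that leading coefficients
    ignore the outer half of a factor; this is what makes the faces next to the split letter
    cancel. *)

Section Circles.
Variables (M : nat) (eta : 'I_M -> bool).
Implicit Types (S T : {set 'I_M}) (f g : 'I_M -> 'I_M) (p x k : 'I_M).

Definition sg (b : bool) : int := if b then 1 else -1.
Definition ori (x y : nat) : int := if (x < y)%N then 1 else -1.
(** For [k] different from both ends this says that [k] lies strictly between [x] and [y], in
    whichever order these come; arcs need not be oriented. *)
Definition sep (x y k : nat) : bool := (x < k)%N (+) (y < k)%N.

Lemma sgN b : sg (~~ b) = - sg b. Proof. by case: b. Qed.

Lemma oriC (x y : nat) : x != y -> ori y x = - ori x y.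
Proof. by rewrite /ori; case: ltngtP. Qed.

Lemma sepE (x y k : nat) : (x < y)%N -> k != x -> k != y -> sep x y k = (x < k < y)%N.
Proof. by rewrite /sep => xy; case: (ltngtP x k); case: (ltngtP y k) => //; lia. Qed.

Lemma lt_adjacent (x y k : nat) :
  (x < y)%N -> ~~ (x < k < y)%N -> k != y -> k != x -> (x < k)%N = (y < k)%N.
Proof. by case: (ltngtP x k); case: (ltngtP y k) => //; lia. Qed.

Lemma gt_adjacent (x y k : nat) :
  (x < y)%N -> ~~ (x < k < y)%N -> k != y -> k != x -> (k < x)%N = (k < y)%N.
Proof. by case: (ltngtP x k); case: (ltngtP y k) => //; lia. Qed.

(** Conservation of turning when the path [p], [x], [y], [q] is straightened to a single arc from
    [p] to [q]: no point considered lies between [x] and [y], and the hypothesis on [sep] says that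
    the arcs from [x] to [p] and from [y] to [q] do not cross. *)
Lemma ori_splice (x y p q : nat) :
  (x < y)%N -> ~~ (x < p < y)%N -> ~~ (x < q < y)%N -> p != x -> p != y ->
  q != x -> q != y -> p != q -> sep x p y = sep x p q ->
  ori y q = 1 + ori x p + ori p q.
Proof.
rewrite /sep /ori; case: (ltngtP x p); case: (ltngtP y q); case: (ltngtP p q);
  case: (ltngtP p y); case: (ltngtP x q); case: (ltngtP x y) => //; lia.
Qed.

Definition matching S f : Prop :=
  [/\ {in S, forall x, f x \in S}, {in S, forall x, f (f x) = x},
      {in S, forall x, eta (f x) = ~~ eta x}
    & {in S &, forall x k, k != x -> k != f x ->
        sep x (f x) k = sep x (f x) (f k)}].

(** The last clause is connectedness: the arcs of [f] and those of [g], drawn on opposite sides of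
    the line, form one closed curve. *)
Definition circle S f g : Prop :=
  [/\ matching S f, matching S g, S != set0
    & forall T, T \subset S -> T != set0 -> {in T, forall x, f x \in T} ->
        {in T, forall x, g x \in T} -> T = S].

Definition prefix_sum S (k : nat) : int := \sum_(x in S | (x < k)%N) sg (eta x).
(** Up to sign, [prefix_sum S k] is the winding number of the curve around a point of the line just
    before [k]; the two numbers on both sides of the crossing [p] are added. For a simple closed
    curve one of them is 0, so the sum is 1 or -1 and tells the orientation. *)
Definition side S p : int := prefix_sum S p + prefix_sum S p.+1.

Lemma matching_neq S f x : matching S f -> x \in S -> f x != x.
Proof.
move=> [_ _ fl _] xS; apply/eqP => e; have := fl x xS; rewrite e.
by case: (eta x).
Qed.

Lemma prefix_sumS S p :
  p \in S -> prefix_sum S p.+1 = prefix_sum S p + sg (eta p).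
Proof.
move=> pS; rewrite /prefix_sum (bigD1 p) /= ?pS ?ltnS //= addrC; congr (_ + _).
by apply: eq_bigl => x; case: (x \in S); rewrite //= -val_eqE /=; lia.
Qed.

Lemma side_step S p : p \in S -> side S p = 2 * prefix_sum S p + sg (eta p).
Proof. by move=> pS; rewrite /side prefix_sumS //; ring. Qed.

(** By non-crossing, [f] permutes the points under the arc and reverses their signs, so the sum
    equals its own opposite. *)
Lemma sum_matching_interval S f p : matching S f -> p \in S -> (p < f p)%N ->
  \sum_(x in S | (p < x < f p)%N) sg (eta x) = 0.
Proof.
move=> [fS ff fl nc] pS lp.
set A := \sum_(x in S | _) _.
suff : A = - A by lia.
rewrite {1}/A (reindex_onto f f) /=; last by move=> x /andP[xS _]; apply: ff.
rewrite -sumrN; apply: eq_big => [x|x].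
  apply/idP/idP.
    case/andP=> /andP[fxS I] /eqP e; have xS : x \in S by rewrite -e fS.
    have n1 : f x != p by apply: contraTneq I => ->; lia.
    have n2 : f x != f p by apply: contraTneq I => ->; lia.
    have n3 : x != p by apply: contraNneq n2 => ->.
    have n4 : x != f p by apply: contraNneq n1 => ->; rewrite ff.
    by have := nc _ _ pS fxS n1 n2; rewrite e xS !sepE // => <-.
  case/andP=> xS I; rewrite fS //= ff // eqxx andbT.
  have n1 : x != p by apply: contraTneq I => ->; lia.
  have n2 : x != f p by apply: contraTneq I => ->; lia.
  have n3 : f x != p by apply: contraNneq n2 => <-; rewrite ff.
  have n4 : f x != f p by apply: contraNneq n1 => e; rewrite -(ff x) // e ff.
  by have := nc _ _ pS xS n1 n2; rewrite !sepE // => <-.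
case/andP=> /andP[fxS _] /eqP e; have xS : x \in S by rewrite -[x]e fS.
by rewrite fl // sgN.
Qed.

Lemma side_matching S f p : matching S f -> p \in S -> side S (f p) = side S p.
Proof.
move=> mf; have [fS ff fl nc] := mf.
wlog lp : p / (p < f p)%N.
  move=> H pS; have := matching_neq mf pS; rewrite -val_eqE /= neq_ltn => /orP[l|l].
    by have := H (f p); rewrite ff // => ->; rewrite ?fS.
  exact: H.
move=> pS; rewrite !side_step ?fS // fl // sgN.
have -> : prefix_sum S (f p) = prefix_sum S p.+1.
  rewrite /prefix_sum (bigID (fun x : 'I_M => (x < p.+1)%N)) /=.
  rewrite [X in _ + X](_ : _ = 0) ?addr0; last first.
    rewrite -[RHS](sum_matching_interval mf pS lp); apply: eq_bigl => x.
    by rewrite -andbA [in RHS]andbC; case: (x \in S); rewrite ?andbT ?andbF //=; lia.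
  by apply: eq_bigl => x; case: (x \in S) => //=; lia.
by rewrite prefix_sumS //; ring.
Qed.

(** The points with a given value of [side] form a set stable under both matchings, hence the whole
    circle. *)
Lemma side_const S f g p q : circle S f g -> p \in S -> q \in S ->
  side S p = side S q.
Proof.
move=> [mf mg _ min] pS qS.
have E : [set x in S | side S x == side S q] = S.
  apply: min.
  - by apply/subsetP => x; rewrite inE => /andP[].
  - by apply/set0Pn; exists q; rewrite inE qS eqxx.
  - move=> x; rewrite !inE => /andP[xS e].
    by rewrite (side_matching mf) // e andbT; case: mf => ->.
  - move=> x; rewrite !inE => /andP[xS e].
    by rewrite (side_matching mg) // e andbT; case: mg => ->.
by move: pS; rewrite -{1}E inE => /andP[_ /eqP].
Qed.

(* The second matching, once the innermost arc i -- j of the first one has been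
   contracted. *)
Definition splice g (i j x : 'I_M) : 'I_M :=
  if x == g i then g j else if x == g j then g i else g x.

(** Every half-turn is counted at both ends of its arc, with the same sign: this is, up to sign,
    four times the turning number of the oriented curve. *)
Definition winding S f g : int :=
  \sum_(x in S) sg (eta x) * (ori x (f x) + ori x (g x)).

Section Splice.
Variables (S : {set 'I_M}) (f g : 'I_M -> 'I_M) (i j : 'I_M).
Hypothesis circ : circle S f g.
Hypotheses (iS : i \in S) (fij : f i = j) (ij : (i < j)%N).
Hypothesis adj : forall k, k \in S -> ~~ (i < k < j)%N.
Hypothesis gij : g i != j.

Let S' := S :\ i :\ j.
Let g' := splice g i j.

Let mf : matching S f. Proof. by case: circ. Qed.
Let mg : matching S g. Proof. by case: circ. Qed.
Let jS : j \in S. Proof. by rewrite -fij; case: mf => ->. Qed.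
Let fji : f j = i. Proof. by rewrite -fij; case: mf => _ ->. Qed.

Lemma in_splice x : x \in S' = [&& x != j, x != i & x \in S].
Proof. by rewrite !inE. Qed.

Lemma adj_lt x : x \in S' -> (i < x)%N = (j < x)%N.
Proof. by rewrite in_splice => /and3P[xj xi xS]; rewrite (lt_adjacent ij) ?adj. Qed.

Lemma adj_gt x : x \in S' -> (x < i)%N = (x < j)%N.
Proof. by rewrite in_splice => /and3P[xj xi xS]; rewrite (gt_adjacent ij) ?adj. Qed.

Lemma splice_end1 : g i \in S'.
Proof.
rewrite in_splice gij (matching_neq mg) //=; case: mg => -> //.
Qed.

Lemma splice_end2 : g j \in S'.
Proof.
rewrite in_splice (matching_neq mg) //=; case: mg => gS gg _ _; rewrite gS // andbT.
by apply: contraNneq gij => <-; rewrite gg.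
Qed.

Lemma splice_ends : g i != g j.
Proof.
case: mg => gS gg _ _; apply/eqP => e; have := gg i iS; rewrite e gg // => e'.
by move: ij; rewrite e' ltnn.
Qed.

Lemma spliceE x : x \in S' -> x != g i -> x != g j -> g' x = g x.
Proof. by move=> _ /negPf n1 /negPf n2; rewrite /g' /splice n1 n2. Qed.

Lemma splice1 : g' (g i) = g j. Proof. by rewrite /g' /splice eqxx. Qed.
Lemma splice2 : g' (g j) = g i.
Proof. by rewrite /g' /splice eq_sym (negPf splice_ends) eqxx. Qed.

Lemma splice_other x : x \in S' -> x != g i -> x != g j -> g x \in S'.
Proof.
rewrite !in_splice => /and3P[xj xi xS] n1 n2; case: mg => gS gg _ _.
rewrite gS // andbT; apply/andP; split.
  by apply: contraNneq n2 => <-; rewrite gg.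
by apply: contraNneq n1 => <-; rewrite gg.
Qed.

Lemma splice_mem x : x \in S' -> x \in S. Proof. by rewrite in_splice => /and3P[]. Qed.

Lemma sep_splice x : x \in S' -> x != g i -> x != g j ->
  sep (g i) (g j) x = sep i (g i) x (+) sep j (g j) x.
Proof.
by move=> xS' _ _; rewrite /sep adj_lt //; case: (j < x)%N; case: (g i < x)%N;
  case: (g j < x)%N.
Qed.

(** No remaining point lies between [i] and [j]. Hence the new arc separates a point exactly when
    one, but not both, of the arcs of [g] at [i] and [j] does, and it inherits non-crossing from
    these two. *)
Lemma matching_splice : matching S' g'.
Proof.
have [gS gg fl nc] := mg; split.
- move=> x xS'; case: (altP (x =P g i)) => [->|n1]; first by rewrite splice1 splice_end2.
  case: (altP (x =P g j)) => [->|n2]; first by rewrite splice2 splice_end1.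
  by rewrite spliceE // splice_other.
- move=> x xS'; case: (altP (x =P g i)) => [->|n1]; first by rewrite splice1 splice2.
  case: (altP (x =P g j)) => [->|n2]; first by rewrite splice2 splice1.
  have xS := splice_mem xS'.
  rewrite spliceE // spliceE ?gg // ?splice_other //.
    by apply: contraTneq xS' => e; rewrite -(gg x) // e gg // in_splice eqxx andbF.
  by apply: contraTneq xS' => e; rewrite -(gg x) // e gg // in_splice eqxx.
- have fi : eta j = ~~ eta i by rewrite -fij; case: mf => _ _ ->.
  move=> x xS'; case: (altP (x =P g i)) => [->|n1]; first by rewrite splice1 !fl // fi.
  case: (altP (x =P g j)) => [->|n2]; first by rewrite splice2 !fl // fi negbK.
  by rewrite spliceE // fl // splice_mem.
have key k : k \in S' -> k != g i -> k != g j ->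
    sep (g i) (g j) k = sep (g i) (g j) (g k).
  move=> kS' n1 n2; have /and3P[kj ki kS] : [&& k != j, k != i & k \in S].
    by rewrite -in_splice.
  have gkS' := splice_other kS' n1 n2.
  have m1 : g k != g i by apply: contraNneq ki => e; rewrite -(gg k) // e gg.
  have m2 : g k != g j by apply: contraNneq kj => e; rewrite -(gg k) // e gg.
  by rewrite !sep_splice // (nc i k) // (nc j k).
move=> x k xS' kS' kx.
case: (altP (x =P g i)) => [e|n1].
  by rewrite e splice1 in kx * => n2; rewrite spliceE //; apply: key.
case: (altP (x =P g j)) => [e|n2].
  rewrite e splice2 in kx * => n3; rewrite spliceE // /sep addbC [RHS]addbC.
  exact: key.
rewrite spliceE //; have xS := splice_mem xS'; have kS := splice_mem kS'.
have gxS' := splice_other xS' n1 n2; have gxS := splice_mem gxS'.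
have sepij : sep x (g x) i = sep x (g x) j by rewrite /sep !adj_gt.
move=> kgx.
have nci : sep x (g x) (g i) = sep x (g x) i.
  apply/esym/nc => //; first by apply: contraTneq xS' => <-; rewrite in_splice eqxx andbF.
  by apply: contraTneq gxS' => <-; rewrite in_splice eqxx andbF.
have ncj : sep x (g x) (g j) = sep x (g x) j.
  apply/esym/nc => //; first by apply: contraTneq xS' => <-; rewrite in_splice eqxx.
  by apply: contraTneq gxS' => <-; rewrite in_splice eqxx.
case: (altP (k =P g i)) => [->|m1]; first by rewrite splice1 nci ncj.
case: (altP (k =P g j)) => [->|m2]; first by rewrite splice2 nci ncj.
by rewrite spliceE //; apply: nc.
Qed.

Lemma circle_splice : circle S' f g'.
Proof.
have [_ _ _ min] := circ; have [gS gg _ _] := mg; have [fS ff fl nc] := mf.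
have fS' x : x \in S' -> f x \in S'.
  rewrite !in_splice => /and3P[xj xi xS]; rewrite fS // andbT; apply/andP; split.
    by apply: contraNneq xi => e; rewrite -(ff x) // e fji.
  by apply: contraNneq xj => e; rewrite -(ff x) // e fij.
split.
- split=> // [x /splice_mem|x /splice_mem|x k /splice_mem xS /splice_mem kS].
  + exact: ff.
  + exact: fl.
  + exact: nc.
- exact: matching_splice.
- by apply/set0Pn; exists (g i); apply: splice_end1.
move=> T sT T0 fT gT.
have memT x : x \in T -> x \in S' by apply: (subsetP sT).
have sTS : T \subset S by apply/subsetP => x /memT/splice_mem.
have [pT|pT] := boolP (g i \in T).
  have qT : g j \in T by rewrite -splice1 gT.
  have E : i |: (j |: T) = S.
    apply: min.
    - by apply/subsetP => x; rewrite !inE => /or3P[/eqP->|/eqP->|/(subsetP sTS)].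
    - by apply/set0Pn; exists i; rewrite !inE eqxx.
    - move=> x; rewrite !inE => /or3P[/eqP->|/eqP->|xT].
      + by rewrite fij eqxx orbT.
      + by rewrite fji eqxx.
      + by rewrite fT ?orbT.
    - move=> x; rewrite !inE => /or3P[/eqP->|/eqP->|xT]; rewrite ?pT ?qT ?orbT //.
      have [->|n1] := eqVneq x (g i); first by rewrite gg // eqxx.
      have [->|n2] := eqVneq x (g j); first by rewrite gg // eqxx orbT.
      by rewrite -(spliceE (memT x xT)) // gT ?orbT.
  apply/eqP; rewrite eqEsubset sT; apply/subsetP => x.
  by rewrite in_splice -E !inE => /and3P[/negPf-> /negPf-> /=].
have qT : g j \notin T by apply: contraNN pT => qT; rewrite -splice2 gT.
have E : T = S.
  apply: min => // x xT; rewrite -(spliceE (memT x xT)) ?gT //.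
    by apply: contraNneq pT => <-.
  by apply: contraNneq qT => <-.
by move: pT; rewrite E gS.
Qed.

Lemma prefix_splice (k : nat) : (i < k)%N = (j < k)%N -> prefix_sum S' k = prefix_sum S k.
Proof.
move=> e; rewrite /prefix_sum [RHS](bigID (mem S')) /= [X in _ = _ + X](_ : _ = 0).
  by rewrite addr0; apply: eq_bigl => x; rewrite andbC -andbA andbC in_splice;
    case: (x \in S); rewrite ?andbT ?andbF //= andbC.
have fl : eta j = ~~ eta i by rewrite -fij; case: mf => _ _ ->.
have ji : j != i by rewrite -val_eqE /= gtn_eqF.
case ik: (i < k)%N; last first.
  apply: big1 => x /andP[/andP[xS xk]]; rewrite in_splice xS andbT negb_and !negbK.
  by move: xk => /[swap] /orP[/eqP->|/eqP->]; rewrite -?e ik.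
rewrite (bigD1 i) /= ?iS ?ik ?in_splice ?eqxx ?andbF //.
rewrite (bigD1 j) /= ?jS -?e ?ik ?ji ?in_splice ?eqxx //.
rewrite big1 ?fl ?sgN ?addr0 ?subrr // => x.
by rewrite in_splice; case: (x == j); case: (x == i); case: (x \in S); rewrite ?andbF.
Qed.

Lemma side_splice x : x \in S' -> side S' x = side S x.
Proof.
move=> xS'; rewrite /side (prefix_splice (adj_lt xS')) prefix_splice //.
have l := adj_lt xS'; move: xS'; rewrite in_splice -!val_eqE /= !ltnS => /and3P[nj ni _].
by rewrite (leq_eqVlt i) (leq_eqVlt j) l ![_ == x :> nat]eq_sym (negPf nj) (negPf ni).
Qed.

Lemma winding_splice : winding S f g = winding S' f g'.
Proof.
have [gS gg gfl nc] := mg; have [_ _ fl _] := mf.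
have ji : j != i by rewrite -val_eqE /= gtn_eqF.
rewrite /winding (bigD1 i) //= (bigD1 j) /= ?jS //.
rewrite (bigD1 (g i)) /=; last first.
  by move: splice_end1; rewrite in_splice => /and3P[-> -> ->].
rewrite (bigD1 (g j)) /=; last first.
  move: splice_end2; rewrite in_splice => /and3P[-> -> ->].
  by rewrite eq_sym splice_ends.
rewrite [RHS](bigD1 (g i)) ?splice_end1 //= [in RHS](bigD1 (g j)) /=; last first.
  by rewrite splice_end2 eq_sym splice_ends.
rewrite !addrA; congr (_ + _); last first.
  apply: eq_big => x; first by rewrite in_splice; case: (x \in S); case: (x == i); case: (x == j).
  by case/andP=> /andP[_ n1] n2; rewrite /g' /splice (negPf n1) (negPf n2).
have etaj : eta j = ~~ eta i by rewrite -fij fl.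
rewrite splice1 splice2 !gg // fij fji !gfl // etaj negbK !sgN.
have ci := nc i j iS jS ji; have jgi : j != g i by rewrite eq_sym.
have := ori_splice ij (adj (gS _ iS)) (adj (gS _ jS)) _ _ _ _ _ (ci jgi).
move: (splice_end1) (splice_end2) splice_ends; rewrite !in_splice -!val_eqE /=.
move=> /and3P[p1 p2 _] /and3P[q1 q2 _] pq => /(_ p2 p1 q2 q1 pq) E.
rewrite (oriC (x := i) (y := j)) 1?neq_ltn ?ij // (oriC (x := i) (y := g i)) 1?eq_sym //.
rewrite (oriC (x := j) (y := g j)) 1?eq_sym // (oriC (x := g i) (y := g j)) //.
have -> : ori i j = 1 by rewrite /ori ij.
by rewrite E; ring.
Qed.

End Splice.

(** An arc of minimal length works: a point under it would be matched under it as well, by a shorter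
    arc. *)
Lemma innermost S f : matching S f -> S != set0 ->
  exists i, [/\ i \in S, (i < f i)%N & forall k, k \in S -> ~~ (i < k < f i)%N].
Proof.
move=> mf /set0Pn[p pS]; have [fS ff fl nc] := mf.
have [p' p'S p'l] : exists2 p', p' \in S & (p' < f p')%N.
  have := matching_neq mf pS; rewrite -val_eqE neq_ltn => /orP[l|l]; last by exists p.
  by exists (f p); rewrite ?ff ?fS.
pose P i := (i \in S) && (i < f i)%N.
have Pp' : P p' by rewrite /P p'S.
case: (@arg_minnP _ p' P (fun i : 'I_M => f i - i)%N Pp') => i /andP[iS il] min.
exists i; split=> // k kS; apply/negP => kI.
have k1 : k != i by apply: contraTneq kI => ->; rewrite ltnn.
have k2 : k != f i by apply: contraTneq kI => ->; rewrite ltnn andbF.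
have n1 : f k != i by apply: contraNneq k2 => <-; rewrite ff.
have n2 : f k != f i by apply: contraNneq k1 => e; rewrite -(ff k) // e ff.
have := nc i k iS kS k1 k2; rewrite !sepE // kI => /esym.
have := matching_neq mf kS; rewrite -val_eqE neq_ltn => /orP[l|l].
  have := min (f k); rewrite /P fS // ff // l => /(_ isT).
  by move: kI il l; clear; move=> /andP[] ? ? ? ? ? /andP[] ? ?; lia.
have := min k; rewrite /P kS l => /(_ isT).
by move: kI il l; clear; move=> /andP[] ? ? ? ? ? /andP[] ? ?; lia.
Qed.

(** A discrete form of the Umlaufsatz: a simple closed curve turns once, in the direction given by
    the position of its interior. Contracting an innermost arc changes neither side of the equation,
    and the process ends with a curve made of two arcs. *)
Lemma winding_side S f g p : circle S f g -> p \in S ->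
  winding S f g = 4 * side S p.
Proof.
have [n] := ubnP #|S|; elim: n => // n IHn in S f g p * => ltSn circ pS.
have [mf mg S0 min] := circ.
have [i [iS il adj]] := innermost mf S0.
set j := f i in il adj; have jS : j \in S by rewrite /j; case: mf => ->.
have fji : f j = i by rewrite /j; case: mf => _ ->.
have ji : j != i by rewrite -val_eqE /= gtn_eqF.
have [gij|gij] := eqVneq (g i) j; last first.
  have circ' := circle_splice circ iS erefl il adj gij.
  have pS' := splice_end1 circ iS gij.
  rewrite (winding_splice circ iS erefl il adj gij) (IHn _ _ _ _ _ circ' pS').
    rewrite (side_splice circ iS erefl il adj pS').
    by rewrite (side_const circ (splice_mem pS') pS).
  rewrite -ltnS; apply: leq_trans ltSn; rewrite ltnS (cardsD1 i S) iS add1n ltnS.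
  exact: subset_leq_card (subsetDl _ _).
have gji : g j = i by rewrite -gij; case: mg => _ ->.
have E : [set i; j] = S.
  apply: min.
  - by apply/subsetP => x; rewrite !inE => /orP[]/eqP->.
  - by apply/set0Pn; exists i; rewrite !inE eqxx.
  - by move=> x; rewrite !inE => /orP[]/eqP->; rewrite ?fji eqxx ?orbT.
  - by move=> x; rewrite !inE => /orP[]/eqP->; rewrite ?gji ?gij eqxx ?orbT.
have fl : eta j = ~~ eta i by case: mf => _ _ ->.
rewrite (side_const circ pS iS) side_step //.
have -> : prefix_sum S i = 0.
  rewrite /prefix_sum -E big1 // => x; rewrite !inE => /andP[/orP[]/eqP->].
    by rewrite ltnn.
  by rewrite ltnNge ltnW.
rewrite /winding -E big_setU1 ?inE 1?eq_sym //= big_set1 fji gji gij -/j fl sgN.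
by rewrite (oriC (x := i) (y := j)) 1?neq_ltn ?il // /ori il; ring.
Qed.

End Circles.

(** * Merging and splitting circles *)

Section Join.
Variable T : finType.
Implicit Types (r : rel T) (x y p q : T).

Definition join r x y : rel T :=
  fun p q => [|| r p q, r p x && r y q | r p y && r x q].

Section JoinEquiv.
Variables (r : rel T) (x y : T).
Hypothesis eq_r : equivalence_rel r.

Let rr p : r p p. Proof. by case: (eq_r p p p). Qed.
Let rs p q : r p q = r q p.
Proof.
apply/idP/idP => h; first by have := (eq_r p q p).2 h; rewrite rr.
by have := (eq_r q p q).2 h; rewrite rr.
Qed.
Let rt : transitive r.
Proof. by move=> q p s pq qs; rewrite (eq_r p q s).2. Qed.

Lemma join_refl p : join r x y p p. Proof. by rewrite /join rr. Qed.

Lemma join_trans : transitive (join r x y).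
Proof.
move=> q p s; rewrite /join => /or3P[h1|/andP[h1 h2]|/andP[h1 h2]].
- case/or3P=> [h|/andP[h h']|/andP[h h']]; first by rewrite (rt h1 h).
    by rewrite (rt h1 h) h' orbT.
  by rewrite (rt h1 h) h' !orbT.
- case/or3P=> [h|/andP[h h']|/andP[h h']]; first by rewrite h1 (rt h2 h) orbT.
    by rewrite h1 h' orbT.
  by rewrite (rt h1 h').
- case/or3P=> [h|/andP[h h']|/andP[h h']]; first by rewrite h1 (rt h2 h) !orbT.
    by rewrite (rt h1 h').
  by rewrite h1 h' !orbT.
Qed.

Lemma join_id : r x y -> join r x y =2 r.
Proof.
move=> xy p q; rewrite /join; case pq: (r p q) => //=.
apply/negbTE/negP => /orP[]/andP[h h'].
  by move: pq; rewrite (rt h (rt xy h')).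
by move: pq; rewrite (rt h _) //; apply: rt h'; rewrite rs.
Qed.

End JoinEquiv.

Lemma connect_rel (e r : rel T) : reflexive r -> transitive r ->
  subrel e r -> subrel (connect e) r.
Proof.
move=> rr rt sub x y /connectP[s ps ->]; elim: s x ps => //= z s IHs x /andP[xz zs].
exact: rt (sub _ _ xz) (IHs _ zs).
Qed.

End Join.

Section Involutions.
Variables (T : finType) (out inn : T -> T).

Definition link : rel T := fun p q => (out p == q) || (inn p == q).

Hypotheses (outK : involutive out) (innK : involutive inn).

Lemma link_sym : symmetric link.
Proof.
by move=> p q; rewrite /link (can2_eq outK outK) (can2_eq innK innK) ![p == _]eq_sym.
Qed.

Lemma connect_link_equiv : equivalence_rel (connect link).
Proof.
apply/equivalence_relP; split; first exact: connect0.
move=> x y xy z; apply/idP/idP; last exact: connect_trans.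
by apply: connect_trans; rewrite (sym_connect_sym link_sym).
Qed.

Lemma connect_linkC p q : connect link p q = connect link q p.
Proof. exact: sym_connect_sym link_sym _ _. Qed.

Variable w : T -> bool.
Hypotheses (w_out : forall p, w (out p) = ~~ w p) (w_inn : forall p, w (inn p) = ~~ w p).

(** Two steps along the cycle that alternates [inn] and [out], which preserve the colour. Fixing the
    other points makes this a permutation of [T]; the white points of a component then form a single
    orbit. *)
Definition walk (p : T) : T := if w p then out (inn p) else p.

Lemma walk_inj : injective walk.
Proof.
move=> p q; rewrite /walk; case wp: (w p); case wq: (w q) => //.
- by move=> /(can_inj outK)/(can_inj innK).
- by move=> e; move: wq; rewrite -e w_out w_inn wp.
- by move=> e; move: wp; rewrite e w_out w_inn wq.
Qed.

Lemma connect_walk p q : w p -> w q ->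
  connect link p q = (q \in porbit (perm walk_inj) p).
Proof.
move=> wp wq; apply/idP/idP; last first.
  case/porbitP => n ->; elim: n => [|n IHn]; first by rewrite perm1 connect0.
  rewrite expgSr permM permE; apply: connect_trans IHn _.
  rewrite /walk; case: ifP => // _.
  by apply: (@connect_trans _ _ (inn ((perm walk_inj ^+ n)%g p))); apply: connect1;
    rewrite /link eqxx ?orbT.
(* The white representative of [p]: a step of [link] either keeps it or moves it by one step of
   [walk], forwards or backwards. *)
pose c p := if w p then p else out p.
suff H : {homo c : p q / connect link p q >-> q \in porbit (perm walk_inj) p}.
  by move=> /H; rewrite /c wp wq.
move=> {wp wq q}p q; move: p q.
apply: connect_rel => [p|q p s|p q]; first exact: porbit_id.
  by rewrite -!eq_porbit_mem => /eqP<-.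
rewrite /link /c => /orP[]/eqP <-.
  by rewrite w_out; case: (w p) => /=; rewrite ?outK porbit_id.
rewrite w_inn; case wp: (w p) => /=.
  have -> : out (inn p) = perm walk_inj p by rewrite permE /walk wp.
  exact: (mem_porbit _ 1).
have -> : out p = perm walk_inj (inn p) by rewrite permE /walk w_inn wp innK.
by rewrite porbit_sym (mem_porbit _ 1).
Qed.

End Involutions.

Section Surgery.
Variables (T : finType) (out inn inn' : T -> T) (w : T -> bool).
Hypotheses (outK : involutive out) (innK : involutive inn) (innK' : involutive inn').
Hypotheses (w_out : forall p, w (out p) = ~~ w p) (w_inn : forall p, w (inn p) = ~~ w p)
  (w_inn' : forall p, w (inn' p) = ~~ w p).
Variables (a b c d : T).
Hypotheses (ab : inn a = b) (cd : inn c = d) (ac : inn' a = c) (bd : inn' b = d).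
Hypothesis same : forall p, p \notin [:: a; b; c; d] -> inn' p = inn p.
Hypothesis neq_ad : a != d.

Let r := connect (link out inn).
Let r' := connect (link out inn').

Let eq_r : equivalence_rel r. Proof. exact: connect_link_equiv. Qed.
Let eq_r' : equivalence_rel r'. Proof. exact: connect_link_equiv. Qed.
Let ba : inn b = a. Proof. by rewrite -ab innK. Qed.
Let dc : inn d = c. Proof. by rewrite -cd innK. Qed.
Let ca : inn' c = a. Proof. by rewrite -ac innK'. Qed.
Let db : inn' d = b. Proof. by rewrite -bd innK'. Qed.
Let r_inn p : r p (inn p). Proof. by rewrite /r connect1 // /link eqxx orbT. Qed.
Let r_inn' p : r' p (inn' p). Proof. by rewrite /r' connect1 // /link eqxx orbT. Qed.
Let r_out p : r p (out p). Proof. by rewrite /r connect1 // /link eqxx. Qed.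
Let r_out' p : r' p (out p). Proof. by rewrite /r' connect1 // /link eqxx. Qed.

Let r_ab : r a b. Proof. by rewrite -ab. Qed.
Let r_ba : r b a. Proof. by rewrite -ba. Qed.
Let r_cd : r c d. Proof. by rewrite -cd. Qed.
Let r_dc : r d c. Proof. by rewrite -dc. Qed.
Let r_ac' : r' a c. Proof. by rewrite -ac. Qed.
Let r_ca' : r' c a. Proof. by rewrite -ca. Qed.
Let r_bd' : r' b d. Proof. by rewrite -bd. Qed.
Let r_db' : r' d b. Proof. by rewrite -db. Qed.

Lemma surgery_sub : subrel r' (join r a c).
Proof.
apply: connect_rel; [exact: join_refl|exact: join_trans|move=> p q].
rewrite /link => /orP[]/eqP<-; first by rewrite /join r_out.
have rr x : r x x by apply: connect0.
have [|/same->] := boolP (p \in [:: a; b; c; d]); last by rewrite /join r_inn.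
rewrite !inE => /or4P[]/eqP->; rewrite ?ac ?bd ?ca ?db /join ?rr ?r_ba ?r_ab ?r_cd ?r_dc ?orbT //.
Qed.

Lemma surgery_sub' : subrel r (join r' a b).
Proof.
apply: connect_rel; [exact: join_refl|exact: join_trans|move=> p q].
rewrite /link => /orP[]/eqP<-; first by rewrite /join r_out'.
have rr x : r' x x by apply: connect0.
have [|/same<-] := boolP (p \in [:: a; b; c; d]); last by rewrite /join r_inn'.
rewrite !inE => /or4P[]/eqP->; rewrite ?ab ?cd ?ba ?dc /join ?rr ?r_ac' ?r_ca' ?r_bd' ?r_db' ?orbT //.
Qed.

(** The surgery multiplies the permutation [walk] by the transposition of [a] and [d], which changes
    the number of orbits by exactly one. Hence [a] and [d] share an orbit for one of the two
    permutations and not for the other. *)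
Lemma surgery_exclusive_white : w a -> r a c = ~~ r' a b.
Proof.
move=> wa.
have wd : w d by rewrite -cd w_inn -ac w_inn' wa.
have -> : r a c = r a d.
  by apply/idP/idP => h; apply: connect_trans h _; rewrite -/r.
have -> : r' a b = r' a d.
  by apply/idP/idP => h; apply: connect_trans h _; rewrite -/r'.
rewrite /r /r' (connect_walk outK innK w_out w_inn wa wd).
rewrite (connect_walk outK innK' w_out w_inn' wa wd).
set s := perm _; set s' := perm _.
have E : s' = (tperm a d * s)%g.
  apply/permP => p; rewrite permM; case: tpermP => [->|->|/eqP n1 /eqP n2].
  - by rewrite !permE /walk wa wd ac dc.
  - by rewrite !permE /walk wa wd ab db.
  rewrite !permE /walk.
  case: ifP => // wp; rewrite same // !inE (negPf n1) (negPf n2) /=.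
  by rewrite orbF; apply: contraTN wp => /orP[]/eqP->; rewrite -?ab -?ac ?w_inn ?w_inn' wa.
have := porbits_mul_tperm s a d; have := porbits_mul_tperm s' a d.
rewrite /= -E {1}E mulgA tperm2 mul1g neq_ad ![a \in _]porbit_sym.
by case: (d \in porbit s a); case: (d \in porbit s' a) => //=; lia.
Qed.

End Surgery.

Section SurgeryRelations.
Variables (T : finType) (out inn inn' : T -> T) (w : T -> bool).
Hypotheses (outK : involutive out) (innK : involutive inn) (innK' : involutive inn').
Hypotheses (w_out : forall p, w (out p) = ~~ w p) (w_inn : forall p, w (inn p) = ~~ w p)
  (w_inn' : forall p, w (inn' p) = ~~ w p).
Variables (a b c d : T).
Hypotheses (ab : inn a = b) (cd : inn c = d) (ac : inn' a = c) (bd : inn' b = d).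
Hypothesis same : forall p, p \notin [:: a; b; c; d] -> inn' p = inn p.
Hypotheses (neq_ad : a != d) (neq_bc : b != c).

Let r := connect (link out inn).
Let r' := connect (link out inn').

Let eq_r : equivalence_rel r. Proof. exact: connect_link_equiv. Qed.
Let eq_r' : equivalence_rel r'. Proof. exact: connect_link_equiv. Qed.

Lemma surgery_exclusive : r a c = ~~ r' a b.
Proof.
case wa : (w a); first exact: (@surgery_exclusive_white _ out inn inn' w _ _ _ _ _ _ a b c d).
have ba : inn b = a by rewrite -ab innK.
have dc : inn d = c by rewrite -cd innK.
have E : r b d = ~~ r' b a.
  apply: (@surgery_exclusive_white _ out inn inn' w _ _ _ _ _ _ b a d c) => //.
    by move=> p pN; apply: same; move: pN; rewrite !inE; case: (p == a); case: (p == b); case: (p == c); case: (p == d).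
  by rewrite -ab w_inn wa.
have i p : r p (inn p) by rewrite /r connect1 // /link eqxx orbT.
rewrite [r' a b]connect_linkC // -E; apply/idP/idP => h.
  apply: (@connect_trans _ _ a); first by rewrite -ba; apply: i.
  by apply: connect_trans h _; rewrite -cd; apply: i.
apply: (@connect_trans _ _ b); first by rewrite -ab; apply: i.
by apply: connect_trans h _; rewrite -dc; apply: i.
Qed.

Lemma surgery_merge : ~~ r a c -> r' =2 join r a c.
Proof.
rewrite surgery_exclusive negbK => r'ab p q.
apply/idP/idP; first exact: (surgery_sub outK innK innK' ab cd ac bd same).
have sub : subrel r r'.
  move=> x y /(surgery_sub' outK innK innK' ab cd ac bd same).
  by rewrite (join_id eq_r').
have r'ac : r' a c by rewrite /r' connect1 // /link ac eqxx orbT.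
case/or3P=> [/sub //|/andP[/sub h /sub h']|/andP[/sub h /sub h']].
  by apply: connect_trans h _; apply: connect_trans h'.
apply: connect_trans h _; apply: connect_trans h'.
by rewrite connect_linkC.
Qed.

Lemma surgery_split : r a c -> ~~ r' a b /\ r =2 join r' a b.
Proof.
move=> rac; split; first by rewrite -surgery_exclusive.
move=> p q; apply/idP/idP; first exact: (surgery_sub' outK innK innK' ab cd ac bd same).
have sub : subrel r' r.
  move=> x y /(surgery_sub outK innK innK' ab cd ac bd same).
  by rewrite (join_id eq_r).
have rab : r a b by rewrite /r connect1 // /link ab eqxx orbT.
case/or3P=> [/sub //|/andP[/sub h /sub h']|/andP[/sub h /sub h']].
  by apply: connect_trans h _; apply: connect_trans h'.
apply: connect_trans h _; apply: connect_trans h'.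
by rewrite connect_linkC.
Qed.

End SurgeryRelations.

(** * Monomials attached to the classes of an equivalence relation *)

Section Classes.
Variable T : finType.
Implicit Types (r : rel T) (x y p q : T) (C : {set T}).

Definition cls r p : {set T} := [set q | r p q].
Definition comps r : {set {set T}} := [set cls r p | p : T].
Definition constant_on A r (h : T -> A) := forall p q, r p q -> h p = h q.

(** For [h] constant on [C] the choice is immaterial; the default can only matter on the empty set,
    which is not a class. *)
Definition pickv A (dflt : A) (h : T -> A) C : A :=
  if [pick p in C] is Some p then h p else dflt.

Section Equiv.
Variable r : rel T.
Hypothesis eq_r : equivalence_rel r.

Let rr p : r p p. Proof. by case: (eq_r p p p). Qed.
Let rs p q : r p q = r q p.
Proof.
apply/idP/idP => h; first by have := (eq_r p q p).2 h; rewrite rr.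
by have := (eq_r q p q).2 h; rewrite rr.
Qed.

Lemma cls_refl p : p \in cls r p. Proof. by rewrite inE rr. Qed.

Lemma cls_eq p q : (cls r p == cls r q) = r p q.
Proof.
apply/eqP/idP => [/setP/(_ q)|pq]; first by rewrite !inE rr.
by apply/setP => z; rewrite !inE (eq_r p q z).2.
Qed.

Lemma cls_in p : cls r p \in comps r. Proof. exact: imset_f. Qed.

Lemma pickv_cls A (d : A) h p : exists2 q, r p q & pickv d h (cls r p) = h q.
Proof.
rewrite /pickv; case: pickP => [q|/(_ p)]; last by rewrite cls_refl.
by rewrite inE => pq; exists q.
Qed.

Lemma pickv_const A (d : A) h p : constant_on r h -> pickv d h (cls r p) = h p.
Proof. by move=> c; have [q pq ->] := pickv_cls d h p; rewrite (c _ _ pq). Qed.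

Section Join.
Variables (r' : rel T) (x y : T).
Hypotheses (Nxy : ~~ r x y) (joined : r' =2 join r x y).

Let rest := comps r :\ cls r x :\ cls r y.

Lemma rest_cls C : C \in rest -> exists2 p, C = cls r p & ~~ r x p && ~~ r y p.
Proof.
rewrite !inE => /and3P[ny nx /imsetP[p _ e]]; exists p => //.
by move: nx ny; rewrite e !cls_eq ![r p _]rs => -> ->.
Qed.

Lemma cls_joined p : cls r' p = if r x p || r y p then cls r x :|: cls r y else cls r p.
Proof.
apply/setP => q; rewrite inE joined /join.
case xp: (r x p) => /=.
  rewrite !inE [r p x]rs xp /= (eq_r x p q).2 //.
  by case: (r p q) => //=; rewrite andbC; case: (r y q) => //=; rewrite [r p y]rs;
    rewrite -(eq_r x p y).2 // (negPf Nxy).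
case yp: (r y p) => /=.
  rewrite !inE [r p x]rs xp [r p y]rs yp /= (eq_r y p q).2 // orbC.
  by case: (r p q).
by rewrite !inE [r p x]rs xp [r p y]rs yp /= orbF.
Qed.

Lemma joined_sub : subrel r r'. Proof. by move=> p q; rewrite joined /join => ->. Qed.

Lemma joined_xy : r' x y. Proof. by rewrite joined /join !rr !orbT. Qed.

Lemma big_comps2 R (idx : R) (op : Monoid.com_law idx) (F : {set T} -> R) :
  \big[op/idx]_(C in comps r) F C
  = op (F (cls r x)) (op (F (cls r y)) (\big[op/idx]_(C in rest) F C)).
Proof.
rewrite (bigD1 (cls r x)) ?cls_in //= (bigD1 (cls r y)) /=; last first.
  by rewrite cls_in cls_eq rs.
congr (op _ (op _ _)); apply: eq_bigl => C; rewrite !inE.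
by do !case: eqP => //=; rewrite ?andbT ?andbF.
Qed.

Lemma comps_joined : comps r' = (cls r x :|: cls r y) |: rest.
Proof.
apply/setP => C; rewrite in_setU1; apply/imsetP/orP.
  case=> p _ ->; rewrite cls_joined; case: ifP => [_|]; first by left.
  move=> /norP[/negPf xp /negPf yp]; right.
  by rewrite !inE !cls_eq ![r p _]rs xp yp cls_in.
case=> [/eqP->|/rest_cls[p -> /andP[/negPf xp /negPf yp]]].
  by exists x => //; rewrite cls_joined rr.
by exists p => //; rewrite cls_joined xp yp.
Qed.

Lemma union_notin_rest : cls r x :|: cls r y \notin rest.
Proof.
apply/negP => /rest_cls[p /setP e /andP[xp _]].
by have := e x; rewrite !inE rr [r p x]rs (negPf xp).
Qed.

Lemma big_comps1 R (idx : R) (op : Monoid.com_law idx) (F : {set T} -> R) :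
  \big[op/idx]_(C in comps r') F C
  = op (F (cls r x :|: cls r y)) (\big[op/idx]_(C in rest) F C).
Proof. by rewrite comps_joined big_setU1 ?union_notin_rest. Qed.

Lemma pickv_union A (d : A) h :
  exists2 q, r x q || r y q & pickv d h (cls r x :|: cls r y) = h q.
Proof.
rewrite /pickv; case: pickP => [q|/(_ x)]; last by rewrite !inE rr.
by rewrite !inE => pq; exists q.
Qed.

Lemma pickv_union_const A (d : A) h : constant_on r' h ->
  pickv d h (cls r x :|: cls r y) = h x.
Proof.
move=> c; have [q pq ->] := pickv_union d h; apply/esym/c.
rewrite joined /join rr /=; case/orP: pq => -> //.
by rewrite orbT.
Qed.

Lemma eq_big_rest R (idx : R) (op : Monoid.com_law idx) A (d : A) (h h' : T -> A) F :
  (forall p, ~~ r x p -> ~~ r y p -> h p = h' p) ->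
  \big[op/idx]_(C in rest) F (pickv d h C) = \big[op/idx]_(C in rest) F (pickv d h' C).
Proof.
move=> e; apply: eq_bigr => _ /rest_cls[p -> /andP[xp yp]]; congr F.
rewrite /pickv; case: pickP => // q; rewrite inE => pq; apply: e.
  by apply: contraNN xp => xq; rewrite rs (eq_r p q x).2 // rs.
by apply: contraNN yp => yq; rewrite rs (eq_r p q y).2 // rs.
Qed.

End Join.
End Equiv.

(** Stated additively to avoid subtraction: joining the classes of [x] and [y] replaces the marks
    [h x] and [h y] by the single mark [h' x]. *)
Lemma sum_join r r' x y (h h' : T -> bool) : equivalence_rel r -> ~~ r x y ->
  r' =2 join r x y -> constant_on r h -> constant_on r' h' ->
  (forall p, ~~ r x p -> ~~ r y p -> h p = h' p) ->
  (\sum_(C in comps r) pickv false h C + h' x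
   = \sum_(C in comps r') pickv false h' C + h x + h y)%N.
Proof.
move=> eq_r N e c c' hh'; rewrite (big_comps2 eq_r N) (big_comps1 eq_r e) /=.
rewrite (eq_big_rest eq_r _ false nat_of_bool hh') !(pickv_const eq_r) //.
rewrite (pickv_union_const eq_r e) //.
have shuffle (u v w z : nat) : (u + (v + z) + w = w + z + u + v)%N by lia.
exact: shuffle.
Qed.

Lemma card_join r r' x y : equivalence_rel r -> ~~ r x y ->
  r' =2 join r x y -> #|comps r| = #|comps r'|.+1.
Proof.
move=> eq_r N e; rewrite -!sum1_card (big_comps2 eq_r N) (big_comps1 eq_r e) /=.
by [].
Qed.

Section Monomials.
Variables (R : comRingType) (Y : T -> R).

Definition mono r (s : T -> bool) : R :=
  \prod_(C in comps r) pickv 1 (fun p => if s p then Y p else 1) C.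

Definition recolor r x (c : bool) (s : T -> bool) : T -> bool :=
  fun q => if r x q then c else s q.

Variable t2 : R.
Hypothesis Y2 : forall p, Y p * Y p = t2.

Lemma eq_mono r s s' : s =1 s' -> mono r s = mono r s'.
Proof.
move=> e; apply: eq_bigr => C _; rewrite /pickv; case: pickP => // p _.
by rewrite e.
Qed.

Section Steps.
Variables (r r' : rel T) (x y : T) (s : T -> bool).
Hypothesis eq_r : equivalence_rel r.
Hypotheses (Nxy : ~~ r x y) (joined : r' =2 join r x y).

Let rr p : r p p. Proof. by case: (eq_r p p p). Qed.
Let rs p q : r p q = r q p.
Proof.
apply/idP/idP => h; first by have := (eq_r p q p).2 h; rewrite rr.
by have := (eq_r q p q).2 h; rewrite rr.
Qed.
Let r'x q : r' x q = r x q || r y q.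
Proof. by rewrite joined /join rr /= (negPf Nxy) /= orbF. Qed.

(** Multiplication with the relation [x^2 = t2]: two marked circles merge into an unmarked one and
    leave the scalar [t2]. *)
Lemma mono_merge : constant_on r s -> constant_on r' Y ->
  mono r s = (if s x && s y then t2 else 1)
     * mono r' (recolor r' x (if s x && s y then false else s x || s y) s).
Proof.
move=> cs cY; set c := (if _ then false else _); set s' := recolor _ _ _ _.
have cY1 : constant_on r Y by move=> p q /(joined_sub joined)/cY.
rewrite /mono (big_comps2 eq_r Nxy) (big_comps1 eq_r joined) /=.
rewrite (eq_big_rest eq_r (x := x) (y := y) _ 1 (h' := fun p => if s' p then Y p else 1) id); last first.
  by move=> p xp yp; rewrite /s' /recolor r'x (negPf xp) (negPf yp).
rewrite !(pickv_const eq_r) /=; last 2 first.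
- by move=> p q pq; rewrite (cs p q) // (cY1 p q).
- by move=> p q pq; rewrite (cs p q) // (cY1 p q).
have [q xyq ->] := pickv_union eq_r x y 1 (fun p => if s' p then Y p else 1).
have xq : r' x q by rewrite r'x.
rewrite /s' /recolor xq -(cY _ _ xq) -(cY _ _ (joined_xy eq_r joined)) /c !mulrA.
by congr (_ * _); case: (s x); case: (s y); rewrite /= ?mulr1 ?mul1r ?Y2.
Qed.

(* [Y] need not be constant on the class of [r'] that is split. *)
Lemma mono_split : constant_on r' s -> constant_on r Y ->
  (Y x + Y y) * mono r' s
  = if s x then mono r s + t2 * mono r (recolor r x false (recolor r y false s))
    else mono r (recolor r x true s) + mono r (recolor r y true s).
Proof.
move=> cs cY.
have sy : s y = s x by apply/esym/cs/(joined_xy eq_r joined).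
have cs1 : constant_on r s by move=> p q /(joined_sub joined)/cs.
have crec c z s1 : constant_on r s1 -> constant_on r (recolor r z c s1).
  by move=> c1 p q pq; rewrite /recolor (c1 _ _ pq) ![r z _]rs (eq_r p q z).2.
have cm s1 : constant_on r s1 -> constant_on r (fun p => if s1 p then Y p else 1).
  by move=> c1 p q pq; rewrite (c1 p q) // (cY p q).
have monoE s1 : constant_on r s1 -> mono r s1 = (if s1 x then Y x else 1) *
   ((if s1 y then Y y else 1) *
    \prod_(C in comps r :\ cls r x :\ cls r y) pickv 1 (fun p => if s1 p then Y p else 1) C).
  by move=> c1; rewrite /mono (big_comps2 eq_r Nxy) /= !(pickv_const eq_r) //; apply: cm.
have er s1 : (forall p, ~~ r x p -> ~~ r y p -> s1 p = s p) ->
   \prod_(C in comps r :\ cls r x :\ cls r y) pickv 1 (fun p => if s1 p then Y p else 1) C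
   = \prod_(C in comps r :\ cls r x :\ cls r y) pickv 1 (fun p => if s p then Y p else 1) C.
  move=> e; apply: (eq_big_rest eq_r _ 1 id) => p xp yp.
  by rewrite e.
rewrite {1}/mono (big_comps1 eq_r joined) /=.
have [q xyq ->] := pickv_union eq_r x y 1 (fun p => if s p then Y p else 1).
have -> : s q = s x by apply/esym/cs; rewrite r'x.
(* Whichever of the two values is picked, its product with their sum is [t2 + Y x * Y y], which is
   the deformed coproduct of a marked circle. *)
have Yq : Y q = Y x \/ Y q = Y y.
  by case/orP: xyq => /cY ->; [left|right].
have c1 := crec true x _ cs1; have c2 := crec true y _ cs1.
have c3 := crec false x _ (crec false y _ cs1).
rewrite !monoE //.
rewrite (er (recolor r x true s)); last by move=> p xp _; rewrite /recolor (negPf xp).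
rewrite (er (recolor r y true s)); last by move=> p _ yp; rewrite /recolor (negPf yp).
rewrite (er (recolor r x false (recolor r y false s))); last first.
  by move=> p xp yp; rewrite /recolor (negPf xp) (negPf yp).
rewrite /recolor !rr (negPf Nxy) [r y x]rs (negPf Nxy) sy.
set P := \prod_(_ in _) _.
case: (s x); last by ring.
by case: Yq => ->; [rewrite -(Y2 x)|rewrite -(Y2 y)]; ring.
Qed.

End Steps.
End Monomials.
End Classes.

(** * Cup diagrams without rays *)

Section Heights.
Variables (M : nat) (l : weight M).
Implicit Types (i j : 'I_M) (k : nat).

Definition hgt k : int := \sum_(x < M | (x < k)%N) sg (l x).

Lemma hgt0 : hgt 0 = 0. Proof. by rewrite /hgt big_pred0. Qed.

Lemma hgtS i : hgt i.+1 = hgt i + sg (l i).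
Proof.
rewrite /hgt (bigD1 i) ?ltnSn //= addrC; congr (_ + _); apply: eq_bigl => x.
by rewrite ltnS [in RHS]ltn_neqAle andbC.
Qed.

Lemma hgt_parity k : (k <= M)%N -> exists c : nat, hgt k = c%:Z + c%:Z - k%:Z.
Proof.
elim: k => [|k IHk] kM; first by exists 0%N; rewrite hgt0.
have [c Hc] := IHk (ltnW kM); have := hgtS (Ordinal kM); rewrite /= Hc => ->.
by exists (c + l (Ordinal kM))%N; case: (l _) => /=; rewrite /sg; lia.
Qed.

Lemma sum_sg (A : {set 'I_M}) :
  \sum_(x in A) sg (l x) = #|[set x in A | l x]|%:Z - #|[set x in A | ~~ l x]|%:Z.
Proof.
rewrite (bigID l) /=; congr (_ + _).
  rewrite -sum1_card (raddf_sum Posz) /=; apply: eq_big => [x|x /andP[_ ->] //].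
  by rewrite !inE.
rewrite -sum1_card (raddf_sum Posz) -sumrN /=; apply: eq_big => [x|x /andP[_ /negPf->] //].
by rewrite !inE.
Qed.

Lemma balancedE i j : (i < j)%N -> balanced l i j = (hgt j == hgt i.+1).
Proof.
move=> ij; rewrite /balanced -eqz_nat -subr_eq0 -[RHS]subr_eq0.
have -> : hgt j = hgt i.+1 + \sum_(x in [set x : 'I_M | (i < x < j)%N]) sg (l x).
  rewrite /hgt (bigID (fun x : 'I_M => (x < i.+1)%N)) /=; congr (_ + _).
    by apply: eq_bigl => x; rewrite andb_idl // ltnS => /leq_ltn_trans->.
  by apply: eq_bigl => x; rewrite inE -leqNgt andbC.
rewrite [X in _ = (X == _)]addrC addKr sum_sg; congr (Posz _ - Posz _ == 0).
  by apply: eq_card => x; rewrite !inE.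
by apply: eq_card => x; rewrite !inE.
Qed.

(** In terms of the lattice path [hgt], a cup leads from an up-step to the first return to the level
    at which this step starts. *)
Lemma cupP i j : reflect [/\ l i, ~~ l j, (i < j)%N, hgt j.+1 = hgt i
    & forall k, (i < k <= j)%N -> hgt i < hgt k] (cup l i j).
Proof.
apply: (iffP and3P) => [[li /and3P[ij lj bij] /forallP min]|[li lj ij hj pos]].
  move: bij; rewrite balancedE // => /eqP hj.
  have hj1 : hgt j.+1 = hgt i by rewrite hgtS (negPf lj) hj hgtS li /sg addrK.
  split=> // k0 ik0; apply: contraT => nk0.
  pose P k := (i < k <= j)%N && (hgt k <= hgt i).
  (* If the path came back before the end of the cup, the step of its first return would be a vertex
     closing the cup earlier than [j]. *)
  have exP : exists k, P k by exists k0; rewrite /P ik0 leNgt.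
  case: (ex_minnP exP) => -[|x] /andP[/andP[ix xj] hx] minx //.
  have xM : (x < M)%N by apply: leq_trans xj (ltnW (ltn_ord j)).
  pose y := Ordinal xM.
  have {}ix : (i < x)%N.
    move: ix; rewrite ltnS leq_eqVlt => /orP[/eqP e|//]; move: hx.
    by rewrite -e hgtS li /sg; lia.
  have hy : hgt i < hgt x.
    rewrite ltNge; apply/negP => h; have := minx x; rewrite /P ix (ltnW xj) h ltnn.
    by move/(_ isT).
  have := hgtS y; rewrite /= => e.
  have ly : ~~ l y by apply/negP => ly; move: hx; rewrite e ly /sg; lia.
  have := min y; rewrite /closes ix ly balancedE // hgtS li.
  have -> : hgt y = hgt i + sg true.
    by move: hx hy; rewrite e (negPf ly) /sg /=; lia.
  by rewrite eqxx /= leqNgt xj.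
have cl : closes l i j.
  rewrite /closes ij lj balancedE //; apply/eqP.
  by move: hj; rewrite !hgtS li (negPf lj) /sg => /eqP; rewrite subr_eq => /eqP.
split=> //; apply/forallP => k; apply/implyP; rewrite /closes => /and3P[ik lk].
rewrite balancedE // => /eqP hk; rewrite leqNgt; apply/negP => kj.
have := pos k.+1; rewrite kj ltnS (ltnW ik) => /(_ isT).
by rewrite hgtS (negPf lk) hk hgtS li /sg addrK ltxx.
Qed.

Lemma cup_lt i j : cup l i j -> (i < j)%N. Proof. by case/cupP. Qed.
Lemma cup_left i j : cup l i j -> l i. Proof. by case/cupP. Qed.
Lemma cup_right i j : cup l i j -> ~~ l j. Proof. by case/cupP. Qed.

(** A height has the parity of its position, and the path is at the same height at [i] and at
    [j.+1]. *)
Lemma cup_parity i j : cup l i j -> odd j = ~~ odd i.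
Proof.
case/cupP => _ _ _ e _; have [c ec] := hgt_parity (ltn_ord j).
have [c' ec'] := hgt_parity (ltnW (ltn_ord i)).
by move: e; rewrite ec ec'; lia.
Qed.

Lemma cup_noncross i j i' j' : cup l i j -> cup l i' j' ->
  (i < i')%N -> (i' < j)%N -> (j' < j)%N.
Proof.
case/cupP => _ _ _ e pos /cupP[_ _ _ e' pos'] ii' i'j.
rewrite ltnNge; apply/negP => jj'.
have h1 : hgt i < hgt i' by apply: pos; rewrite ii' ltnW.
move: jj'; rewrite leq_eqVlt => /orP[/eqP ej|jj'].
  by move: h1; rewrite -e' -ej e ltxx.
have := pos' j.+1; rewrite jj' ltnS ltnW // e => /(_ isT).
by move/(lt_trans h1); rewrite ltxx.
Qed.

Lemma cup_uniq_r i j j' : cup l i j -> cup l i j' -> j = j'.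
Proof.
move=> /and3P[_ c /forallP min] /and3P[_ c' /forallP min'].
apply/val_inj/eqP; rewrite eqn_leq.
by rewrite (implyP (min j')) // (implyP (min' j)).
Qed.

Lemma cup_uniq_l i i' j : cup l i j -> cup l i' j -> i = i'.
Proof.
have H (u v w : 'I_M) : cup l u w -> cup l v w -> (u < v)%N -> false.
  move=> c c' uv; have := cup_noncross c c' uv (cup_lt c').
  by rewrite ltnn.
move=> c c'; apply/val_inj; case: (ltngtP i i') => // h.
  by have := H _ _ _ c c' h.
by have := H _ _ _ c' c h.
Qed.

Lemma arc_sym i j : arc l i j = arc l j i. Proof. by rewrite /arc orbC. Qed.

Lemma arc_uniq i j j' : arc l i j -> arc l i j' -> j = j'.
Proof.
case/orP=> c /orP[] c'.
- exact: cup_uniq_r c c'.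
- by have := cup_left c; rewrite (negPf (cup_right c')).
- by have := cup_right c; rewrite (cup_left c').
- exact: cup_uniq_l c c'.
Qed.

Definition mate i : 'I_M := if [pick j | arc l i j] is Some j then j else i.

Lemma arc_mate i j : arc l i j -> mate i = j.
Proof.
rewrite /mate => a; case: pickP => [j' /arc_uniq/(_ a)//|/(_ j)].
by rewrite a.
Qed.

Lemma mate_arc i : ~~ ray l i -> arc l i (mate i).
Proof.
rewrite negb_forall => /existsP[j]; rewrite negbK => a.
by rewrite (arc_mate a).
Qed.

Section Closed.
Hypothesis no_ray : forall i, ~~ ray l i.

Lemma arcE i j : arc l i j = (mate i == j).
Proof.
apply/idP/eqP => [/arc_mate //|<-]; exact: mate_arc.
Qed.

Lemma mateK : involutive mate.
Proof. by move=> i; apply: arc_mate; rewrite arc_sym arcE. Qed.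

Lemma mate_label i : l (mate i) = ~~ l i.
Proof.
have := mate_arc (no_ray i) => /orP[] c.
  by rewrite (cup_left c) (negPf (cup_right c)).
by rewrite (cup_left c) (cup_right c).
Qed.

Lemma mate_odd i : odd (mate i) = ~~ odd i.
Proof.
have := mate_arc (no_ray i) => /orP[/cup_parity //|/cup_parity ->].
by rewrite negbK.
Qed.

Lemma label_lt i : l i = (i < mate i)%N.
Proof.
have := mate_arc (no_ray i) => /orP[] c.
  by rewrite (cup_left c) (cup_lt c).
by rewrite (negPf (cup_right c)) ltnNge ltnW // (cup_lt c).
Qed.

Lemma cupE i j : cup l i j = (i < j)%N && (mate i == j).
Proof.
apply/idP/andP => [c|[ij /eqP e]].
  by rewrite (cup_lt c) (@arc_mate i j) // /arc c.
have := mate_arc (no_ray i); rewrite e => /orP[//|/cup_lt].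
by rewrite ltnNge ltnW.
Qed.

Lemma sep_cup i j (k : 'I_M) : cup l i j -> k != i -> k != j -> sep i j k = sep i j (mate k).
Proof.
move=> c ki kj; have ij := cup_lt c; have ej : mate i = j.
  by apply: arc_mate; rewrite /arc c.
have mi : mate k != i by apply: contraNneq kj => e; rewrite -[k]mateK e ej.
have mj : mate k != j by apply: contraNneq ki => e; rewrite -[k]mateK e -ej mateK.
rewrite !sepE //.
have H (u v : 'I_M) : cup l u v -> u != i -> v != j -> u != j -> v != i ->
    (i < u < j)%N = (i < v < j)%N.
  move=> c' ui vj uj vi; have uv := cup_lt c'; apply/andP/andP => [[iu uj']|[iv vj']].
    by rewrite (ltn_trans iu uv) (cup_noncross c c').
  rewrite (ltn_trans uv vj'); split=> //.
  move: ui; rewrite -val_eqE neq_ltn => /orP[ui|//].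
  by have := cup_noncross c' c ui iv; rewrite ltnNge ltnW.
by have := mate_arc (no_ray k) => /orP[] c'; [|symmetry]; apply: H.
Qed.

Lemma mate_sep i (k : 'I_M) : k != i -> k != mate i ->
  sep i (mate i) k = sep i (mate i) (mate k).
Proof.
have := mate_arc (no_ray i) => /orP[] c n1 n2; first exact: sep_cup.
by rewrite /sep addbC [RHS]addbC; apply: sep_cup.
Qed.

End Closed.
End Heights.

(** The partner of an up-step is the first later return to its initial level, that of a down-step
    comes from the last earlier visit to its final level; a nonnegative path ending at 0 has
    both. *)
Lemma no_ray_height M (l : weight M) :
  (forall k, (k <= M)%N -> 0 <= hgt l k) -> hgt l M = 0 -> forall i, ~~ ray l i.
Proof.
move=> pos tot i; rewrite negb_forall; apply/existsP.
suff [j c] : exists j, arc l i j by exists j; rewrite negbK.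
case li : (l i).
  pose P k := (i < k <= M)%N && (hgt l k <= hgt l i).
  have exP : exists k, P k.
    by exists M; rewrite /P ltn_ord leqnn tot pos // ltnW.
  case: (ex_minnP exP) => -[|x] /andP[/andP[ix xM] hx] minx //.
  have gt k : (i < k <= x)%N -> hgt l i < hgt l k.
    case/andP=> ik kx; rewrite ltNge; apply/negP => h; have := minx k.
    by rewrite /P ik h (leq_trans kx (ltnW xM)) ltnNge kx => /(_ isT).
  have {}ix : (i < x)%N.
    move: ix; rewrite ltnS leq_eqVlt => /orP[/eqP e|//]; move: hx.
    by rewrite -e hgtS li /sg; lia.
  have := hgtS l (Ordinal xM); rewrite /= => e.
  have hxi : hgt l i < hgt l x by apply: gt; rewrite ix leqnn.
  have lx : ~~ l (Ordinal xM) by apply/negP => lx; move: hx; rewrite e lx /sg; lia.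
  exists (Ordinal xM); rewrite /arc; apply/orP; left; apply/cupP; split=> //.
  by move: hx; rewrite e (negPf lx) /sg; lia.
pose P k := (k < i)%N && (hgt l k <= hgt l i.+1).
have hi : hgt l i.+1 = hgt l i - 1 by rewrite hgtS li.
have hi0 : 0 <= hgt l i.+1 by apply: pos.
have exP : exists k, P k.
  exists 0%N; rewrite /P hgt0 hi0 andbT lt0n; apply/eqP => e.
  by move: hi0; rewrite hi e hgt0.
have ubP k : P k -> (k <= i)%N by case/andP=> /ltnW.
case: (ex_maxnP exP ubP) => x /andP[xi hx] maxx.
have xM : (x < M)%N by apply: ltn_trans xi (ltn_ord i).
have gt k : (x < k <= i)%N -> hgt l i.+1 < hgt l k.
  case/andP=> xk; rewrite leq_eqVlt => /orP[/eqP->|ki]; first by rewrite hi; lia.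
  rewrite ltNge; apply/negP => h; have := maxx k.
  by rewrite /P ki h leqNgt xk => /(_ isT).
have := hgtS l (Ordinal xM); rewrite /= => e.
have gx : hgt l i.+1 < hgt l x.+1 by apply: gt; rewrite ltnSn.
have lx : l (Ordinal xM).
  by apply: contraT => lx; move: gx; rewrite e (negPf lx) /sg; lia.
have ex : hgt l x = hgt l i.+1 by move: gx; rewrite e lx /sg; lia.
exists (Ordinal xM); rewrite /arc; apply/orP; right; apply/cupP; split; rewrite ?li //=.
by move=> k; rewrite ex; apply: gt.
Qed.

(** * Surgeries in the deformed algebra *)

Section Stack.
Variables (M : nat) (d b a : weight M).
Hypotheses (d_closed : forall i, ~~ ray d i) (b_closed : forall i, ~~ ray b i)
  (a_closed : forall i, ~~ ray a i).
Implicit Types (i j : 'I_M) (S : {set 'I_M}) (p q : point M).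

Definition outer p : point M := (p.1, if p.1 then mate a p.2 else mate d p.2).
Definition inner S p : point M :=
  if p.2 \in S then (~~ p.1, p.2) else (p.1, mate b p.2).
(** Arcs change the parity of the vertex and vertical segments change the line, so this is a proper
    bicolouring of the stacked diagrams at every stage. *)
Definition white p : bool := odd p.2 (+) p.1.

Lemma stackedE S : stacked d b a S =2 link outer (inner S).
Proof.
case=> l i [l' j]; rewrite /stacked /link /outer /inner /= !arcE //.
by case: l; case: l'; case: (i \in S); rewrite !xpair_eqE /= ?andbT ?andbF ?orbF.
Qed.

Definition stack S : rel (point M) := connect (stacked d b a S).

Lemma stack_link S : stack S =2 connect (link outer (inner S)).
Proof. exact: eq_connect (stackedE S). Qed.

Definition mate_stable S := forall i, (mate b i \in S) = (i \in S).

Lemma outerK : involutive outer.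
Proof. by case=> -[] i; rewrite /outer /= mateK. Qed.

Lemma innerK S : mate_stable S -> involutive (inner S).
Proof.
move=> st [l i]; rewrite /inner /=; case: (boolP (i \in S)) => iS /=.
  by rewrite iS negbK.
by rewrite st (negPf iS) mateK.
Qed.

Lemma white_outer p : white (outer p) = ~~ white p.
Proof. by case: p => -[] i; rewrite /white /outer /= mate_odd // addNb. Qed.

Lemma white_inner S p : white (inner S p) = ~~ white p.
Proof.
case: p => l i; rewrite /white /inner /=; case: ifP => _ /=; first by rewrite addbN.
by rewrite mate_odd // addNb.
Qed.

Lemma stack_equiv S : mate_stable S -> equivalence_rel (stack S).
Proof.
move=> st p q s; rewrite !stack_link.
exact: (connect_link_equiv outerK (innerK st) p q s).
Qed.

Section OneSurgery.
Variables (S : {set 'I_M}) (i j : 'I_M).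
Hypotheses (st : mate_stable S) (iS : i \notin S) (ij : mate b i = j).
Let S' := i |: (j |: S).

Let jS : j \notin S. Proof. by rewrite -ij st. Qed.
Let ji : mate b j = i. Proof. by rewrite -ij mateK. Qed.

Lemma mate_stableU : mate_stable S'.
Proof.
move=> k; rewrite !inE st !(can2_eq (mateK b_closed) (mateK b_closed)) ij ji.
by rewrite orbCA.
Qed.

Let ab : inner S (false, i) = (false, j). Proof. by rewrite /inner /= (negPf iS) ij. Qed.
Let cd : inner S (true, i) = (true, j). Proof. by rewrite /inner /= (negPf iS) ij. Qed.
Let ac : inner S' (false, i) = (true, i). Proof. by rewrite /inner /= !inE eqxx. Qed.
Let bd : inner S' (false, j) = (true, j).
Proof. by rewrite /inner /= !inE eqxx orbT. Qed.
Let same p : p \notin [:: (false, i); (false, j); (true, i); (true, j)] ->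
  inner S' p = inner S p.
Proof.
case: p => l k; rewrite /inner !inE !xpair_eqE /=.
by case: l; case: (k == i); case: (k == j).
Qed.

Lemma stack_merge : ~~ stack S (false, i) (true, i) ->
  stack S' =2 join (stack S) (false, i) (true, i).
Proof.
rewrite stack_link => N p q; rewrite /join !stack_link.
exact: (surgery_merge outerK (innerK st) (innerK mate_stableU) white_outer
  (white_inner S) (white_inner S') ab cd ac bd same _ _ N).
Qed.

Lemma stack_split : stack S (false, i) (true, i) ->
  ~~ stack S' (false, i) (false, j) /\
  stack S =2 join (stack S') (false, i) (false, j).
Proof.
rewrite stack_link => N.
have [] := surgery_split outerK (innerK st) (innerK mate_stableU) white_outer
  (white_inner S) (white_inner S') ab cd ac bd same _ _ N => // N1 N2.
by split=> [|p q]; rewrite /join !stack_link.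
Qed.

End OneSurgery.

(** The list [cs] holds the cups of [b] still to be replaced; the complement of [points cs] is the
    set [S] of the vertices already joined vertically. *)
Definition points (cs : seq ('I_M * 'I_M)) : {set 'I_M} :=
  [set x | has (fun c => (x == c.1) || (x == c.2)) cs].

Definition good (cs : seq ('I_M * 'I_M)) : bool :=
  uniq cs && all (fun c => cup b c.1 c.2) cs.

Lemma good_step i j cs : good ((i, j) :: cs) ->
  [/\ good cs, mate b i = j, i \in points ((i, j) :: cs)
    & i |: (j |: ~: points ((i, j) :: cs)) = ~: points cs].
Proof.
rewrite /good /= => /andP[/andP[ijcs ucs] /andP[c ccs]]; split=> //.
- by rewrite ucs.
- by apply: arc_mate; rewrite /arc c.
- by rewrite inE /= eqxx.
have H k : k \in points cs -> k != i /\ k != j.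
  rewrite inE => /hasP[[u v] uv /= kuv].
  have c' : cup b u v by apply: (allP ccs _ uv).
  have key : (u, v) != (i, j) by apply: contraNneq ijcs => <-.
  split; apply: contraNneq key => e.
    case/orP: kuv => /eqP; rewrite e => e'.
      by rewrite -e' in c'; rewrite -e' (cup_uniq_r c c').
    by rewrite -e' in c'; have := cup_right c'; rewrite (cup_left c).
  case/orP: kuv => /eqP; rewrite e => e'.
    by rewrite -e' in c'; have := cup_right c; rewrite (cup_left c').
  by rewrite -e' in c'; rewrite -e' (cup_uniq_l c c').
apply/setP => k; rewrite !inE /=.
have [kcs|] := boolP (has _ cs); last by rewrite orbF; case: (k == i); case: (k == j).
have := H k; rewrite inE kcs => /(_ isT)[/negPf-> /negPf->].
by rewrite orbT.
Qed.

Lemma points_stable cs : good cs -> mate_stable (~: points cs).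
Proof.
elim: cs => [|[i j] cs IHcs] g k; first by rewrite !inE.
have [gcs ij _ _] := good_step g; have ji : mate b j = i by rewrite -ij mateK.
have := IHcs gcs k; rewrite !inE /= !(can2_eq (mateK b_closed) (mateK b_closed)) ij ji.
by move/negb_inj ->; rewrite [(k == j) || _]orbC.
Qed.

End Stack.

(** Parity and label both change along an arc, so this is constant on the circles that [eta]
    orients; it tells which root is the value of x there. *)
Definition twist M (eta : weight M) (i : 'I_M) : bool := odd i (+) eta i.

Section Deformation.
Variable K : fieldType.
Implicit Type M : nat.

(* [true] and [false] index the two roots of x^2 = t^2. *)
Definition root_of (c : bool) : {poly K} := if c then 'X else - 'X.

Lemma root_of_sq c : root_of c * root_of c = 'X^2.
Proof. by case: c; rewrite /root_of ?mulrNN expr2. Qed.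

Definition value M (eta : weight M) (p : point M) : {poly K} := root_of (twist eta p.2).

Variables (M : nat) (d b a : weight M).
Hypotheses (d_closed : forall i, ~~ ray d i) (b_closed : forall i, ~~ ray b i)
  (a_closed : forall i, ~~ ray a i).
Implicit Types (i j : 'I_M) (cs : seq ('I_M * 'I_M)) (s : labelling M) (eta : weight M).

Definition stage cs : rel (point M) := stack d b a (~: points cs).

Definition compatible cs eta := constant_on (stage cs) (fun p => twist eta p.2).

(** The factor G of the overview, for the surgeries left in [cs]. A split contributes 0 when the two
    new circles carry opposite roots, and twice the common root otherwise. *)
Fixpoint saddles cs eta : {poly K} :=
  if cs is (i, j) :: cs' then
    (if stage cs (false, i) (true, i) then value eta (false, i) + value eta (false, j) else 1)
    * saddles cs' eta
  else 1.

Lemma compatible_value cs eta : compatible cs eta -> constant_on (stage cs) (value eta).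
Proof. by move=> c p q pq; rewrite /value (c _ _ pq). Qed.

Lemma stage_equiv cs : good b cs -> equivalence_rel (stage cs).
Proof. by move=> g; apply: stack_equiv => //; apply: points_stable. Qed.

Lemma stage_sym cs p q : good b cs -> stage cs p q = stage cs q p.
Proof.
move=> g; rewrite /stage !stack_link //.
by apply: connect_linkC; [exact: outerK|apply: innerK => //; apply: points_stable].
Qed.

Lemma stage_congr cs x y p : good b cs -> stage cs x y -> stage cs p x = stage cs p y.
Proof.
move=> g xy; rewrite ![stage cs p _]stage_sym //.
exact: (stage_equiv g x y p).2.
Qed.

Lemma stage_merge i j cs : good b ((i, j) :: cs) ->
  ~~ stage ((i, j) :: cs) (false, i) (true, i) ->
  stage cs =2 join (stage ((i, j) :: cs)) (false, i) (true, i).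
Proof.
move=> g N; have [gcs ij ip e] := good_step g.
rewrite /stage -e; apply: stack_merge => //; first exact: points_stable.
by rewrite inE negbK.
Qed.

Lemma stage_split i j cs : good b ((i, j) :: cs) ->
  stage ((i, j) :: cs) (false, i) (true, i) ->
  ~~ stage cs (false, i) (false, j) /\
  stage ((i, j) :: cs) =2 join (stage cs) (false, i) (false, j).
Proof.
move=> g N; have [gcs ij ip e] := good_step g.
rewrite /stage -e; apply: stack_split => //; first exact: points_stable.
by rewrite inE negbK.
Qed.

Lemma constant_merge A r r' (x y : point M) (h : point M -> A) :
  r' =2 join r x y -> constant_on r h -> h x = h y -> constant_on r' h.
Proof.
move=> e c hxy p q; rewrite e => /or3P[/c //|/andP[/c-> /c<-] //|/andP[/c-> /c<-] //].
Qed.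

Lemma constant_sub A r r' (h : point M -> A) :
  subrel r' r -> constant_on r h -> constant_on r' h.
Proof. by move=> e c p q /e/c. Qed.

Lemma compatible_step i j cs eta : good b ((i, j) :: cs) ->
  compatible ((i, j) :: cs) eta -> compatible cs eta.
Proof.
move=> g c; have [N|N] := boolP (stage ((i, j) :: cs) (false, i) (true, i)).
  have [_ e] := stage_split g N.
  by apply: constant_sub c => p q pq; rewrite e /join pq.
exact: constant_merge (stage_merge g N) c erefl.
Qed.

Lemma compatible_back i j cs eta : good b ((i, j) :: cs) -> compatible cs eta ->
  (stage ((i, j) :: cs) (false, i) (true, i) -> twist eta i = twist eta j) ->
  compatible ((i, j) :: cs) eta.
Proof.
move=> g c h; have [N|N] := boolP (stage ((i, j) :: cs) (false, i) (true, i)).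
  by have [_ e] := stage_split g N; apply: constant_merge e c _; apply: h.
have e := stage_merge g N.
by apply: constant_sub c => p q pq; rewrite e /join pq.
Qed.

(** Going back from the final diagram, undoing a merge refines the classes, and undoing a split
    joins two classes on which the roots agree because the factor is not zero. *)
Lemma saddles_compatible cs eta : good b cs -> compatible [::] eta ->
  saddles cs eta != 0 -> compatible cs eta.
Proof.
move=> + c0; elim: cs => [//|[i j] cs IHcs] g /=; rewrite mulf_eq0 negb_or.
have [gcs ij _ _] := good_step g => /andP[s0 /(IHcs gcs) c].
apply: compatible_back g c _ => N; move: s0; rewrite N /value /root_of /=.
by case: (twist eta i); case: (twist eta j); rewrite // ?addNr ?subrr eqxx.
Qed.

(* [F], a function of the fixed points, is an integral combination of
   monomials in the circles of the final diagram, with reduction [alpha]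
   modulo the deformation parameter. *)
Definition reduces (F : weight M -> {poly K}) (alpha : labelling M -> K) : Prop :=
  exists r : labelling M -> {poly K},
    [/\ forall s, (r s).[0] = alpha s,
        forall s, r s != 0 -> constant_on (stage [::]) s
      & forall eta, compatible [::] eta ->
          F eta = \sum_s r s * mono (value eta) (stage [::]) s].

Lemma reducesD F G alpha beta : reduces F alpha -> reduces G beta ->
  reduces (fun eta => F eta + G eta) (fun s => alpha s + beta s).
Proof.
move=> [r [r0 rc rE]] [q [q0 qc qE]]; exists (fun s => r s + q s); split.
- by move=> s; rewrite hornerD r0 q0.
- move=> s; have [->|/rc //] := eqVneq (r s) 0; rewrite add0r; exact: qc.
move=> eta c; rewrite rE // qE // -big_split; apply: eq_bigr => s _.
by rewrite /= mulrDl.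
Qed.

Lemma reducesZ p F alpha : reduces F alpha ->
  reduces (fun eta => p * F eta) (fun s => p.[0] * alpha s).
Proof.
move=> [r [r0 rc rE]]; exists (fun s => p * r s); split.
- by move=> s; rewrite hornerM r0.
- by move=> s; rewrite mulf_eq0 negb_or => /andP[_ /rc].
move=> eta c; rewrite rE // mulr_sumr; apply: eq_bigr => s _.
by rewrite mulrA.
Qed.

Lemma reduces_ext F G alpha beta : reduces F alpha ->
  (forall eta, compatible [::] eta -> F eta = G eta) -> alpha =1 beta -> reduces G beta.
Proof.
move=> [r [r0 rc rE]] e ea; exists r; split=> // [s|eta c]; first by rewrite r0 ea.
by rewrite -e // rE.
Qed.

Lemma recolor_constant cs p c s : good b cs ->
  constant_on (stage cs) s -> constant_on (stage cs) (recolor (stage cs) p c s).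
Proof.
by move=> g cs1 x y xy; rewrite /recolor (cs1 _ _ xy) (stage_congr p g xy).
Qed.

Lemma relabelE cs p c s : relabel (stacked d b a (~: points cs)) p c s
  =1 recolor (stage cs) p c s.
Proof. by move=> q; rewrite ffunE. Qed.

Lemma relabel_constant cs p c s : good b cs -> constant_on (stage cs) s ->
  constant_on (stage cs) (relabel (stacked d b a (~: points cs)) p c s).
Proof.
by move=> g h x y xy; rewrite !relabelE; apply: recolor_constant xy.
Qed.

Lemma constant_stage_step i j cs s : good b ((i, j) :: cs) ->
  constant_on (stage ((i, j) :: cs)) s ->
  stage ((i, j) :: cs) (false, i) (true, i) -> constant_on (stage cs) s.
Proof.
move=> g h N; have [_ e] := stage_split g N.
by apply: constant_sub h => p q pq; rewrite e /join pq.
Qed.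

Lemma merge_constant i j cs s c : good b ((i, j) :: cs) ->
  constant_on (stage ((i, j) :: cs)) s ->
  ~~ stage ((i, j) :: cs) (false, i) (true, i) ->
  constant_on (stage cs) (relabel (stacked d b a (~: points cs)) (false, i) c s).
Proof.
move=> g h N; have e := stage_merge g N; have [gcs _ _ _] := good_step g.
have eq_r := stage_equiv g.
move=> p q pq; rewrite !relabelE /recolor (stage_congr _ gcs pq).
case: ifP => // Nq; move: pq; rewrite e => /or3P[/h //|/andP[px yq]|/andP[py xq]].
  by move: Nq; rewrite e /join yq (eq_r (false, i) (false, i) (false, i)).1 orbT.
by move: Nq; rewrite e /join xq.
Qed.

Lemma surgeriesE i j cs s : good b ((i, j) :: cs) ->
  surgeries d b a (~: points ((i, j) :: cs)) ((i, j) :: cs) s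
  = flatten [seq surgeries d b a (~: points cs) cs t
            | t <- surgery (stacked d b a (~: points ((i, j) :: cs)))
                     (stacked d b a (~: points cs)) i j s].
Proof. by move=> g; have [_ _ _ e] := good_step g; rewrite -e. Qed.

(** The terms by which deformed merges and splits differ from the rules of [surgery] carry a factor
    ['X^2], so they disappear at 0. *)
Lemma reduces_surgeries cs s : good b cs -> constant_on (stage cs) s ->
  reduces (fun eta => saddles cs eta * mono (value eta) (stage cs) s)
    (fun s' => (count (pred1 s') (surgeries d b a (~: points cs) cs s))%:R).
Proof.
elim: cs s => [|[i j] cs IHcs] s g hs.
  exists (fun s' => (s == s')%:R); split.
  - by move=> s'; rewrite -polyC_natr hornerC /= addn0.
  - by move=> s'; have [<- //|_] := eqVneq s s'; rewrite eqxx.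
  move=> eta _; rewrite mul1r (bigD1 s) //= eqxx mul1r big1 ?addr0 // => s' /negPf n.
  by rewrite eq_sym n mul0r.
have [gcs ij ip e] := good_step g.
rewrite surgeriesE // /surgery; set e' := stacked _ _ _ (~: points cs).
have sq eta p : value eta p * value eta p = 'X^2 by apply: root_of_sq.
(* At a point that is not compatible with the present stage the factor [saddles] is 0; the rules for
   monomials are only needed where the values are constant on circles. *)
have zeroF eta (P Q : {poly K}) : (compatible cs eta -> P = Q) ->
    compatible [::] eta -> saddles cs eta * P = saddles cs eta * Q.
  have [-> _ _|s0 H c] := eqVneq (saddles cs eta) 0; first by rewrite !mul0r.
  by rewrite H //; apply: saddles_compatible.
have [N|N] := boolP (stage ((i, j) :: cs) (false, i) (true, i)).
  have [Nij es] := stage_split g N; have hs' := constant_stage_step g hs N.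
  rewrite [connect _ _ _]N /=.
  have E eta : compatible cs eta -> _ := fun c => mono_split (sq eta)
    (stage_equiv gcs) Nij es hs (compatible_value c).
  case sx: (s (false, i)); rewrite /= ?cats0.
    pose s2 := relabel e' (false, i) false (relabel e' (false, j) false s).
    have hs2 : constant_on (stage cs) s2 by do 2!apply: relabel_constant => //.
    apply: reduces_ext (reducesD (IHcs _ gcs hs') (reducesZ 'X^2 (IHcs _ gcs hs2))) _ _.
      move=> eta c; rewrite N mulrCA -mulrDr -mulrA mulrCA.
      apply: zeroF => // c'; rewrite [RHS]E // sx; congr (_ + _ * _).
      apply: eq_mono => q; rewrite relabelE /recolor; case: ifP => // _.
      by rewrite relabelE.
    by move=> s'; rewrite hornerXn expr0n mul0r addr0.
  have h1 := relabel_constant (false, i) true gcs hs'.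
  have h2 := relabel_constant (false, j) true gcs hs'.
  apply: reduces_ext (reducesD (IHcs _ gcs h1) (IHcs _ gcs h2)) _ _.
    move=> eta c; rewrite N -mulrDr -mulrA mulrCA.
    apply: zeroF => // c'; rewrite [RHS]E // sx; congr (_ + _).
      by apply: eq_mono => q; rewrite relabelE.
    by apply: eq_mono => q; rewrite relabelE.
  by move=> s'; rewrite count_cat natrD.
have es := stage_merge g N.
have E eta : compatible cs eta -> _ := fun c => mono_merge (sq eta)
  (stage_equiv g) N es hs (compatible_value c).
rewrite [connect _ _ _](negPf N) /=.
case sxy: (s (false, i) && s (true, i)); rewrite /= ?cats0.
  pose s2 := relabel e' (false, i) false s.
  have hs2 : constant_on (stage cs) s2 by apply: merge_constant g hs N.
  apply: reduces_ext (reducesZ 'X^2 (IHcs _ gcs hs2)) _ _.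
    move=> eta c; rewrite (negPf N) mul1r mulrCA.
    apply: zeroF => // c'; rewrite [RHS]E // sxy; congr (_ * _).
    by apply: eq_mono => q; rewrite relabelE.
  by move=> s'; rewrite hornerXn expr0n mul0r.
have h1 := merge_constant (s (false, i) || s (true, i)) g hs N.
apply: reduces_ext (IHcs _ gcs h1) _ _ => // eta c.
rewrite (negPf N) mul1r; apply: zeroF => // c'; rewrite [RHS]E // sxy mul1r.
by apply: eq_mono => q; rewrite relabelE.
Qed.

Definition ncircles c cs eta : nat :=
  \sum_(C in comps (stage cs)) pickv false (fun p => twist eta p.2 == c) C.

(** For each root, splits minus merges is the variation of the number of circles carrying it, while
    splits plus merges is the number of cups. The number [n c] of splits is therefore determined by
    the two ends of the procedure. *)
Lemma saddles_count cs eta : good b cs -> compatible cs eta ->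
  exists n : bool -> nat,
    saddles cs eta = \prod_(c : bool) (root_of c *+ 2) ^+ n c
    /\ forall c, (2 * n c + ncircles c cs eta
        = count (fun u => twist eta u.1 == c) cs + ncircles c [::] eta)%N.
Proof.
elim: cs => [|[i j] cs IHcs] g h.
  by exists (fun=> 0%N); split=> //; rewrite big1 // => c _; rewrite expr0.
have [gcs ij _ _] := good_step g; have h' := compatible_step g h.
have [n [sE nE]] := IHcs gcs h'.
have hc e c : compatible e eta -> constant_on (stage e) (fun p => twist eta p.2 == c).
  by move=> ce p q /ce ->.
have [N|N] := boolP (stage ((i, j) :: cs) (false, i) (true, i)); last first.
  exists n; rewrite /= (negPf N) mul1r; split=> // c; have := nE c.
  have := sum_join (stage_equiv g) N (stage_merge g N) (hc _ c h) (hc _ c h') (fun _ _ _ => erefl).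
  rewrite -/(ncircles _ _ _) -/(ncircles _ _ _) /=; case: (twist eta i == c) => /=; lia.
have [N' e] := stage_split g N.
have tij : twist eta j = twist eta i.
  apply: esym (h (false, i) (false, j) _); rewrite e /join.
  by rewrite (stage_equiv gcs (false, i) (false, i) (false, i)).1
    (stage_equiv gcs (false, j) (false, j) (false, j)).1 orbT.
exists (fun c => n c + (twist eta i == c))%N; split=> [|c].
  rewrite /= N sE /value /= tij -mulr2n !big_bool !exprD.
  by case: (twist eta i) => /=; rewrite ?expr1 ?expr0; ring.
have := nE c.
have := sum_join (stage_equiv gcs) N' e (hc _ c h') (hc _ c h) (fun _ _ _ => erefl).
rewrite -/(ncircles _ _ _) -/(ncircles _ _ _) /= tij; case: (twist eta i == c) => /=; lia.
Qed.

Definition nmarked cs s : nat := \sum_(C in comps (stage cs)) pickv false s C.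

(** Each surgery raises by one the quantity [twice the marks minus the circles]: a merge removes a
    circle and keeps the marks, a split adds one circle and one mark. *)
Lemma surgeries_degree cs s s' : good b cs -> constant_on (stage cs) s ->
  s' \in surgeries d b a (~: points cs) cs s ->
  constant_on (stage [::]) s' /\
  (2 * nmarked [::] s' + #|comps (stage cs)|
   = 2 * nmarked cs s + #|comps (stage [::])| + size cs)%N.
Proof.
elim: cs s => [|[i j] cs IHcs] s g hs.
  by rewrite inE => /eqP->; split=> //; rewrite addn0.
have [gcs ij _ _] := good_step g.
rewrite surgeriesE // => /flatten_mapP[t]; rewrite /surgery.
set e' := stacked _ _ _ (~: points cs).
have rr x : stage cs x x by rewrite (stage_equiv gcs x x x).1.
have [N|N] := boolP (stage ((i, j) :: cs) (false, i) (true, i)).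
  have [N' e] := stage_split g N; have hs' := constant_stage_step g hs N.
  rewrite [connect _ _ _]N /=.
  have H (t' : labelling M) : constant_on (stage cs) t' ->
      (forall p, ~~ stage cs (false, i) p -> ~~ stage cs (false, j) p -> t' p = s p) ->
      (t' (false, i) + t' (false, j) = s (false, i) + 1)%N ->
      s' \in surgeries d b a (~: points cs) cs t' ->
      constant_on (stage [::]) s' /\ (2 * nmarked [::] s' + #|comps (stage ((i, j) :: cs))|
        = 2 * nmarked ((i, j) :: cs) s + #|comps (stage [::])| + (size cs).+1)%N.
    move=> ht' offt sumt /(IHcs _ gcs ht')[c E]; split=> //; move: E.
    rewrite (card_join (stage_equiv gcs) N' e).
    have := sum_join (stage_equiv gcs) N' e ht' hs offt.
    by rewrite -/(nmarked _ _) -/(nmarked _ _); lia.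
  have sj : s (false, j) = s (false, i).
    by apply: esym (hs (false, i) (false, j) _); rewrite e /join !rr orbT.
  case si: (s (false, i)); rewrite /= !inE.
    by move=> /eqP-> {t}; apply: H => //; rewrite sj si.
  case/orP=> /eqP-> {t}; apply: H => //; try exact: relabel_constant.
  - by move=> p n1 n2; rewrite relabelE /recolor (negPf n1).
  - by rewrite !relabelE /recolor rr (negPf N') sj si.
  - by move=> p n1 n2; rewrite relabelE /recolor (negPf n2).
  by rewrite !relabelE /recolor rr stage_sym // (negPf N') si.
have e := stage_merge g N; rewrite [connect _ _ _](negPf N) /=.
case: ifP => // sxy; rewrite inE => /eqP-> {t}.
have ht := merge_constant (s (false, i) || s (true, i)) g hs N.
move=> /(IHcs _ gcs ht)[c E]; split=> //; move: E.
rewrite (card_join (stage_equiv g) N e).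
have := sum_join (stage_equiv g) N e hs ht.
rewrite -/(nmarked _ _) -/(nmarked _ _) relabelE /recolor rr => F.
suff /F : forall p, ~~ stage ((i, j) :: cs) (false, i) p ->
    ~~ stage ((i, j) :: cs) (true, i) p ->
    s p = relabel e' (false, i) (s (false, i) || s (true, i)) s p.
  by move: sxy; case: (s (false, i)); case: (s (true, i)) => //=; lia.
move=> p n1 n2; rewrite relabelE /recolor e /join (negPf n1) (negPf n2) (negPf N) /=.
by rewrite andbF.
Qed.

End Deformation.

(** * Circles and orientations of a single circle diagram *)

Section OneLine.
Variable M : nat.
Implicit Types (d a l eta nu : weight M) (i j x : 'I_M).

Definition circ d a : rel 'I_M := connect (fun u v => arc d u v || arc a u v).

(** For [l] without rays this is [orients eta l], freed from the distinction between the two ends of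
    an arc. *)
Definition fits l eta : bool := [forall i, eta (mate l i) != eta i].

Lemma fitsP l eta i : fits l eta -> eta (mate l i) = ~~ eta i.
Proof. by move/forallP/(_ i); case: (eta i); case: (eta _). Qed.

Lemma circ_refl d a i : circ d a i i. Proof. exact: connect0. Qed.

Lemma circ_sym d a i j : circ d a i j = circ d a j i.
Proof.
apply: sym_connect_sym => u v; rewrite [arc d u v]arc_sym [arc a u v]arc_sym //.
Qed.

Lemma rightmostP d a i : circ d a i (rightmost d a i) /\
  forall j, circ d a i j -> (j <= rightmost d a i)%N.
Proof. by rewrite /rightmost; case: arg_maxnP => [|j ij max]; [exact: connect0|]. Qed.

Lemma rightmost_circ d a i j : circ d a i j -> rightmost d a i = rightmost d a j.
Proof.
have H u v : circ d a u v -> (rightmost d a u <= rightmost d a v)%N.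
  move=> uv; have [c _] := rightmostP d a u; have [_ m] := rightmostP d a v.
  by apply: m; rewrite circ_sym in uv; apply: connect_trans uv c.
by move=> ij; apply/val_inj/eqP; rewrite eqn_leq !H // circ_sym.
Qed.

Definition is_rm d a i : bool := rightmost d a i == i.

Lemma rightmost_rm d a i : is_rm d a (rightmost d a i).
Proof.
by rewrite /is_rm; have [c _] := rightmostP d a i; rewrite -(rightmost_circ c).
Qed.

Lemma rightmost_eqE d a i r : is_rm d a r -> (rightmost d a i == r) = circ d a i r.
Proof.
move=> /eqP rr; apply/eqP/idP => [<-|/rightmost_circ -> //].
by have [] := rightmostP d a i.
Qed.

Section Closed.
Variables d a : weight M.
Hypotheses (d_closed : forall i, ~~ ray d i) (a_closed : forall i, ~~ ray a i).

Lemma circ_mate_l i : circ d a i (mate d i).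
Proof. by apply: connect1; rewrite arcE // eqxx. Qed.

Lemma circ_mate_r i : circ d a i (mate a i).
Proof. by apply: connect1; rewrite (arcE a_closed) eqxx orbT. Qed.

Lemma circ_ind (r : rel 'I_M) : reflexive r -> transitive r ->
  (forall i, r i (mate d i)) -> (forall i, r i (mate a i)) -> subrel (circ d a) r.
Proof.
move=> rr rt rd ra; apply: connect_rel => // u v /orP[]; rewrite arcE // => /eqP <- //.
Qed.

Section Fits.
Variable eta : weight M.
Hypotheses (fd : fits d eta) (fa : fits a eta).

Lemma twist_circ i j : circ d a i j -> twist eta i = twist eta j.
Proof.
move=> ij; apply/eqP; move: i j ij.
apply: circ_ind => [i|j i k|i|i] //=; first by move=> /eqP->.
  by rewrite /twist mate_odd // (fitsP _ fd) addbN addNb negbK.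
by rewrite /twist mate_odd // (fitsP _ fa) addbN addNb negbK.
Qed.

Definition circle_of i : {set 'I_M} := [set j | circ d a i j].

Lemma circleP i : circle eta (circle_of i) (mate d) (mate a).
Proof.
have st l : (forall j, circ d a j (mate l j)) -> (forall j, ~~ ray l j) -> fits l eta ->
    matching eta (circle_of i) (mate l).
  move=> cl lc fl; split.
  - by move=> x; rewrite !inE => ix; apply: connect_trans ix (cl x).
  - by move=> x _; apply: mateK.
  - by move=> x _; apply: fitsP.
  by move=> x k _ _ n1 n2; apply: mate_sep.
split.
- exact: st circ_mate_l _ _.
- exact: st circ_mate_r _ _.
- by apply/set0Pn; exists i; rewrite inE circ_refl.
move=> T sT /set0Pn[t tT] cd ca; apply/eqP; rewrite eqEsubset sT /=.
apply/subsetP => x; rewrite inE => ix.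
have : circ d a t x.
  by apply: connect_trans ix; have := subsetP sT _ tT; rewrite inE -/(circ d a t i) circ_sym.
move=> tx; have : (t \in T) ==> (x \in T).
  move: t x tx {ix tT}; apply: circ_ind => [u|v u w|u|u].
  - exact: implybb.
  - by move=> /implyP h /implyP h'; apply/implyP => /h/h'.
  - by apply/implyP/cd.
  by apply/implyP/ca.
by rewrite tT.
Qed.

Lemma sum_circle i : \sum_(x in circle_of i) sg (eta x) = 0.
Proof.
set A := \sum_(_ in _) _; suff : A = - A by lia.
rewrite {1}/A (reindex_inj (can_inj (mateK d_closed))) /= -sumrN; apply: eq_big => x.
  rewrite !inE; apply/idP/idP => h.
    by apply: connect_trans h _; rewrite -/(circ d a _ _) circ_sym circ_mate_l.
  exact: connect_trans h (circ_mate_l x).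
by rewrite (fitsP _ fd) sgN.
Qed.

(** The signs on the circle add up to 0, so the prefix sum just before the rightmost vertex is the
    opposite of the sign of that vertex. *)
Lemma side_circle i p : circ d a i p ->
  side eta (circle_of i) p = - sg (eta (rightmost d a i)).
Proof.
move=> ip; have [ir max] := rightmostP d a i; set r := rightmost d a i in ir max *.
rewrite (@side_const _ eta _ _ _ p r (circleP i)) ?inE // side_step ?inE //.
suff -> : prefix_sum eta (circle_of i) r = - sg (eta r) by ring.
have := sum_circle i; rewrite (bigD1 r) ?inE //= /prefix_sum => /eqP.
rewrite addr_eq0 => /eqP->; rewrite opprK; apply: eq_bigl => x.
rewrite !inE; case ix: (circ d a i x) => //=.
by rewrite ltn_neqAle max ?andbT.
Qed.

(** On an anticlockwise circle [side] is 1 at every vertex, which forces the prefix sums next to a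
    vertex to be 0 and 1; they do not change between vertices. *)
Lemma prefix_circle_ge0 i k : ~~ eta (rightmost d a i) ->
  0 <= prefix_sum eta (circle_of i) k.
Proof.
move=> r0.
case: (pickP [pred p | (p \in circle_of i) && (p < k)%N]) => [p0 /= Pp0|none]; last first.
  by rewrite /prefix_sum big_pred0.
case: (@arg_maxnP _ p0 [pred p | (p \in circle_of i) && (p < k)%N]
  (fun p : 'I_M => p : nat) Pp0) => p /andP[pS pk] max.
have -> : prefix_sum eta (circle_of i) k = prefix_sum eta (circle_of i) p.+1.
  rewrite /prefix_sum; apply: eq_bigl => x; case xS: (x \in circle_of i) => //=.
  rewrite ltnS; apply/idP/idP => [xk|xp]; first by apply: max; rewrite /= xS.
  exact: leq_ltn_trans xp pk.
have := side_circle (p := p); rewrite inE in pS; move=> /(_ _ pS).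
rewrite (negPf r0) prefix_sumS ?inE // side_step ?inE //.
by case: (eta p); rewrite /sg; lia.
Qed.

Lemma winding_circle i :
  \sum_(x in circle_of i) sg (eta x) * (ori x (mate d x) + ori x (mate a x))
  = - 4 * sg (eta (rightmost d a i)).
Proof.
rewrite -/(winding eta _ _ _) (winding_side (p := i) (circleP i)) ?inE ?circ_refl //.
by rewrite side_circle ?circ_refl //; ring.
Qed.

End Fits.

Lemma sum_circles (V : zmodType) (P : pred 'I_M) (F : 'I_M -> V) :
  (forall i j, circ d a i j -> P i = P j) ->
  \sum_(x | P x) F x = \sum_(r | is_rm d a r && P r) \sum_(x in circle_of r) F x.
Proof.
move=> cP; rewrite (partition_big (rightmost d a) (fun r => is_rm d a r && P r)) /=.
  apply: eq_bigr => r /andP[rm Pr]; apply: eq_bigl => x.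
  rewrite inE rightmost_eqE // circ_sym andbC; case rx : (circ d a r x) => //=.
  by rewrite -(cP _ _ rx).
move=> x Px; rewrite rightmost_rm; have [c _] := rightmostP d a x.
by rewrite -(cP _ _ c).
Qed.

(** On a circle where the orientations differ, [nu] is anticlockwise and [eta] is its reversal, so
    the circle contributes twice a prefix sum of [nu] to the difference of heights. *)
Lemma dominance eta nu : fits d eta -> fits a eta -> fits d nu -> fits a nu ->
  (forall r, is_rm d a r -> nu r -> eta r) -> forall k, hgt eta k <= hgt nu k.
Proof.
move=> fd fa fd' fa' h k; rewrite -subr_ge0.
rewrite /hgt -sumrB big_mkcond (sum_circles (P := predT)) //.
apply: sumr_ge0 => r /andP[rm _].
have [e|ne] := eqVneq (nu r) (eta r).
  rewrite big1 // => x; rewrite inE => rx; case: ifP => // _.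
  suff -> : nu x = eta x by rewrite subrr.
  have := twist_circ fd fa rx; have := twist_circ fd' fa' rx.
  by rewrite /twist e => -> /addbI.
have nur : nu r = false by apply: contraNF ne => n; rewrite n h.
have etar : eta r by move: ne; rewrite nur; case: (eta r).
have -> : \sum_(x in circle_of r) (if (x < k)%N then sg (nu x) - sg (eta x) else 0)
    = 2 * prefix_sum nu (circle_of r) k.
  rewrite /prefix_sum mulr_sumr [RHS]big_mkcondr /=; apply: eq_bigr => x.
  rewrite inE => rx; case: ifP => // _.
  suff -> : eta x = ~~ nu x by rewrite sgN; ring.
  have := twist_circ fd fa rx; have := twist_circ fd' fa' rx.
  by rewrite /twist nur etar; case: (odd r); case: (odd x); case: (nu x); case: (eta x).
by rewrite mulr_ge0 // prefix_circle_ge0 // (eqP rm) nur.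
Qed.

Definition ncirc c eta : nat := #|[pred r | is_rm d a r && (twist eta r == c)]|.
Definition nclock c eta : nat := #|[pred r | [&& is_rm d a r, twist eta r == c & eta r]]|.

Definition turning c l eta : int :=
  \sum_(x | twist eta x == c) sg (eta x) * ori x (mate l x).

(** A circle contributes 4 if it is anticlockwise and 4 - 8 if it is clockwise. Circles are sorted
    by their root [c] for comparison with the count of splits. *)
Lemma turning_circles c eta : fits d eta -> fits a eta ->
  turning c d eta + turning c a eta = 4 * (ncirc c eta)%:Z - 8 * (nclock c eta)%:Z.
Proof.
move=> fd fa; rewrite /turning -big_split /=.
under eq_bigr do rewrite -mulrDr.
rewrite sum_circles; last by move=> i j /(twist_circ fd fa) ->.
rewrite (eq_bigr (fun r => 4 - 8 * (eta r)%:Z)); last first.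
  move=> r /andP[/eqP rm _]; rewrite winding_circle // rm.
  by case: (eta r).
have E1 : \sum_(r | is_rm d a r && (twist eta r == c)) (4 : int) = 4 * (ncirc c eta)%:Z.
  by rewrite sumr_const -[_ *+ #|_|]mulr_natr (natz #|_|).
have E2 : \sum_(r | is_rm d a r && (twist eta r == c)) (eta r)%:Z = (nclock c eta)%:Z.
  rewrite /nclock -sum1_card (raddf_sum Posz) /= [LHS]big_mkcond [RHS]big_mkcond /=.
  apply: eq_bigr => r _; rewrite !inE.
  by case: (is_rm d a r) => //=; case: eqP => //= _; case: (eta r).
by rewrite sumrB -mulr_sumr E1 E2.
Qed.

End Closed.
End OneLine.

(** * From the stages of the surgery procedure to circle diagrams *)

Lemma big_comps_reps (T : finType) (r : rel T) (rep : T -> T) (P : pred T)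
    R (idx : R) (op : Monoid.com_law idx) (F : {set T} -> R) :
  equivalence_rel r -> (forall p, r p (rep p)) -> (forall p, P (rep p)) ->
  (forall p q, P p -> P q -> r p q -> p = q) ->
  \big[op/idx]_(C in comps r) F C = \big[op/idx]_(p | P p) F (cls r p).
Proof.
move=> eq_r rrep Prep uniq.
have -> : comps r = cls r @: [set p | P p].
  apply/setP => C; apply/imsetP/imsetP => [[p _ ->]|[p _ ->]]; last by exists p.
  by exists (rep p); rewrite ?inE //; apply/eqP; rewrite cls_eq.
rewrite big_imset /=; first by apply: eq_bigl => p; rewrite inE.
by move=> p q; rewrite !inE => Pp Pq /eqP; rewrite cls_eq //; apply: uniq.
Qed.

Section Transfer.
Variable K : fieldType.
Variables (M : nat) (d b a : weight M).
Hypotheses (d_closed : forall i, ~~ ray d i) (b_closed : forall i, ~~ ray b i)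
  (a_closed : forall i, ~~ ray a i).
Implicit Types (i j r : 'I_M) (s : labelling M) (eta : weight M).

Lemma points_cups : points (cups b) = setT.
Proof.
apply/setP => i; rewrite !inE; apply/hasP.
have := mate_arc (b_closed i) => /orP[] c.
  by exists (i, mate b i); rewrite /= ?eqxx // mem_filter /= c mem_enum inE.
by exists (mate b i, i); rewrite /= ?eqxx ?orbT // mem_filter /= c mem_enum inE.
Qed.

Lemma good_cups : good b (cups b).
Proof.
rewrite /good filter_uniq ?enum_uniq //=.
by apply/allP => c; rewrite mem_filter => /andP[].
Qed.

(** After all surgeries the two lines are joined at every vertex, so only the position on the line
    matters and the arcs of [d] and [a] remain. *)
Lemma final_stage p q : stage d b a [::] p q = circ d a p.2 q.2.
Proof.
have sT : ~: points [::] = [set: 'I_M] by apply/setP => i; rewrite !inE.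
rewrite /stage sT; apply/idP/idP.
  move: p q; apply: connect_rel => [p|p q s|p q] /=; first exact: circ_refl.
    exact: connect_trans.
  rewrite /stacked !inE !andbF !orbF.
  case: p q => -[] i [] [] j //= => [h|/andP[/eqP-> _]|/andP[/eqP-> _]|h]; try exact: circ_refl.
    by apply: connect1; rewrite h orbT.
  by apply: connect1; rewrite h.
have vert i l l' : stack d b a setT (l, i) (l', i).
  case: (eqVneq l l') => [->|n]; first exact: connect0.
  by apply: connect1; rewrite /stacked /= eqxx inE; case: l l' n => -[].
move=> h; case: p q h => l i [l' j] /= h.
apply: connect_trans (vert i l false) _; apply: connect_trans _ (vert j false l').
move: i j h; apply: (circ_ind d_closed a_closed) => /= [i|j i k|i|i].
- exact: connect0.
- exact: connect_trans.
- by apply: connect1; rewrite /stacked /= arcE // eqxx.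
apply: connect_trans (vert i false true) _; apply: connect_trans _ (vert _ true false).
by apply: connect1; rewrite /stacked /= arcE // eqxx.
Qed.

Lemma initial_stage p q : stage d b a (cups b) p q =
  (p.1 == q.1) && (if p.1 then circ b a p.2 q.2 else circ d b p.2 q.2).
Proof.
have sT : ~: points (cups b) = set0 by rewrite points_cups setCT.
rewrite /stage sT; apply/idP/idP.
  move: p q; apply: connect_rel => [p|q p s|p q] /=.
  - by rewrite eqxx; case: ifP; rewrite circ_refl.
  - move=> /andP[/eqP e h] /andP[/eqP e' h']; rewrite e e' eqxx; rewrite e e' in h h' *.
    by case: (s.1) h h'; apply: connect_trans.
  rewrite /stacked !inE !andbT !andbF.
  case: p q => -[] i [] [] j //= h; apply: connect1 => //.
  by rewrite orbC.
case: p q => l i [l' j] /= => /andP[/eqP<- {l'}].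
case: l; move: i j.
  apply: (circ_ind b_closed a_closed) => /= [i|j i k|i|i].
  - exact: connect0.
  - exact: connect_trans.
  - by apply: connect1; rewrite /stacked /= !arcE // eqxx inE orbT.
  - by apply: connect1; rewrite /stacked /= !arcE // eqxx.
apply: (circ_ind d_closed b_closed) => /= [i|j i k|i|i].
- exact: connect0.
- exact: connect_trans.
- by apply: connect1; rewrite /stacked /= !arcE // eqxx.
by apply: connect1; rewrite /stacked /= !arcE // eqxx inE orbT.
Qed.

Lemma big_final R (idx : R) (op : Monoid.com_law idx) (F : {set point M} -> R) :
  \big[op/idx]_(C in comps (stage d b a [::])) F C
  = \big[op/idx]_(r | is_rm d a r) F (cls (stage d b a [::]) (false, r)).
Proof.
rewrite (@big_comps_reps _ _ (fun p => (false, rightmost d a p.2))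
  (fun p => ~~ p.1 && is_rm d a p.2)).
- rewrite (eq_bigr (fun p => F (cls (stage d b a [::]) (p.1, p.2)))); last by case.
  rewrite -(pair_big_dep (fun l : bool => ~~ l) (fun _ r => is_rm d a r)
    (fun l r => F (cls (stage d b a [::]) (l, r)))) /=.
  by rewrite big_mkcond big_bool /= Monoid.mul1m.
- exact: stage_equiv.
- by move=> p; rewrite final_stage; have [] := rightmostP d a p.2.
- by move=> p; rewrite /= rightmost_rm.
move=> [l i] [l' j] /= /andP[/negPf-> rmi] /andP[/negPf-> rmj].
by rewrite final_stage /= => /rightmost_circ; rewrite (eqP rmi) (eqP rmj) => ->.
Qed.

Lemma big_initial R (idx : R) (op : Monoid.com_law idx) (F : {set point M} -> R) :
  \big[op/idx]_(C in comps (stage d b a (cups b))) F C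
  = op (\big[op/idx]_(r | is_rm d b r) F (cls (stage d b a (cups b)) (false, r)))
       (\big[op/idx]_(r | is_rm b a r) F (cls (stage d b a (cups b)) (true, r))).
Proof.
rewrite (@big_comps_reps _ _
  (fun p => (p.1, if p.1 then rightmost b a p.2 else rightmost d b p.2))
  (fun p => true && if p.1 then is_rm b a p.2 else is_rm d b p.2)).
- rewrite (eq_bigr (fun p => F (cls (stage d b a (cups b)) (p.1, p.2)))); last by case.
  rewrite -(pair_big_dep predT (fun l r => if l then is_rm b a r else is_rm d b r)
    (fun l r => F (cls (stage d b a (cups b)) (l, r)))) /=.
  by rewrite big_bool /= Monoid.mulmC.
- by apply: stage_equiv => //; apply: good_cups.
- case=> -[] i; rewrite initial_stage /=; first by have [] := rightmostP b a i.
  by have [] := rightmostP d b i.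
- by case=> -[] i; rewrite /= rightmost_rm.
move=> [l i] [l' j] /= rmi rmj; rewrite initial_stage /= => /andP[/eqP e]; move: rmi rmj; rewrite -e.
by case: l {e} => /eqP rmi /eqP rmj /rightmost_circ; rewrite rmi rmj => ->.
Qed.

(** The rightmost vertices represent the circles, as in the definition of [clockwise]. *)
Definition umono d' a' eta (A : 'I_M -> bool) : {poly K} :=
  \prod_(r | is_rm d' a' r && A r) root_of K (twist eta r).

Lemma final_compatible eta :
  compatible d b a [::] eta <-> fits d eta && fits a eta.
Proof.
split=> [c|/andP[fd fa] p q]; last by rewrite final_stage => /(twist_circ d_closed a_closed fd fa).
apply/andP; split; apply/forallP => i.
  have := c (false, i) (false, mate d i); rewrite final_stage circ_mate_l //=.
  by rewrite /twist mate_odd // => /(_ isT); case: (odd i); case: (eta i); case: (eta _).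
have := c (false, i) (false, mate a i); rewrite final_stage circ_mate_r //=.
by rewrite /twist mate_odd // => /(_ isT); case: (odd i); case: (eta i); case: (eta _).
Qed.

Lemma initial_compatible eta :
  compatible d b a (cups b) eta <-> [&& fits d eta, fits b eta & fits a eta].
Proof.
split=> [c|/and3P[fd fb fa] p q]; last first.
  rewrite initial_stage => /andP[/eqP e].
  by case: (p.1) => /twist_circ; apply.
have H l i j : stage d b a (cups b) (l, i) (l, j) -> odd j = ~~ odd i -> eta j != eta i.
  move=> /c /=; rewrite /twist => e o; move: e; rewrite o.
  by case: (odd i); case: (eta i); case: (eta j).
apply/and3P; split; apply/forallP => i.
- by apply: (H false); rewrite ?mate_odd // initial_stage /= circ_mate_l.
- by apply: (H false); rewrite ?mate_odd // initial_stage /= circ_mate_r.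
by apply: (H true); rewrite ?mate_odd // initial_stage /= circ_mate_r.
Qed.

Lemma mono_final eta s : compatible d b a [::] eta -> constant_on (stage d b a [::]) s ->
  mono (value K eta) (stage d b a [::]) s = umono d a eta (fun r => s (false, r)).
Proof.
move=> c cs; rewrite /mono /umono big_final [RHS]big_mkcondr; apply: eq_bigr => r _.
rewrite pickv_const //; first exact: stage_equiv.
by move=> p q pq; rewrite (cs _ _ pq) (compatible_value K c pq).
Qed.

Lemma mono_initial eta lam mu : compatible d b a (cups b) eta ->
  mono (value K eta) (stage d b a (cups b))
    (fun p => if p.1 then clockwise b mu a p.2 else clockwise d lam b p.2)
  = umono d b eta lam * umono b a eta mu.
Proof.
move=> c; rewrite /mono /umono big_initial /=.
have cst : constant_on (stage d b a (cups b))
    (fun p => if p.1 then clockwise b mu a p.2 else clockwise d lam b p.2).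
  case=> l i [l' j]; rewrite initial_stage /= => /andP[/eqP<-]; rewrite /clockwise.
  by case: l => /rightmost_circ ->.
have eqst : equivalence_rel (stage d b a (cups b)).
  by apply: stage_equiv => //; apply: good_cups.
congr (_ * _); rewrite [RHS]big_mkcondr; apply: eq_bigr => r /eqP rm.
  rewrite pickv_const //= /clockwise ?rm //.
  by move=> p q pq; rewrite (cst _ _ pq) (compatible_value K c pq).
rewrite pickv_const //= /clockwise ?rm //.
by move=> p q pq; rewrite (cst _ _ pq) (compatible_value K c pq).
Qed.

Lemma ncircles_final c eta : compatible d b a [::] eta ->
  ncircles d b a c [::] eta = ncirc d a c eta.
Proof.
move=> ce; rewrite /ncircles big_final /ncirc -sum1_card [RHS]big_mkcondr /=.
apply: eq_bigr => r _; rewrite pickv_const //=; first exact: stage_equiv.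
by move=> p q /ce ->.
Qed.

Lemma ncircles_initial c eta : compatible d b a (cups b) eta ->
  ncircles d b a c (cups b) eta = (ncirc d b c eta + ncirc b a c eta)%N.
Proof.
move=> ce; rewrite /ncircles big_initial /ncirc /= -!sum1_card.
have eqst : equivalence_rel (stage d b a (cups b)).
  by apply: stage_equiv => //; apply: good_cups.
by congr (_ + _)%N; rewrite [RHS]big_mkcondr /=; apply: eq_bigr => r _;
  rewrite pickv_const //=; move=> p q /ce ->.
Qed.

End Transfer.

(** * Basis elements as functions of the weights *)

Section Rank.
Variable M : nat.
Implicit Types eta nu : weight M.

(** The Bruhat order read on lattice paths: the smaller weight [nu] has the higher path. *)
Definition dominated nu eta := forall k, hgt eta k <= hgt nu k.

Definition nfalse eta (k : nat) : nat := #|[set x : 'I_M | (x < k)%N && ~~ eta x]|.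

Lemma hgt_nfalse eta k :
  hgt eta k = #|[set x : 'I_M | (x < k)%N]|%:Z - 2 * (nfalse eta k)%:Z.
Proof.
have -> : hgt eta k = \sum_(x in [set x : 'I_M | (x < k)%N]) sg (eta x).
  by apply: eq_bigl => x; rewrite inE.
rewrite sum_sg -(cardsID [set x | eta x] [set x : 'I_M | (x < k)%N]).
have -> : [set x in [set x : 'I_M | (x < k)%N] | eta x]
    = [set x : 'I_M | (x < k)%N] :&: [set x | eta x] by apply/setP => x; rewrite !inE.
have -> : [set x in [set x : 'I_M | (x < k)%N] | ~~ eta x]
    = [set x : 'I_M | (x < k)%N] :\: [set x | eta x].
  by apply/setP => x; rewrite !inE andbC.
have -> : nfalse eta k = #|[set x : 'I_M | (x < k)%N] :\: [set x | eta x]|.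
  by apply: eq_card => x; rewrite !inE andbC.
have shuffle (u v : nat) : u%:Z - v%:Z = (u + v)%N%:Z - 2 * v%:Z by lia.
exact: shuffle.
Qed.

(** Essentially the area above the path of [eta], so that it grows strictly with the Bruhat
    order. *)
Definition base_rank eta : nat := \sum_(k < M.+1) nfalse eta k.

(* The second term only serves to make [rank] injective. *)
Definition rank eta : nat := (base_rank eta * #|{: weight M}| + enum_rank eta)%N.

Lemma rank_inj : injective rank.
Proof.
move=> eta nu /(congr1 (modn^~ #|{: weight M}|)).
by rewrite /rank !modnMDl !modn_small // => /val_inj/enum_rank_inj.
Qed.

Lemma hgt_inj eta nu : (forall k, (k <= M)%N -> hgt eta k = hgt nu k) -> eta = nu.
Proof.
move=> e; apply/ffunP => x; have := hgtS eta x; rewrite !e ?ltn_ord //; last exact: ltnW.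
by rewrite hgtS => /addrI; case: (eta x); case: (nu x).
Qed.

Lemma dominated_rank nu eta : dominated nu eta -> nu = eta \/ (rank nu < rank eta)%N.
Proof.
move=> dom; have le k : (nfalse nu k <= nfalse eta k)%N.
  by have := dom k; rewrite !hgt_nfalse; lia.
case: (pickP (fun k : 'I_M.+1 => nfalse nu k < nfalse eta k)%N) => [k lt|none].
  right; suff lt' : (base_rank nu < base_rank eta)%N.
    apply: leq_trans (leq_addr _ _); apply: leq_trans (leq_mul lt' (leqnn _)).
    by rewrite /rank mulSn addnC ltn_add2r.
  rewrite /base_rank (bigD1 k) //= [X in (_ < X)%N](bigD1 k) //= -addSn leq_add //.
  by apply: leq_sum => j _.
left; apply: hgt_inj => k kM; rewrite !hgt_nfalse.
have := none (inord k); rewrite inordK // => /negbT; rewrite -leqNgt => ge.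
suff -> : nfalse nu k = nfalse eta k by [].
by apply/eqP; rewrite eqn_leq le ge.
Qed.

End Rank.

(** * Classes, monomials and triangularity *)

Section Fixed.
Variable K : fieldType.
Hypothesis charK : [pchar K] =i pred0.
Variables (M : nat) (W : pred (weight M)).
(** [W] stands for the image of [cl]. At a point of [W] only classes of weights below that point are
    nonzero, and this hypothesis puts them in [W]. *)
Hypothesis Wdown : forall l eta nu, (forall i, ~~ ray l i) -> fits l nu ->
  W eta -> dominated nu eta -> W nu.

Local Notation rootK := (root_of K).
Local Notation umono := (umono K).

Section Pair.
Variables d a : weight M.
Hypotheses (d_closed : forall i, ~~ ray d i) (a_closed : forall i, ~~ ray a i).
Implicit Types (eta nu : weight M) (i r : 'I_M) (A J : {set 'I_M}).

Definition lies nu : bool := [&& W nu, fits d nu & fits a nu].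

Definition rms : {set 'I_M} := [set r | is_rm d a r].

Definition cwset nu : {set 'I_M} := [set r | is_rm d a r & nu r].

Definition fset_cls A eta : {poly K} :=
  \prod_(r in A) (if eta r then rootK (twist eta r) *+ 2 else 0).

(* The class of the circle diagram (d, nu, a), as a function on the fixed
   points: it vanishes at [eta] unless every circle clockwise in [nu] is
   clockwise in [eta]. *)
Definition fcls nu eta : {poly K} := fset_cls (cwset nu) eta.

Definition fset_mono A eta : {poly K} := \prod_(r in A) rootK (twist eta r).

(** Inverse to [cwset]: the orientation whose clockwise circles are those with rightmost vertex in
    [J]. *)
Definition wt J : weight M :=
  [ffun i : 'I_M => odd i (+) (odd (rightmost d a i) (+) (rightmost d a i \in J))].

Lemma fits_wt J : fits d (wt J) && fits a (wt J).
Proof.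
have rd i : rightmost d a (mate d i) = rightmost d a i.
  by apply/esym/rightmost_circ/circ_mate_l.
have ra i : rightmost d a (mate a i) = rightmost d a i.
  by apply/esym/rightmost_circ/circ_mate_r.
by apply/andP; split; apply/forallP => i; rewrite !ffunE mate_odd // ?rd ?ra;
  case: (odd i); case: (odd _); case: (_ \in _).
Qed.

Lemma cwset_sub nu : cwset nu \subset rms.
Proof. by apply/subsetP => r; rewrite !inE => /andP[]. Qed.

Lemma cwset_wt J : J \subset rms -> cwset (wt J) = J.
Proof.
move=> sJ; apply/setP => r; rewrite !inE ffunE.
case rm: (is_rm d a r) => /=; first by rewrite (eqP rm) addKb.
by apply/esym/negbTE/negP => /(subsetP sJ); rewrite inE rm.
Qed.

Lemma wt_cwset nu : fits d nu -> fits a nu -> wt (cwset nu) = nu.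
Proof.
move=> fd fa; apply/ffunP => i; rewrite ffunE inE rightmost_rm /=.
have [c _] := rightmostP d a i.
by rewrite -/(twist nu _) -(twist_circ d_closed a_closed fd fa c) /twist addKb.
Qed.

Lemma sum_subsets (V : zmodType) (F : {set 'I_M} -> V) :
  \sum_(J : {set 'I_M} | J \subset rms) F J
  = \sum_(nu : weight M | fits d nu && fits a nu) F (cwset nu).
Proof.
rewrite (reindex_onto cwset wt) /=; last exact: cwset_wt.
apply: eq_bigl => nu; rewrite cwset_sub; apply/eqP/andP => [<-|[fd fa]].
  by apply/andP/fits_wt.
exact: wt_cwset.
Qed.

Lemma fcls_neq0 nu eta : fcls nu eta != 0 -> forall r, is_rm d a r -> nu r -> eta r.
Proof.
move=> /prodf_neq0 h r rm nr; have := h r; rewrite inE rm nr => /(_ isT).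
by case: (eta r) => //; rewrite eqxx.
Qed.

Lemma fcls_dominated nu eta : fits d eta -> fits a eta -> fits d nu -> fits a nu ->
  fcls nu eta != 0 -> dominated nu eta.
Proof. by move=> f1 f2 f3 f4 /fcls_neq0 h; apply: (dominance d_closed a_closed). Qed.

Lemma root2_neq0 c : rootK c *+ 2 != 0.
Proof.
rewrite -mulr_natl mulf_eq0 negb_or; apply/andP; split.
  by rewrite -polyC_natr polyC_eq0 ((GRing.pcharf0P K).1 charK).
by rewrite /root_of; case: c; rewrite ?oppr_eq0 polyX_eq0.
Qed.

Lemma fcls_diag nu : fcls nu nu != 0.
Proof.
by apply/prodf_neq0 => r; rewrite inE => /andP[_ ->]; apply: root2_neq0.
Qed.

(** Coefficients of both base changes: a class is a product of factors [x + c] and a monomial a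
    product of factors [x = (x + c) - c], where [c] is the root that x takes on the clockwise
    circle. *)
Definition shift_coef (sgn : {poly K}) A J : {poly K} :=
  if J \subset A then \prod_(r in A :\: J) (sgn * rootK (~~ odd r)) else 0.

(** Each element of [A] outside [J] brings a multiple of ['X]: modulo the parameter, classes and
    monomials coincide. *)
Lemma shift_coef0 sgn A J : (shift_coef sgn A J).[0] = (J == A)%:R.
Proof.
rewrite /shift_coef; case: ifP => sJ; last first.
  rewrite horner0; case: eqP => // e; by rewrite e subxx in sJ.
have [->|ne] := eqVneq J A; first by rewrite setDv big_set0 hornerC.
have : A :\: J != set0.
  by rewrite setD_eq0; apply: contraNN ne => sA; rewrite eqEsubset sJ.
case/set0Pn => r rA; rewrite horner_prod (bigD1 r) //= hornerM /root_of.
by case: (~~ _); rewrite ?hornerN hornerX ?oppr0 mulr0 mul0r.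
Qed.

Lemma prod_add_subset A (F G : 'I_M -> {poly K}) :
  \prod_(r in A) (F r + G r)
  = \sum_(J : {set 'I_M}) (if J \subset A then \prod_(r in A :\: J) G r else 0)
      * \prod_(r in J) F r.
Proof.
rewrite big_mkcond (eq_bigr (fun r => (if r \in A then F r else 0)
   + (if r \in A then G r else 1))); last first.
  by move=> r _; case: (r \in A); rewrite // add0r.
rewrite bigA_distr; apply: eq_bigr => J _.
case: ifP => sJ; last first.
  rewrite mul0r; move/negbT: sJ => /subsetPn[r rJ rA].
  by rewrite (bigD1 r) //= rJ (negPf rA) mul0r.
rewrite (bigID (mem J)) /= mulrC; congr (_ * _).
  rewrite [RHS]big_mkcond [LHS]big_mkcond /=; apply: eq_bigr => r _.
  by rewrite inE; case: (r \in J) => //=.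
apply: eq_bigr => r rJ; by rewrite rJ (subsetP sJ).
Qed.

Lemma fset_factor eta r :
  (if eta r then rootK (twist eta r) *+ 2 else 0)
  = rootK (twist eta r) + rootK (~~ odd r).
Proof.
rewrite /twist /root_of; case: (eta r); case: (odd r) => //=;
  by rewrite ?mulr2n ?addrN ?addNr.
Qed.

Lemma cls_expand A eta :
  fset_cls A eta = \sum_(J : {set 'I_M}) shift_coef 1 A J * fset_mono J eta.
Proof.
rewrite /fset_cls; under eq_bigr do rewrite fset_factor.
rewrite prod_add_subset; apply: eq_bigr => J _; congr (_ * _).
by rewrite /shift_coef; case: ifP => // _; apply: eq_bigr => r _; rewrite mul1r.
Qed.

Lemma mono_expand A eta :
  fset_mono A eta = \sum_(J : {set 'I_M}) shift_coef (-1) A J * fset_cls J eta.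
Proof.
rewrite /fset_mono.
rewrite (eq_bigr (fun r => (if eta r then rootK (twist eta r) *+ 2 else 0)
    + -1 * rootK (~~ odd r))); last first.
  by move=> r _; rewrite fset_factor mulN1r addrK.
by rewrite prod_add_subset.
Qed.

Lemma shift_coef_sub sgn A J : A \subset rms -> ~~ (J \subset rms) -> shift_coef sgn A J = 0.
Proof.
move=> sA sJ; rewrite /shift_coef ifN //; apply: contraNN sJ => sJ.
exact: subset_trans sJ sA.
Qed.

Lemma umonoE eta nu : umono d a eta nu = fset_mono (cwset nu) eta.
Proof. by apply: eq_bigl => r; rewrite inE. Qed.

Lemma fcls_expand nu eta :
  fcls nu eta = \sum_(mu : weight M | fits d mu && fits a mu)
    shift_coef 1 (cwset nu) (cwset mu) * umono d a eta mu.
Proof.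
rewrite /fcls cls_expand (bigID (fun J : {set 'I_M} => J \subset rms)) /= [X in _ + X]big1.
  rewrite addr0 (sum_subsets (fun J => shift_coef 1 _ J * fset_mono J eta)).
  by apply: eq_bigr => mu _; rewrite umonoE.
by move=> J sJ; rewrite shift_coef_sub ?mul0r ?cwset_sub.
Qed.

(** A class that is nonzero at [eta] belongs to a weight below [eta], so the terms outside [W]
    vanish. *)
Lemma umono_expand A eta : A \subset rms -> W eta -> fits d eta -> fits a eta ->
  fset_mono A eta = \sum_(nu | lies nu) shift_coef (-1) A (cwset nu) * fcls nu eta.
Proof.
move=> sA We fd fa.
rewrite mono_expand (bigID (fun J : {set 'I_M} => J \subset rms)) /= [X in _ + X]big1.
  rewrite addr0 (sum_subsets (fun J => shift_coef (-1) _ J * fset_cls J eta)).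
  rewrite [LHS](bigID W) /= [X in _ + X]big1 ?addr0.
    by apply: eq_bigl => nu; rewrite /lies andbC.
  move=> nu /andP[/andP[fd' fa'] WN].
  have [->|ne] := eqVneq (fset_cls (cwset nu) eta) 0; first by rewrite mulr0.
  case/negP: WN; apply: (Wdown d_closed fd' We).
  exact: fcls_dominated.
by move=> J sJ; rewrite shift_coef_sub ?mul0r.
Qed.

Lemma cwset_eq nu mu : fits d nu -> fits a nu -> fits d mu -> fits a mu ->
  (cwset nu == cwset mu) = (nu == mu).
Proof.
by move=> *; apply/eqP/eqP => [e|-> //]; rewrite -[nu]wt_cwset // e wt_cwset.
Qed.

(** Evaluate at [nu]: only classes of weights below [nu] survive, those strictly below have
    coefficient 0 by induction, and the class of [nu] is not 0 at [nu]. The bound [N] serves for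
    relations known at points of small rank only. *)
Lemma triangular N (rho : weight M -> {poly K}) :
  (forall eta, lies eta -> (rank eta < N)%N ->
     \sum_(nu | lies nu) rho nu * fcls nu eta = 0) ->
  forall nu, lies nu -> (rank nu < N)%N -> rho nu = 0.
Proof.
move=> H nu; have [k] := ubnP (rank nu); elim: k nu => // k IHk nu lk Lnu rN.
have := H nu Lnu rN; rewrite (bigD1 nu) //= big1 ?addr0.
  by move/eqP; rewrite mulf_eq0 (negPf (fcls_diag nu)) orbF => /eqP.
move=> mu /andP[Lmu ne].
have [->|n0] := eqVneq (fcls mu nu) 0; first by rewrite mulr0.
have [_ fd fa] := and3P Lnu; have [_ fd' fa'] := and3P Lmu.
case: (dominated_rank (fcls_dominated fd fa fd' fa' n0)) => [e|lt].
  by rewrite e eqxx in ne.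
rewrite IHk ?mul0r //; first exact: leq_trans lt lk.
exact: ltn_trans lt rN.
Qed.

(** [alpha] collects the coefficients of [F] on the classes, at parameter 0. By [symb_uniq] the
    values of [F] determine them, so identities between functions yield identities in the undeformed
    algebra. *)
Definition symb (F : weight M -> {poly K}) (alpha : weight M -> K) : Prop :=
  exists rho : weight M -> {poly K},
    (forall nu, lies nu -> (rho nu).[0] = alpha nu) /\
    (forall eta, lies eta -> F eta = \sum_(nu | lies nu) rho nu * fcls nu eta).

Lemma symb_rank N F alpha : symb F alpha ->
  (forall eta, lies eta -> (rank eta < N)%N -> F eta = 0) ->
  forall nu, lies nu -> (rank nu < N)%N -> alpha nu = 0.
Proof.
move=> [rho [r0 rE]] H nu L lt; rewrite -r0 //.
rewrite (triangular (N := N)) ?horner0 // => eta Le /(H _ Le).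
by rewrite rE.
Qed.

Lemma symbD F G alpha beta : symb F alpha -> symb G beta ->
  symb (fun eta => F eta + G eta) (fun nu => alpha nu + beta nu).
Proof.
move=> [r [r0 rE]] [q [q0 qE]]; exists (fun nu => r nu + q nu); split.
  by move=> nu L; rewrite hornerD r0 // q0.
move=> eta L; rewrite rE // qE // -big_split; apply: eq_bigr => s _.
by rewrite /= mulrDl.
Qed.

Lemma symbZ p F alpha : symb F alpha ->
  symb (fun eta => p * F eta) (fun nu => p.[0] * alpha nu).
Proof.
move=> [r [r0 rE]]; exists (fun nu => p * r nu); split.
  by move=> nu L; rewrite hornerM r0.
by move=> eta L; rewrite rE // mulr_sumr; apply: eq_bigr => s _; rewrite mulrA.
Qed.

Lemma symb0 : symb (fun=> 0) (fun=> 0).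
Proof.
exists (fun=> 0); split=> [nu _|eta _]; first by rewrite horner0.
by rewrite big1 // => nu _; rewrite mul0r.
Qed.

Lemma symb_sum (I : finType) (P : pred I) F alpha :
  (forall k : I, P k -> symb (F k) (alpha k)) ->
  symb (fun eta => \sum_(i | P i) F i eta) (fun nu => \sum_(i | P i) alpha i nu).
Proof.
move=> H; suff : forall s : seq I, symb (fun eta => \sum_(i <- s | P i) F i eta)
    (fun nu => \sum_(i <- s | P i) alpha i nu) by apply.
elim=> [|k s [r [r0 rE]]].
  have [r [r0 rE]] := symb0; exists r.
  by split=> [nu L|eta L] /=; rewrite big_nil; [apply: r0|apply: rE].
case Pi : (P k); last first.
  by exists r; split=> [nu L|eta L] /=; rewrite big_cons Pi; [apply: r0|apply: rE].
have [q [q0 qE]] := symbD (H k Pi) (ex_intro _ r (conj r0 rE)).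
by exists q; split=> [nu L|eta L] /=; rewrite big_cons Pi; [apply: q0|apply: qE].
Qed.

Lemma symb_ext F G alpha beta : symb F alpha ->
  (forall eta, lies eta -> F eta = G eta) ->
  (forall nu, lies nu -> alpha nu = beta nu) -> symb G beta.
Proof.
move=> [r [r0 rE]] e ea; exists r; split=> [nu L|eta L]; first by rewrite r0 // ea.
by rewrite -e // rE.
Qed.

Lemma symb_uniq F alpha beta : symb F alpha -> symb F beta ->
  forall nu, lies nu -> alpha nu = beta nu.
Proof.
move=> sa sb nu L; have := symb_rank (symbD sa (symbZ (-1) sb)) _ L (leqnn _).
rewrite -polyCN hornerC mulN1r => H; apply/eqP; rewrite -subr_eq0 H // => eta _ _.
by rewrite polyCN mulN1r subrr.
Qed.

End Pair.
End Fixed.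

(** * Products *)

Section Products.
Variable K : fieldType.
Hypothesis charK : [pchar K] =i pred0.
Variables (M : nat) (W : pred (weight M)).
Hypothesis Wdown : forall l eta nu, (forall i, ~~ ray l i) -> fits l nu ->
  W eta -> dominated nu eta -> W nu.
Implicit Types (l d b a e eta nu lam mu : weight M).

Definition closedw l := forall i, ~~ ray l i.

(** Modulo the parameter the class of [nu] is the monomial that marks the clockwise circles of
    [nu]. *)
Lemma symb_reduces d b a F alpha : closedw d -> closedw b -> closedw a ->
  reduces d b a F alpha ->
  symb W d a F (fun nu => alpha [ffun p => clockwise d nu a p.2] : K).
Proof.
move=> dc bc ac [r [r0 rc rE]].
pose A (s : labelling M) := [set i | is_rm d a i & s (false, i)].
have sA s : A s \subset rms d a by apply/subsetP => i; rewrite !inE => /andP[].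
pose s1 nu : labelling M := [ffun p => clockwise d nu a p.2].
have A1 nu : A (s1 nu) = cwset d a nu.
  apply/setP => i; rewrite !inE !ffunE /clockwise /=.
  by case rm : (is_rm d a i) => //=; rewrite (eqP rm).
exists (fun nu => \sum_s r s * shift_coef (-1 : {poly K}) (A s) (cwset d a nu)); split.
  move=> nu L; rewrite horner_sum (bigD1 (s1 nu)) //= A1 hornerM shift_coef0 eqxx mulr1 r0.
  rewrite big1 ?addr0 // => s ne; rewrite hornerM shift_coef0.
  have [->|rs] := eqVneq (r s) 0; first by rewrite horner0 mul0r.
  case: eqP => [eA|_]; last by rewrite mulr0.
  (* A labelling constant on circles is determined by its values at the rightmost vertices. *)
  case/eqP: ne; apply/ffunP => -[x i]; rewrite ffunE /clockwise /=.
  have /(_ (x, i) (false, rightmost d a i)) -> := rc _ rs; last first.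
    by rewrite final_stage //=; have [] := rightmostP d a i.
  have := rightmost_rm d a i; move/setP/(_ (rightmost d a i)): eA.
  by rewrite !inE => + rm; rewrite rm.
move=> eta /and3P[We fd fa]; have ce : compatible d b a [::] eta.
  by apply/final_compatible => //; rewrite fd.
rewrite rE //; under [RHS]eq_bigr do rewrite mulr_suml.
rewrite [RHS]exchange_big; apply: eq_bigr => s _ /=.
have [->|rs] := eqVneq (r s) 0.
  by rewrite mul0r big1 // => nu _; rewrite !mul0r.
rewrite mono_final //; last exact: rc.
have -> : umono K d a eta (fun i => s (false, i)) = fset_mono K (A s) eta.
  by apply: eq_bigl => i; rewrite inE.
rewrite (umono_expand K Wdown dc ac) // mulr_sumr; apply: eq_bigr => nu _.
by rewrite mulrA.
Qed.

Definition sad d b a eta := saddles K d b a (cups b) eta.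

Lemma sad_neq0 d b a eta : closedw d -> closedw b -> closedw a ->
  fits d eta -> fits a eta -> sad d b a eta != 0 -> fits b eta.
Proof.
move=> dc bc ac fd fa s0.
have cf : compatible d b a [::] eta by apply/final_compatible => //; rewrite fd.
have c : compatible d b a (cups b) eta.
  exact: (saddles_compatible dc bc ac (good_cups b) cf s0).
by case/and3P: ((initial_compatible dc bc ac eta).1 c).
Qed.

Definition prodF d b a lam mu eta := sad d b a eta * (fcls K d b lam eta * fcls K b a mu eta).

(** The surgery rules multiply monomials. Expanding both classes in monomials, all terms but the
    leading one have coefficients that vanish at 0, so [arc_coef] also gives the product of
    classes. *)
Lemma prod_symb d b a lam mu : closedw d -> closedw b -> closedw a ->
  lies W d b lam -> lies W b a mu ->
  symb W d a (prodF d b a lam mu) (fun nu => (arc_coef d lam b mu a nu)%:R).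
Proof.
move=> dc bc ac /and3P[Wl fdl fbl] /and3P[Wm fbm fam].
pose s0 lam' mu' : labelling M :=
  [ffun p => if p.1 then clockwise b mu' a p.2 else clockwise d lam' b p.2].
have step lam' mu' : symb W d a
    (fun eta => sad d b a eta * (umono K d b eta lam' * umono K b a eta mu'))
    (fun nu => (arc_coef d lam' b mu' a nu)%:R).
  have cs0 : constant_on (stage d b a (cups b)) (s0 lam' mu').
    case=> x i [y j]; rewrite initial_stage //= => /andP[/eqP<-]; rewrite !ffunE /= /clockwise.
    by case: x => /rightmost_circ ->.
  have := symb_reduces dc bc ac (reduces_surgeries K dc bc ac (good_cups b) cs0).
  move=> /symb_ext; apply=> [eta /and3P[We fd fa]|nu _]; last first.
    by rewrite /arc_coef points_cups // setCT.
  have [s00|sn0] := eqVneq (sad d b a eta) 0.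
    by rewrite -/(sad d b a eta) s00 !mul0r.
  congr (_ * _); rewrite -mono_initial //; first by apply: eq_mono => p; rewrite ffunE.
  by apply/initial_compatible => //; rewrite fd fa (sad_neq0 dc bc ac fd fa sn0).
have := symb_sum (P := fun lam' => fits d lam' && fits b lam') (fun lam' _ =>
  symb_sum (P := fun mu' => fits b mu' && fits a mu') (fun mu' _ =>
    symbZ (shift_coef (1 : {poly K}) (cwset d b lam) (cwset d b lam') * shift_coef (1 : {poly K}) (cwset b a mu) (cwset b a mu'))
      (step lam' mu'))).
move=> /symb_ext; apply=> [eta _|nu _].
  rewrite /prodF (fcls_expand K dc bc lam) (fcls_expand K bc ac mu) mulr_suml mulr_sumr.
  apply: eq_bigr => lam' _; rewrite mulr_sumr mulr_sumr; apply: eq_bigr => mu' _.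
  by ring.
rewrite (bigD1 lam) ?fdl //= (bigD1 mu) ?fbm //= hornerM !shift_coef0 !eqxx !mul1r.
rewrite big1 ?addr0.
  rewrite big1 ?addr0 // => lam' /andP[/andP[f1 f2] ne].
  rewrite big1 // => mu' _; rewrite hornerM !shift_coef0.
  by rewrite [_ == cwset d b lam]cwset_eq // (negPf ne) !mul0r.
move=> mu' /andP[/andP[f1 f2] ne]; rewrite hornerM !shift_coef0.
by rewrite [_ == cwset b a mu]cwset_eq // (negPf ne) mulr0 mul0r.
Qed.

Lemma sad_count d b a eta : closedw d -> closedw b -> closedw a ->
  fits d eta -> fits b eta -> fits a eta ->
  exists n : bool -> nat,
    sad d b a eta = \prod_(c : bool) (root_of K c *+ 2) ^+ n c
    /\ forall c, (2 * n c + (ncirc d b c eta + ncirc b a c eta)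
        = count (fun u => twist eta u.1 == c) (cups b) + ncirc d a c eta)%N.
Proof.
move=> dc bc ac fd fb fa.
have ci : compatible d b a (cups b) eta by apply/initial_compatible => //; rewrite fd fb.
have cf : compatible d b a [::] eta by apply/final_compatible => //; rewrite fd.
have [n [sE nE]] := saddles_count K dc bc ac (good_cups b) ci.
by exists n; split=> // c; rewrite -ncircles_initial // -(ncircles_final dc bc ac) // nE.
Qed.

(** By [sad_count], twice an exponent is the number of cups of the middle diagram plus a coboundary
    in the numbers of circles; the cups of [b] and [a] occur on both sides. Where [eta] does not fit
    [b] or [a] both products vanish. *)
Lemma sad_cocycle d b a e eta : closedw d -> closedw b -> closedw a -> closedw e ->
  fits d eta -> fits e eta ->
  sad d b a eta * sad d a e eta = sad d b e eta * sad b a e eta \/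
  sad d a e eta = 0 /\ sad d b e eta * sad b a e eta = 0.
Proof.
move=> dc bc ac ec fd fe.
have [z|nz] := eqVneq (sad d a e eta) 0.
  have [z'|nz'] := eqVneq (sad d b e eta) 0; first by right; rewrite z' mul0r.
  have fb := sad_neq0 dc bc ec fd fe nz'.
  have [z''|nz''] := eqVneq (sad b a e eta) 0; first by right; rewrite z'' mulr0.
  have fa := sad_neq0 bc ac ec fb fe nz''.
  have [n [E _]] := sad_count dc ac ec fd fa fe.
  move: z; rewrite E big_bool => /eqP; rewrite mulf_eq0 !expf_eq0.
  by rewrite !(negPf (root2_neq0 charK _)) !andbF.
have fa := sad_neq0 dc ac ec fd fe nz; left.
have [fb|Nfb] := boolP (fits b eta); last first.
  have -> : sad d b a eta = 0.
    by apply/eqP; apply: contraNT Nfb => /(sad_neq0 dc bc ac fd fa).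
  have -> : sad d b e eta = 0.
    by apply/eqP; apply: contraNT Nfb => /(sad_neq0 dc bc ec fd fe).
  by rewrite !mul0r.
have [n1 [-> E1]] := sad_count dc bc ac fd fb fa.
have [n2 [-> E2]] := sad_count dc ac ec fd fa fe.
have [n3 [-> E3]] := sad_count dc bc ec fd fb fe.
have [n4 [-> E4]] := sad_count bc ac ec fb fa fe.
rewrite -!big_split /=; apply: eq_bigr => c _; rewrite -!exprD; congr (_ ^+ _).
by have := E1 c; have := E2 c; have := E3 c; have := E4 c; lia.
Qed.

(** Both sums are coefficients of the same function [F], the product of three classes and two saddle
    factors, since the cocycle identity reconciles the two bracketings. *)
Lemma arc_assoc d b a e lam mu kap pi : closedw d -> closedw b -> closedw a -> closedw e ->
  lies W d b lam -> lies W b a mu -> lies W a e kap -> lies W d e pi ->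
  \sum_(nu | lies W d a nu) (arc_coef d lam b mu a nu)%:R * (arc_coef d nu a kap e pi)%:R
  = \sum_(nu | lies W b e nu) (arc_coef b mu a kap e nu)%:R * (arc_coef d lam b nu e pi)%:R :> K.
Proof.
move=> dc bc ac ec Ll Lm Lk Lp.
pose F eta := sad d b a eta * sad d a e eta * (fcls K d b lam eta * fcls K b a mu eta
  * fcls K a e kap eta).
have [r [r0 rE]] := prod_symb dc bc ac Ll Lm.
have [q [q0 qE]] := prod_symb bc ac ec Lm Lk.
have S1 : symb W d e F (fun pi => \sum_(nu | lies W d a nu)
    (arc_coef d lam b mu a nu)%:R * (arc_coef d nu a kap e pi)%:R).
  have := symb_sum (P := lies W d a) (fun nu L => symbZ (r nu) (prod_symb dc ac ec L Lk)).
  move=> /symb_ext; apply=> [eta /and3P[We fd fe]|nu _]; last first.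
    by apply: eq_bigr => nu' L; rewrite r0.
  (* The expansion of the inner product holds at points that fit [a]; at the others the outer saddle
     factor is 0. *)
  have [z|nz] := eqVneq (sad d a e eta) 0.
    by rewrite /F z mulr0 mul0r big1 // => nu _; rewrite /prodF z mul0r mulr0.
  have fa := sad_neq0 dc ac ec fd fe nz.
  transitivity (prodF d b a lam mu eta * (sad d a e eta * fcls K a e kap eta)).
    rewrite rE; last by rewrite /lies We fd.
    by rewrite mulr_suml; apply: eq_bigr => nu _; rewrite /prodF; ring.
  by rewrite /prodF /F; ring.
have S2 : symb W d e F (fun pi => \sum_(nu | lies W b e nu)
    (arc_coef b mu a kap e nu)%:R * (arc_coef d lam b nu e pi)%:R).
  have := symb_sum (P := lies W b e) (fun nu L => symbZ (q nu) (prod_symb dc bc ec Ll L)).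
  move=> /symb_ext; apply=> [eta /and3P[We fd fe]|nu _]; last first.
    by apply: eq_bigr => nu' L; rewrite q0.
  transitivity (sad d b e eta * sad b a e eta * (fcls K d b lam eta * fcls K b a mu eta
    * fcls K a e kap eta)); last first.
    by rewrite /F; case: (sad_cocycle dc bc ac ec fd fe) => [->|[-> ->]] //; rewrite mulr0 !mul0r.
  have [z|nz] := eqVneq (sad d b e eta) 0.
    by rewrite z !mul0r big1 // => nu _; rewrite /prodF z mul0r mulr0.
  have fb := sad_neq0 dc bc ec fd fe nz.
  transitivity (prodF b a e mu kap eta * (sad d b e eta * fcls K d b lam eta)).
    rewrite qE; last by rewrite /lies We fb.
    by rewrite mulr_suml; apply: eq_bigr => nu _; rewrite /prodF; ring.
  by rewrite /prodF; ring.
exact: (symb_uniq charK dc ec S1 S2).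
Qed.

Lemma fcls_rank d a nu eta : closedw d -> closedw a -> fits d eta -> fits a eta ->
  fits d nu -> fits a nu -> fcls K d a nu eta != 0 -> nu = eta \/ (rank nu < rank eta)%N.
Proof.
by move=> dc ac f1 f2 f3 f4 n0; apply/dominated_rank/(fcls_dominated dc ac f1 f2 f3 f4 n0).
Qed.

(** The product function vanishes at every point that is not above both [lam] and [mu], so
    triangularity excludes classes of smaller rank. *)
Lemma arc_rank d b a lam mu nu : closedw d -> closedw b -> closedw a ->
  lies W d b lam -> lies W b a mu -> lies W d a nu ->
  (arc_coef d lam b mu a nu)%:R != 0 :> K -> (rank lam <= rank nu)%N && (rank mu <= rank nu)%N.
Proof.
move=> dc bc ac Ll Lm Ln; have S := prod_symb dc bc ac Ll Lm.
have [_ fdl fbl] := and3P Ll; have [_ fbm fam] := and3P Lm.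
apply: contraNT; rewrite negb_and -!ltnNge => lt; apply/eqP.
have key N : (forall eta, lies W d a eta -> (rank eta < N)%N -> prodF d b a lam mu eta = 0) ->
    (rank nu < N)%N -> (arc_coef d lam b mu a nu)%:R = 0 :> K.
  by move=> H; apply: (symb_rank charK dc ac S H).
have zero eta : lies W d a eta -> prodF d b a lam mu eta != 0 ->
    (rank lam <= rank eta)%N && (rank mu <= rank eta)%N.
  case/and3P=> We fd fa; rewrite !mulf_eq0 !negb_or => /and3P[s0 n1 n2].
  have fb := sad_neq0 dc bc ac fd fa s0; apply/andP; split.
    by case: (fcls_rank dc bc fd fb fdl fbl n1) => [->|/ltnW].
  by case: (fcls_rank bc ac fb fa fbm fam n2) => [->|/ltnW].
case/orP: lt => lt; apply: key lt => eta L lt; apply/eqP; apply: contraTT lt => /(zero _ L).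
  by rewrite -leqNgt => /andP[].
by rewrite -leqNgt => /andP[].
Qed.

End Products.

(** * Clockwise cups, turning numbers and degrees *)

Section Cups.
Variable M : nat.
Implicit Types (l d b a eta nu : weight M) (P : pred 'I_M).

Lemma sum_mates l (V : zmodType) (F : 'I_M -> V) : closedw l ->
  \sum_x F x = \sum_(x | l x) (F x + F (mate l x)).
Proof.
move=> lc; rewrite (bigID l) big_split /=; congr (_ + _).
rewrite (reindex_inj (can_inj (mateK lc))) /=; apply: eq_bigl => x.
by rewrite mate_label // negbK.
Qed.

Lemma count_cups l P : closedw l ->
  count (fun u => P u.1) (cups l) = #|[pred x | l x && P x]|.
Proof.
move=> lc; rewrite /cups -sum1_count big_filter_cond big_enum_cond /= sum1_card.
rewrite -(card_image (f := fun x => (x, mate l x))); last by move=> x y [].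
apply: eq_card => -[x y]; rewrite unfold_in in_setT /=; apply/andP/imageP => [[c Px]|[z]].
  exists x; first by rewrite inE (cup_left c).
  by rewrite (@arc_mate _ _ x y) // /arc c.
by rewrite inE => /andP[lz Pz] [-> ->]; rewrite Pz cupE // eqxx -label_lt // lz.
Qed.

Lemma turning_self c l : closedw l ->
  turning c l l = 2 * (count (fun u => twist l u.1 == c) (cups l))%:Z.
Proof.
move=> lc; rewrite (count_cups (fun x => twist l x == c) lc) /turning big_mkcond (sum_mates _ lc).
rewrite -sum1_card (raddf_sum Posz) mulr_sumr /= [RHS]big_mkcondr /=.
apply: eq_bigr => x lx; rewrite mateK // mate_label // lx /=.
have -> : twist l (mate l x) = twist l x.
  by rewrite /twist mate_odd // mate_label // addNb addbN negbK.
have lt : (x < mate l x)%N by rewrite -label_lt.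
by case: ifP => _ //=; rewrite /ori lt ltnNge ltnW.
Qed.

(** The rightmost vertex of a circle is the right end of an arc of [l], where [l] has the label
    \wedge. *)
Lemma cwset_self_l d l : closedw d -> closedw l -> cwset d l l = set0.
Proof.
move=> dc lc; apply/setP => r; rewrite !inE; apply/negP => /andP[/eqP rm lr].
have [_ max] := rightmostP d l r; have := max (mate l r).
by rewrite circ_mate_r // rm leqNgt -label_lt // lr => /(_ isT).
Qed.

Lemma cwset_self_r a l : closedw a -> closedw l -> cwset l a l = set0.
Proof.
move=> ac lc; apply/setP => r; rewrite !inE; apply/negP => /andP[/eqP rm lr].
have [_ max] := rightmostP l a r; have := max (mate l r).
by rewrite circ_mate_l // rm leqNgt -label_lt // lr => /(_ isT).
Qed.

Lemma nclock_cwset c d a eta :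
  nclock d a c eta = #|[pred r | (r \in cwset d a eta) && (twist eta r == c)]|.
Proof. by apply: eq_card => r; rewrite !inE; case: (is_rm d a r) => //=; rewrite andbC. Qed.

Lemma turning_total d a eta : closedw d -> closedw a -> fits d eta -> fits a eta ->
  \sum_x sg (eta x) * (ori x (mate d x) + ori x (mate a x))
  = 4 * #|rms d a|%:Z - 8 * #|cwset d a eta|%:Z.
Proof.
move=> dc ac fd fa.
have := turning_circles dc ac true fd fa; have := turning_circles dc ac false fd fa.
have split (P : pred 'I_M) : #|P| = (#|[pred r | P r && (twist eta r == true)]|
    + #|[pred r | P r && (twist eta r == false)]|)%N.
  rewrite -(cardID (fun r => twist eta r) P); congr (_ + _)%N; apply: eq_card => r;
    by rewrite !inE /= ?unfold_in; case: (twist eta r); case: (P r).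
have -> : #|rms d a| = (ncirc d a true eta + ncirc d a false eta)%N.
  by rewrite /rms cardsE; apply: (split (is_rm d a)).
have -> : #|cwset d a eta| = (nclock d a true eta + nclock d a false eta)%N.
  by rewrite !nclock_cwset; apply: (split (mem (cwset d a eta))).
have sp l : turning true l eta + turning false l eta = \sum_x sg (eta x) * ori x (mate l x).
  rewrite /turning [RHS](bigID (twist eta)) /=; congr (_ + _); apply: eq_bigl => x;
    by case: (twist eta x).
under eq_bigr do rewrite mulrDr.
rewrite big_split /= -!sp; lia.
Qed.

Lemma turning_clockwise l eta : closedw l -> fits l eta ->
  \sum_x sg (eta x) * ori x (mate l x)
  = 2 * (size (cups l))%:Z - 4 * (nb_clockwise eta l)%:Z.
Proof.
move=> lc fl; rewrite (sum_mates _ lc).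
have -> : size (cups l) = #|[pred x | l x]|.
  rewrite -(count_predT (cups l)) (count_cups predT lc).
  by apply: eq_card => x; rewrite !inE andbT.
have -> : nb_clockwise eta l = #|[pred x | l x & ~~ eta x]|.
  rewrite /nb_clockwise -(card_image (f := fun x => (x, mate l x))); last by move=> x y [].
  apply: eq_card => -[x y]; rewrite !inE /=; apply/and3P/imageP => [[c e1 e2]|[z]].
    exists x; first by rewrite inE (cup_left c).
    by rewrite (@arc_mate _ _ x y) // /arc c.
  by rewrite inE => /andP[lz ez] [-> ->]; rewrite cupE // eqxx -label_lt // (fitsP _ fl) ez lz.
rewrite -!sum1_card !(raddf_sum Posz) !mulr_sumr /= [in RHS]big_mkcondr /= -sumrB.
apply: eq_bigr => x lx; rewrite mateK // (fitsP _ fl) sgN.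
have lt : (x < mate l x)%N by rewrite -label_lt.
by rewrite /ori lt ltnNge ltnW //=; case: (eta x).
Qed.

Lemma size_cups l : closedw l -> (2 * size (cups l) = M)%N.
Proof.
move=> lc; rewrite -(count_predT (cups l)) (count_cups predT lc).
have := sum_mates (fun=> 1%:Z) lc; rewrite !sumr_const card_ord natz.
rewrite (_ : #|[pred x | l x && predT x]| = #|[pred x | l x]|).
  by move=> e; apply/eqP; rewrite -eqz_nat e -mulr_natr natz; apply/eqP; ring.
by apply: eq_card => x; rewrite !inE andbT.
Qed.

End Cups.

Section Degree.
Variable M : nat.
Implicit Types (l d b a eta nu lam mu : weight M).

(** The total turning is computed circle by circle and cup by cup. This expresses the degree by the
    numbers of circles and of clockwise circles, which are the quantities that surgeries control. *)
Lemma double_degree d a eta : closedw d -> closedw a -> fits d eta -> fits a eta ->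
  (2 * (nb_clockwise eta d + nb_clockwise eta a) + 2 * #|rms d a|
   = M + 4 * #|cwset d a eta|)%N.
Proof.
move=> dc ac fd fa; have := turning_total dc ac fd fa.
under eq_bigr do rewrite mulrDr.
rewrite big_split /= !turning_clockwise //.
have := size_cups dc; have := size_cups ac; lia.
Qed.

Lemma arc_degree d b a lam mu nu : closedw d -> closedw b -> closedw a ->
  fits d lam -> fits b lam -> fits b mu -> fits a mu -> fits d nu -> fits a nu ->
  arc_coef d lam b mu a nu != 0%N ->
  (nb_clockwise nu d + nb_clockwise nu a
   = nb_clockwise lam d + nb_clockwise lam b + (nb_clockwise mu b + nb_clockwise mu a))%N.
Proof.
move=> dc bc ac fdl fbl fbm fam fdn fan.
rewrite /arc_coef -lt0n -has_count => /hasP[s' + /eqP e].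
set s0 := [ffun p => _] => s's.
have s's' : s' \in surgeries d b a (~: points (cups b)) (cups b) s0.
  by rewrite points_cups // setCT.
have c0 : constant_on (stage d b a (cups b)) s0.
  case=> x i [y j]; rewrite initial_stage //= => /andP[/eqP<-]; rewrite !ffunE /= /clockwise.
  by case: x => /rightmost_circ ->.
have [cf E] := surgeries_degree dc bc ac (good_cups b) c0 s's'.
have eq0 := stage_equiv dc bc ac (good_cups b).
have eq1 : equivalence_rel (stage d b a [::]) by apply: stage_equiv.
have n1 : nmarked d b a [::] s' = #|cwset d a nu|.
  rewrite /nmarked big_final //= /cwset cardsE -sum1_card [RHS]big_mkcondr /=.
  apply: eq_bigr => r /eqP rm; rewrite pickv_const //.
  by rewrite e ffunE /clockwise /= rm; case: (nu r).
have n0 : nmarked d b a (cups b) s0 = (#|cwset d b lam| + #|cwset b a mu|)%N.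
  rewrite /nmarked big_initial //= /cwset !cardsE -!sum1_card.
  congr (_ + _)%N; rewrite [RHS]big_mkcondr /=; apply: eq_bigr => r /eqP rm;
    rewrite pickv_const // ffunE /clockwise /= rm.
    by case: (lam r).
  by case: (mu r).
have k1 : #|comps (stage d b a [::])| = #|rms d a|.
  by rewrite -sum1_card big_final //= /rms cardsE -sum1_card.
have k0 : #|comps (stage d b a (cups b))| = (#|rms d b| + #|rms b a|)%N.
  by rewrite -sum1_card big_initial //= /rms !cardsE -!sum1_card.
move: E; rewrite n1 n0 k1 k0.
have := double_degree dc bc fdl fbl; have := double_degree bc ac fbm fam.
have := double_degree dc ac fdn fan; have := size_cups bc; lia.
Qed.

Section Unit.
Variable K : fieldType.
Hypothesis charK : [pchar K] =i pred0.
Variable W : pred (weight M).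
Hypothesis Wdown : forall l eta nu, (forall i, ~~ ray l i) -> fits l nu ->
  W eta -> dominated nu eta -> W nu.

Lemma fits_self l : closedw l -> fits l l.
Proof. by move=> lc; apply/forallP => i; rewrite mate_label //; case: (l i). Qed.

Lemma fcls_nclock d a eta :
  fcls K d a eta eta = \prod_(c : bool) (root_of K c *+ 2) ^+ nclock d a c eta.
Proof.
rewrite /fcls /fset_cls (eq_bigr (fun r => root_of K (twist eta r) *+ 2)); last first.
  by move=> r; rewrite inE => /andP[_ ->].
rewrite (bigID (twist eta)) /= big_bool !nclock_cwset -!prodr_const.
by congr (_ * _); apply: eq_big => [r|r /andP[_]]; rewrite ?unfold_in /=;
  case: (twist eta r).
Qed.

(** Evaluate the product at the point [l]. The factors have no clockwise circle, so their classes
    are 1 and the value is the saddle factor; in the expansion only the class of [l] survives. Both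
    are products of doubled roots, with the same exponents. *)
Lemma arc_unit d l a : closedw d -> closedw l -> closedw a -> W l ->
  fits d l -> fits a l -> (arc_coef d l l l a l)%:R = 1 :> K.
Proof.
move=> dc lc ac Wl fd fa; have fl := fits_self lc.
have Ldl : lies W d l l by rewrite /lies Wl fd.
have Lla : lies W l a l by rewrite /lies Wl fl.
have Lda : lies W d a l by rewrite /lies Wl fd.
have [r [r0 rE]] := prod_symb K Wdown dc lc ac Ldl Lla.
have S : symb W d a (prodF K d l a l l) (fun nu => (arc_coef d l l l a nu)%:R) by exists r.
have := rE l Lda; rewrite (bigD1 l) //= big1 ?addr0; last first.
  move=> nu /andP[L ne]; have [_ fdn fan] := and3P L.
  have [->|n0] := eqVneq (fcls K d a nu l) 0; first by rewrite mulr0.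
  case: (fcls_rank dc ac fd fa fdn fan n0) => [e|lt]; first by rewrite e eqxx in ne.
  (* Classes below [l] have coefficient 0, because the product vanishes at all points of rank
     smaller than that of [l]. *)
  rewrite (triangular charK dc ac (N := rank l) (rho := r) (W := W)) ?mul0r //.
  move=> eta Le lt'; rewrite -rE //; have [_ fde fae] := and3P Le.
  rewrite /prodF; have [->|s0] := eqVneq (sad K d l a eta) 0; first by rewrite mul0r.
  have fle := sad_neq0 dc lc ac fde fae s0.
  have [->|n1] := eqVneq (fcls K d l l eta) 0; first by rewrite mul0r mulr0.
  case: (fcls_rank dc lc fde fle fd fl n1) => [e|lt'']; first by rewrite -e ltnn in lt'.
  by have := ltn_trans lt' lt''; rewrite ltnn.
have one1 : fcls K d l l l = 1 by rewrite /fcls cwset_self_l // /fset_cls big_set0.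
have one2 : fcls K l a l l = 1 by rewrite /fcls cwset_self_r // /fset_cls big_set0.
rewrite /prodF one1 one2 !mulr1.
have [n [sE nE]] := sad_count K dc lc ac fd fl fa.
have -> : sad K d l a l = fcls K d a l l.
  rewrite sE fcls_nclock; apply: eq_bigr => c _; congr (_ ^+ _).
  (* Eliminating the turnings of [d] and [a] from the three identities leaves that of [l], which
     counts its cups; with [nE] this gives [n c = nclock d a c l]. *)
  have := turning_circles dc lc c fd fl; have := turning_circles lc ac c fl fa.
  have := turning_circles dc ac c fd fa; rewrite turning_self //.
  have z1 : nclock d l c l = 0%N.
    by rewrite nclock_cwset cwset_self_l //; apply: eq_card0 => x; rewrite !inE.
  have z2 : nclock l a c l = 0%N.
    by rewrite nclock_cwset cwset_self_r //; apply: eq_card0 => x; rewrite !inE.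
  rewrite z1 z2; have := nE c; lia.
move=> /esym/eqP; rewrite -[X in _ == X]mul1r => /eqP.
by move/(mulIf (fcls_diag charK _ _ _)) => r1; rewrite -r0 // r1 hornerC.
Qed.

End Unit.
End Degree.

(** * Closing a weight *)

Section Heights.
Variables (M : nat) (l : weight M).

Lemma hgt_step k : (k < M)%N -> hgt l k - 1 <= hgt l k.+1 <= hgt l k + 1.
Proof.
move=> kM; have := hgtS l (Ordinal kM); rewrite /= => ->.
by case: (l _); rewrite /sg; lia.
Qed.

Lemma hgt_le k : (k <= M)%N -> hgt l k <= k%:Z.
Proof.
elim: k => [|k IHk] kM; first by rewrite hgt0.
by have := IHk (ltnW kM); have := hgt_step kM; lia.
Qed.

Lemma hgt_le_end k : (k <= M)%N -> hgt l k <= hgt l M + (M - k)%N%:Z.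
Proof.
move=> kM; rewrite -{1}(subKn kM).
elim: (M - k)%N (leq_subr k M) => [|j IHj] jM; first by rewrite subn0 addr0.
have jM' : (M - j.+1 < M)%N by lia.
have := hgt_step jM'; have -> : (M - j.+1).+1 = (M - j)%N by lia.
by have := IHj (ltnW jM); lia.
Qed.

Lemma hgt_end : hgt l M = #|[set i | l i]|%:Z - #|[set i | ~~ l i]|%:Z.
Proof.
have -> : hgt l M = \sum_(x in [set: 'I_M]) sg (l x).
  by apply: eq_bigl => x; rewrite inE ltn_ord.
by rewrite sum_sg; congr (Posz _ - Posz _); apply: eq_card => x; rewrite !inE.
Qed.

Lemma card_labels : (#|[set i | l i]| + #|[set i | ~~ l i]| = M)%N.
Proof.
rewrite -[RHS](card_ord M) -(cardC [set i | l i]); congr (_ + _)%N.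
by apply: eq_card => x; rewrite !inE.
Qed.

Lemma hgt_ge k : - #|[set i | ~~ l i]|%:Z <= hgt l k.
Proof.
have -> : hgt l k = \sum_(x in [set x : 'I_M | (x < k)%N]) sg (l x).
  by apply: eq_bigl => x; rewrite inE.
rewrite sum_sg; have : (#|[set x in [set x : 'I_M | (x < k)%N] | ~~ l x]| <= #|[set i | ~~ l i]|)%N.
  by apply: subset_leq_card; apply/subsetP => x; rewrite !inE => /andP[].
have shuffle (u v w : nat) : (w <= u)%N -> - u%:Z <= v%:Z - w%:Z by lia.
exact: shuffle.
Qed.

End Heights.

Section Closure.
Variables (n m : nat).
Hypothesis le_nm : (n <= m)%N.
Implicit Types (l b eta : weight m) (i j : 'I_m) (u v : 'I_m.*2).

Lemma shift_proof i : (m - n + i < m.*2)%N.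
Proof. by have := ltn_ord i; lia. Qed.

Definition shift i : 'I_m.*2 := Ordinal (shift_proof i).

Lemma cl_left l u : (u < m - n)%N -> cl n l u = true.
Proof. by move=> h; rewrite ffunE h. Qed.

Lemma cl_right l u : (m.*2 - n <= u)%N -> cl n l u = false.
Proof.
move=> h; rewrite ffunE ifN ?ifN // -leqNgt //.
by apply: leq_trans h; lia.
Qed.

Lemma cl_shift l i : cl n l (shift i) = l i.
Proof.
rewrite ffunE /= ltnNge leq_addr /= addKn.
have -> : (m - n + i < m.*2 - n)%N by have := ltn_ord i; lia.
rewrite /label_at; case: insubP => [j _ /val_inj -> //|].
by rewrite ltn_ord.
Qed.

Variant shift_spec u : Prop :=
| InLeft of (u < m - n)%N
| InShift i of u = shift i
| InRight of (m.*2 - n <= u)%N.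

Lemma shiftP u : shift_spec u.
Proof.
case: (ltnP u (m - n)) => [|h1]; first exact: InLeft.
case: (ltnP u (m.*2 - n)) => [h2|]; last exact: InRight.
have um : (u - (m - n) < m)%N by move: h1 h2; lia.
by apply: (@InShift _ (Ordinal um)); apply/val_inj; rewrite /= subnKC.
Qed.

Section Weight.
Variable l : weight m.

Lemma hgt_cl_left k : (k <= m - n)%N -> hgt (cl n l) k = k%:Z.
Proof.
elim: k => [|k IHk] km; first by rewrite hgt0.
have kM : (k < m.*2)%N by move: km; lia.
have := hgtS (cl n l) (Ordinal kM); rewrite /= => ->.
by rewrite cl_left // IHk 1?ltnW // /sg; lia.
Qed.

Lemma hgt_cl_mid (j : nat) : (j <= m)%N -> hgt (cl n l) (m - n + j) = (m - n)%N%:Z + hgt l j.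
Proof.
elim: j => [|j IHj] jm; first by rewrite addn0 hgt_cl_left // hgt0 addr0.
have := hgtS (cl n l) (shift (Ordinal jm)); rewrite /= addnS => ->.
have := hgtS l (Ordinal jm); rewrite /= => ->.
by rewrite cl_shift IHj 1?ltnW // addrA.
Qed.

Hypothesis cardl : #|[set i | l i]| = n.

Lemma hgt_cl_right (j : nat) : (j <= n)%N -> hgt (cl n l) (m.*2 - n + j) = n%:Z - j%:Z.
Proof.
elim: j => [|j IHj] jn.
  have -> : (m.*2 - n + 0)%N = (m - n + m)%N by lia.
  by rewrite hgt_cl_mid // hgt_end; have := card_labels l; rewrite cardl; lia.
have kM : (m.*2 - n + j < m.*2)%N by lia.
have := hgtS (cl n l) (Ordinal kM); rewrite /= addnS => ->.
by rewrite cl_right ?leq_addr // IHj 1?ltnW // /sg; lia.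
Qed.

(** As [l] has [m - n] labels \wedge, its path stays nonnegative after [m - n] up-steps; it then
    stands at height [n] and descends to 0. *)
Lemma closedw_cl : closedw (cl n l).
Proof.
apply: no_ray_height => [k kM|].
  case: (leqP k (m - n)) => [h|h1]; first by rewrite hgt_cl_left.
  case: (leqP k (m.*2 - n)) => [h2|h2].
    have -> : k = (m - n + (k - (m - n)))%N by lia.
    rewrite hgt_cl_mid; last by move: h1 h2; lia.
    have := hgt_ge l (k - (m - n)); have := card_labels l; rewrite cardl; lia.
  have -> : k = (m.*2 - n + (k - (m.*2 - n)))%N by lia.
  by rewrite hgt_cl_right; move: h2 kM; lia.
by have := hgt_cl_right (leqnn n); rewrite subrr subnK //; lia.
Qed.

Lemma cup_shift i j : cup (cl n l) (shift i) (shift j) = cup l i j.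
Proof.
have hi := hgt_cl_mid (ltnW (ltn_ord i)); have hj := hgt_cl_mid (ltn_ord j).
rewrite addnS in hj; apply/cupP/cupP; rewrite !cl_shift.
  rewrite /= hi hj => -[li lj]; rewrite ltn_add2l => ij /addrI e pos.
  split=> // k /andP[ik kj]; have := pos (m - n + k)%N.
  rewrite ltn_add2l leq_add2l ik kj hgt_cl_mid ?ltrD2l => [/(_ isT) //|].
  exact: leq_trans kj (ltnW (ltn_ord j)).
rewrite /= hi hj => -[li lj ij e pos]; split; rewrite ?ltn_add2l ?e // => k /andP[ik kj].
have ek : k = (m - n + (k - (m - n)))%N by lia.
rewrite ek hgt_cl_mid ?ltrD2l; last by have := ltn_ord j; lia.
by apply: pos; lia.
Qed.

Lemma arc_shift i j : arc (cl n l) (shift i) (shift j) = arc l i j.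
Proof. by rewrite /arc !cup_shift. Qed.

Lemma ray_left i : ray l i -> ~~ l i -> (mate (cl n l) (shift i) < m - n)%N.
Proof.
move=> ri li; have := mate_label closedw_cl (shift i); rewrite cl_shift li.
case: (shiftP (mate (cl n l) (shift i))) => // [j e|h]; last by rewrite cl_right.
move/forallP: ri => /(_ j); rewrite -arc_shift -e mate_arc //; exact: closedw_cl.
Qed.

Lemma ray_right i : ray l i -> l i -> (m.*2 - n <= mate (cl n l) (shift i))%N.
Proof.
move=> ri li; have := mate_label closedw_cl (shift i); rewrite cl_shift li.
case: (shiftP (mate (cl n l) (shift i))) => // [h|j e]; first by rewrite cl_left.
move/forallP: ri => /(_ j); rewrite -arc_shift -e mate_arc //; exact: closedw_cl.
Qed.

(** In the closure, a ray labelled \wedge is joined to the added left part and a ray labelled \vee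
    to the added right part; in the wrong order these arcs would cross. *)
Lemma rays_sorted i j : ray l i -> ray l j -> (i < j)%N -> l i -> l j.
Proof.
move=> ri rj ij li; apply: contraT => lj.
have := ray_right ri li; have := ray_left rj lj.
set v := mate _ (shift j); set u := mate _ (shift i) => vl ur.
have c1 : cup (cl n l) v (shift j).
  by rewrite cupE ?mateK ?eqxx ?andbT //=; [lia|exact: closedw_cl|exact: closedw_cl].
have c2 : cup (cl n l) (shift i) u.
  rewrite cupE ?eqxx ?andbT //=; [|exact: closedw_cl].
  by apply: leq_trans ur; have := ltn_ord i; lia.
have := cup_noncross c1 c2; rewrite /= => /(_ _ _).
move=> H; have : (u < m - n + j)%N by apply: H; lia.
by have := ltn_ord j; move: ur; lia.
Qed.

Lemma sum_nonrays (eta : weight m) :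
  (forall i j, cup l i j -> eta i != eta j) ->
  (2 * \sum_(i | ~~ ray l i) eta i = #|[pred i | ~~ ray l i]|)%N.
Proof.
move=> H.
have mK i : ~~ ray l i -> mate l (mate l i) = i.
  by move=> ri; apply: arc_mate; rewrite arc_sym mate_arc.
have rm i : ~~ ray l i -> ~~ ray l (mate l i).
  move=> ri; rewrite negb_forall; apply/existsP; exists i.
  by rewrite negbK arc_sym mate_arc.
have E : (\sum_(i | ~~ ray l i) eta i = \sum_(i | ~~ ray l i) eta (mate l i))%N.
  rewrite (reindex_onto (mate l) (mate l)) /=; last by move=> i /mK.
  apply: eq_bigl => i; apply/andP/idP => [[h /eqP <-]|ri]; first exact: rm.
  by rewrite rm // mK ?eqxx.
rewrite mul2n -addnn {2}E.
rewrite -big_split /= -sum1_card; apply: eq_bigr => i ri.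
have := mate_arc ri => /orP[] /H; by case: (eta i); case: (eta _).
Qed.

(** Each cup carries one \vee, so [eta] and [l] have equally many on the rays; both are monotone
    there, hence equal. *)
Lemma ray_agree eta i : #|[set i | eta i]| = n -> orients eta l -> ray l i -> eta i = l i.
Proof.
move=> cardeta /andP[/forallP cupsH /forallP raysH] ri.
have hc e : (forall i j, cup l i j -> e i != e j) -> #|[set i | e i]| = n ->
    (\sum_(i | ray l i) e i + \sum_(i | ~~ ray l i) e i = n)%N.
  move=> _ <-; transitivity (\sum_i e i)%N; first by rewrite [RHS](bigID (ray l)).
  rewrite -sum1_card [RHS]big_mkcond /=.
  by apply: eq_bigr => j _; rewrite inE; case: (e j).
have cl1 : forall i j, cup l i j -> l i != l j.
  by move=> i' j' c; rewrite (cup_left c) (negPf (cup_right c)).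
have ce1 : forall i j, cup l i j -> eta i != eta j.
  by move=> i' j'; have /forallP/(_ j')/implyP := cupsH i'.
have sums : (\sum_(i | ray l i) eta i = \sum_(i | ray l i) l i)%N.
  have := hc _ cl1 cardl; have := hc _ ce1 cardeta.
  by have := sum_nonrays cl1; have := sum_nonrays ce1; lia.
have se j k : ray l j -> ray l k -> (j < k)%N -> eta j -> eta k.
  move=> rj rk jk ej; have /forallP/(_ k)/implyP := raysH j.
  by apply; rewrite rj rk jk ej.
have key (s t : weight m) : (forall j k, ray l j -> ray l k -> (j < k)%N -> s j -> s k) ->
    (forall j k, ray l j -> ray l k -> (j < k)%N -> t j -> t k) ->
    s i -> ~~ t i -> (\sum_(i | ray l i) t i < \sum_(i | ray l i) s i)%N.
  move=> ss st si ti; rewrite (bigD1 i) //= [X in (_ < X)%N](bigD1 i) //= si (negPf ti).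
  rewrite add0n add1n ltnS; apply: leq_sum => j /andP[rj ji].
  move: ji; rewrite -val_eqE neq_ltn => /orP[lt|lt].
    by case tj: (t j) => //; case/negP: ti; apply: st tj.
  by rewrite (ss i j) //; case: (t j).
case ei: (eta i); case li: (l i) => //.
  by have := key _ _ se rays_sorted ei (negbT li); rewrite sums ltnn.
by have := key _ _ rays_sorted se li (negbT ei); rewrite sums ltnn.
Qed.

(** The arcs that close the rays force the labels of [l] on them, and by [ray_agree] an orientation
    has exactly these labels. *)
Lemma fits_cl eta : #|[set i | eta i]| = n -> fits (cl n l) (cl n eta) = orients eta l.
Proof.
move=> ce; apply/idP/idP => [f|o].
  have agree i : ray l i -> eta i = l i.
    move=> ri; have := fitsP (shift i) f; rewrite cl_shift.
    case li: (l i); first by rewrite (cl_right _ (ray_right ri li)) => /esym/negbFE.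
    by rewrite (cl_left _ (ray_left ri (negbT li))) => /esym/negbTE.
  apply/andP; split; apply/forallP => i; apply/forallP => j; apply/implyP.
    rewrite -cup_shift => c; have := fitsP (shift i) f.
    by rewrite (@arc_mate _ _ _ (shift j)) ?/arc ?c // !cl_shift => ->; case: (eta i).
  case/and4P=> ri rj ij; rewrite !agree //; exact: rays_sorted.
have agree := ray_agree ce o.
case/andP: o => /forallP cupsH _.
have hcup i j : cup l i j -> eta i != eta j.
  by have /forallP/(_ j)/implyP := cupsH i.
have sh i : cl n eta (mate (cl n l) (shift i)) != cl n eta (shift i).
  have [ri|nri] := boolP (ray l i).
    rewrite cl_shift agree //; case li: (l i).
      by rewrite cl_right // ray_right.
    by rewrite cl_left // ray_left // li.
  have := mate_arc nri; rewrite -arc_shift (arcE closedw_cl) => /eqP->.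
  rewrite !cl_shift; have /orP[c|c] := mate_arc nri; last exact: hcup c.
  by rewrite eq_sym (hcup _ _ c).
apply/forallP => u; case: (shiftP u) => [h|i ->|h]; last 2 first.
- exact: sh.
- case: (shiftP (mate (cl n l) u)) => [h'|i e|h'].
  + by rewrite cl_left // cl_right.
  + by have := sh i; rewrite -e mateK 1?eq_sym //; apply: closedw_cl.
  have := mate_label closedw_cl u; by rewrite !cl_right.
case: (shiftP (mate (cl n l) u)) => [h'|i e|h'].
+ have := mate_label closedw_cl u; by rewrite !cl_left.
+ by have := sh i; rewrite -e mateK 1?eq_sym //; apply: closedw_cl.
by rewrite cl_right // cl_left.
Qed.

Lemma nb_clockwise_cl eta : nb_clockwise (cl n eta) (cl n l) = nb_clockwise eta l.
Proof.
rewrite /nb_clockwise -(card_image (f := fun p => (shift p.1, shift p.2))).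
  apply: eq_card => -[u v]; rewrite !inE /=; apply/and3P/imageP => [[c e1 e2]|[[i j]]].
    have uv := cup_lt c.
    case: (shiftP u) => [h|i ei|h]; first by rewrite cl_left in e1.
      case: (shiftP v) => [h|j ej|h]; last by rewrite cl_right in e2.
        by have := cup_right c; rewrite cl_left.
      exists (i, j); rewrite ?ei ?ej // inE /=.
      by move: c e1 e2; rewrite ei ej cup_shift !cl_shift => -> -> ->.
    by have := cup_left c; rewrite cl_right.
  by rewrite inE /= => /and3P[c e1 e2] [-> ->]; rewrite cup_shift !cl_shift.
by move=> [i j] [i' j'] [/= /addnI /val_inj -> /addnI /val_inj ->].
Qed.

Lemma orients_clockwise0 eta : #|[set i | eta i]| = n -> orients eta l ->
  nb_clockwise eta l = 0%N -> eta = l.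
Proof.
move=> ce o; have agree := ray_agree ce o; case/andP: o => /forallP cupsH _.
move/eqP; rewrite cards_eq0 => /eqP/setP cw; apply/ffunP => i.
have [ri|nri] := boolP (ray l i); first exact: agree.
have H j k : cup l j k -> eta j = true /\ eta k = false.
  move=> c; have /forallP/(_ k)/implyP/(_ c) := cupsH j.
  by have := cw (j, k); rewrite !inE /= c /=; case: (eta j); case: (eta k).
have /orP[c|c] := mate_arc nri; have [e1 e2] := H _ _ c.
  by rewrite e1 (cup_left c).
by rewrite e2 (negPf (cup_right c)).
Qed.

End Weight.

Definition in_cl (eta : weight m.*2) : bool :=
  [exists l : weight m, (#|[set i | l i]| == n) && (cl n l == eta)].

(** Over the added vertices the path of a closure is as high as possible: a path is bounded by the
    distance to its start and, when it ends at 0, by the distance to its end. A path above that of a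
    closure thus coincides with it there. This is why the remaining weights span an ideal. *)
Lemma in_cl_down (l eta nu : weight m.*2) : closedw l -> fits l nu ->
  in_cl eta -> dominated nu eta -> in_cl nu.
Proof.
move=> lc fl /existsP[e /andP[/eqP ce /eqP <-]] dom.
have nuM : hgt nu m.*2 = 0.
  have -> : hgt nu m.*2 = \sum_x sg (nu x) by apply: eq_bigl => x; rewrite ltn_ord.
  rewrite (sum_mates _ lc) big1 // => x _.
  by rewrite (fitsP _ fl) sgN subrr.
have hl k : (k <= m - n)%N -> hgt nu k = k%:Z.
  move=> km; apply/eqP; rewrite eq_le hgt_le; last by move: km; lia.
  by rewrite -(hgt_cl_left e km) dom.
have hr (j : nat) : (j <= n)%N -> hgt nu (m.*2 - n + j) = n%:Z - j%:Z.
  move=> jn; have jM : (m.*2 - n + j <= m.*2)%N by lia.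
  have := hgt_le_end nu jM; rewrite nuM add0r.
  have := dom (m.*2 - n + j)%N; rewrite hgt_cl_right //.
  by move: jM; lia.
pose l' : weight m := [ffun i => nu (shift i)].
have el' : cl n l' = nu.
  apply/ffunP => u; case: (shiftP u) => [h|i ->|h].
  - have := hgtS nu u; rewrite !hl //; last exact: ltnW.
    by rewrite cl_left //; case: (nu u) => //; rewrite /sg; lia.
  - by rewrite cl_shift ffunE.
  have := hgtS nu u; have eu : u = (m.*2 - n + (u - (m.*2 - n)))%N :> nat by rewrite subnKC.
  have un : (u - (m.*2 - n) < n)%N by have := ltn_ord u; move: h; lia.
  rewrite eu -addnS !hr //; last exact: ltnW.
  by rewrite cl_right //; case: (nu u) => //; rewrite /sg; lia.
apply/existsP; exists l'; rewrite el' eqxx andbT.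
have := hr 0%N (leq0n _); rewrite -el' addn0.
have -> : (m.*2 - n)%N = (m - n + m)%N by lia.
rewrite hgt_cl_mid // hgt_end; have := card_labels l'; rewrite -eqz_nat; lia.
Qed.

Lemma cl_inj : injective (@cl n m).
Proof. by move=> l l' e; apply/ffunP => i; rewrite -cl_shift e cl_shift. Qed.

End Closure.

(** * The extended arc algebra *)

(* Conversion tests would otherwise run the surgery procedure. *)
Opaque arc_coef.

Section ArcAlgebra.
Variable K : fieldType.
Hypothesis charK : [pchar K] =i pred0.
Variables (n m : nat).
Hypothesis le_nm : (n <= m)%N.
Local Notation B := (circle_diagram n m).
Local Notation L := (Lambda n m).
Implicit Types (x y z s : B) (d b a e : L).

Definition clL (e : L) : weight m.*2 := cl n (val e).

Definition mulK x y z : K := (K_coef x y z)%:R.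

Definition height (e : L) : nat := rank (clL e).

Lemma count_val e : #|[set i | (val e) i]| = n.
Proof. exact: eqP (valP e). Qed.

Lemma clL_closed e : closedw (clL e).
Proof. have := closedw_cl le_nm (count_val e). apply. Qed.

Lemma clL_inj : injective clL.
Proof. by move=> e e' /(cl_inj le_nm) /val_inj. Qed.

Lemma in_clL e : in_cl n (clL e).
Proof. by apply/existsP; exists (val e); rewrite (valP e) eqxx. Qed.

Lemma in_clP (nu : weight m.*2) : in_cl n nu -> exists e, nu = clL e.
Proof. by case/existsP => l /andP[cl_ /eqP <-]; exists (Sub l cl_). Qed.

Lemma fits_clL e b : fits (clL b) (clL e) = orients (val e) (val b).
Proof. have := fits_cl le_nm (count_val b) (count_val e). apply. Qed.

Lemma height_inj : injective height.
Proof. by move=> e e' /rank_inj/clL_inj. Qed.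

Lemma Wdown (l eta nu : weight m.*2) : (forall i, ~~ ray l i) -> fits l nu ->
  in_cl n eta -> dominated nu eta -> in_cl n nu.
Proof. by move=> lc fl; apply: (in_cl_down le_nm lc fl). Qed.

Lemma liesE d a e : lies (@in_cl n m) (clL d) (clL a) (clL e)
  = orients (val e) (val d) && orients (val e) (val a).
Proof. by rewrite /lies in_clL !fits_clL. Qed.

Lemma lies_diagram x : lies (@in_cl n m) (clL (dcup x)) (clL (dcap x)) (clL (dweight x)).
Proof. by rewrite liesE; apply: (valP x). Qed.

Lemma diagram_inj x y : dcup x = dcup y -> dweight x = dweight y -> dcap x = dcap y -> x = y.
Proof.
case: x y => [[[b e] a] ?] [[[b' e'] a'] ?]; rewrite /dcup /dweight /dcap /=.
by move=> eb ee ea; apply/val_inj; rewrite /= eb ee ea.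
Qed.

Lemma lies_self d a : orients (val a) (val d) -> orients (val a) (val d) && orients (val a) (val a).
Proof. by move=> ->; rewrite -fits_clL fits_self //; apply: clL_closed. Qed.

Definition mkdiag d e a (h : orients (val e) (val d) && orients (val e) (val a)) : B :=
  Sub (d, e, a) h.

Lemma degree_nb x : degree x = (nb_clockwise (clL (dweight x)) (clL (dcup x))
  + nb_clockwise (clL (dweight x)) (clL (dcap x)))%N.
Proof. by rewrite /degree /clL !(nb_clockwise_cl le_nm) ?count_val. Qed.

Lemma degree0 x : degree x = 0%N -> dcup x = dweight x /\ dcap x = dweight x.
Proof.
move=> /eqP; rewrite addn_eq0 => /andP[/eqP h1 /eqP h2].
have /andP[o1 o2] := valP x.
split; apply/val_inj/esym.
  exact: (orients_clockwise0 le_nm (count_val _) (count_val _) o1 h1).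
exact: (orients_clockwise0 le_nm (count_val _) (count_val _) o2 h2).
Qed.

Lemma mulK_matched x y z : mulK x y z != 0 ->
  [/\ dcap x = dcup y, dcup z = dcup x & dcap z = dcap y].
Proof.
rewrite /mulK /K_coef; case: ifP => [/and3P[/eqP h1 /eqP h2 /eqP h3] //|_].
by rewrite eqxx.
Qed.

Lemma mulKE x y z : dcap x = dcup y -> dcup z = dcup x -> dcap z = dcap y ->
  mulK x y z = (arc_coef (clL (dcup x)) (clL (dweight x)) (clL (dcap x))
    (clL (dweight y)) (clL (dcap y)) (clL (dweight z)))%:R.
Proof. by move=> h1 h2 h3; rewrite /mulK /K_coef h1 h2 h3 !eqxx. Qed.

Opaque K_coef mulK.

Lemma mulK_height x y z : mulK x y z != 0 ->
  (height (dweight x) <= height (dweight z))%N /\ (height (dweight y) <= height (dweight z))%N.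
Proof.
move=> nz; have [h1 h2 h3] := mulK_matched nz; move: nz; rewrite mulKE // => nz.
have Lx := lies_diagram x; have Ly := lies_diagram y; have Lz := lies_diagram z.
rewrite -h1 in Ly; rewrite h2 h3 in Lz.
have := arc_rank charK Wdown (@clL_closed _) (@clL_closed _) (@clL_closed _) Lx Ly Lz nz.
by case/andP.
Qed.

Lemma mulK_degree x y z : mulK x y z != 0 -> degree z = (degree x + degree y)%N.
Proof.
move=> nz; have [h1 h2 h3] := mulK_matched nz; move: nz; rewrite mulKE // => nz.
have /and3P[_ f1 f2] := lies_diagram x; have /and3P[_ f3 f4] := lies_diagram y.
have /and3P[_ f5 f6] := lies_diagram z.
rewrite !degree_nb h2 h3 -h1 in f3 f5 f6 nz *.
apply: (arc_degree (clL_closed _) (clL_closed _) (clL_closed _) f1 f2 f3 f4 f5 f6).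
by apply: contraNneq nz => ->.
Qed.

(** Translates sums over basis elements with given cup and cap diagrams into the sums over weights
    of [arc_assoc]. *)
Lemma sum_diagrams (V : zmodType) d a (F : weight m.*2 -> V) :
  \sum_(s | (dcup s == d) && (dcap s == a)) F (clL (dweight s))
  = \sum_(nu | lies (@in_cl n m) (clL d) (clL a) nu) F nu.
Proof.
set A := [set s : B | (dcup s == d) && (dcap s == a)].
transitivity (\sum_(nu in [set clL (dweight s) | s in A]) F nu).
  rewrite big_imset /=; first by apply: eq_bigl => s; rewrite inE.
  move=> s s'; rewrite !inE => /andP[/eqP h1 /eqP h2] /andP[/eqP h3 /eqP h4] /clL_inj e.
  by apply: diagram_inj; rewrite ?h1 ?h2 ?h3 ?h4.
apply: eq_bigl => nu; apply/imsetP/idP => [[s]|Ln].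
  by rewrite inE => /andP[/eqP<- /eqP<-] ->; apply: lies_diagram.
have [e ee] : exists e, nu = clL e by apply: in_clP; case/and3P: Ln.
rewrite ee liesE in Ln; exists (mkdiag Ln); last by rewrite ee.
by rewrite inE /dcup /dcap /= !eqxx.
Qed.

Lemma sum_between (F : B -> K) d a : (forall s, F s != 0 -> dcup s = d /\ dcap s = a) ->
  \sum_s F s = \sum_(s | (dcup s == d) && (dcap s == a)) F s.
Proof.
move=> h; rewrite [RHS]big_mkcond; apply: eq_bigr => s _.
case: ifP => [//|/negP N]; apply/eqP; apply: contra_notT N => /h[-> ->].
by rewrite !eqxx.
Qed.

Lemma mulK_assoc x y z t :
  \sum_s mulK x y s * mulK s z t = \sum_s mulK y z s * mulK x s t.
Proof.
have [/and4P[/eqP h1 /eqP h2 /eqP h3 /eqP h4]|N] := boolP [&& dcap x == dcup y,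
    dcap y == dcup z, dcup t == dcup x & dcap t == dcap z]; last first.
  transitivity (0 : K); [|symmetry]; apply: big1 => s _; apply/eqP; apply: contraNT N;
    rewrite mulf_eq0 negb_or => /andP[/mulK_matched[e1 e2 e3] /mulK_matched[e4 e5 e6]].
    by rewrite e1 -e3 e4 -e2 e5 e6 !eqxx.
  by rewrite e1 e4 e2 e5 e6 e3 !eqxx.
transitivity (\sum_(s | (dcup s == dcup x) && (dcap s == dcap y)) mulK x y s * mulK s z t).
  apply: sum_between => s; rewrite mulf_eq0 negb_or.
  by case/andP=> /mulK_matched[_ -> ->].
transitivity (\sum_(s | (dcup s == dcup y) && (dcap s == dcap z)) mulK y z s * mulK x s t);
  last first.
  apply/esym/sum_between => s; rewrite mulf_eq0 negb_or.
  by case/andP=> /mulK_matched[_ -> ->].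
transitivity (\sum_(s | (dcup s == dcup x) && (dcap s == dcap y))
    (arc_coef (clL (dcup x)) (clL (dweight x)) (clL (dcap x)) (clL (dweight y))
       (clL (dcap y)) (clL (dweight s)))%:R *
    (arc_coef (clL (dcup x)) (clL (dweight s)) (clL (dcap y)) (clL (dweight z))
       (clL (dcap z)) (clL (dweight t)))%:R : K).
  apply: eq_bigr => s /andP[/eqP e1 /eqP e2].
  rewrite !mulKE ?e1 ?e2; try by rewrite ?h1 ?h2 ?h3 ?h4.
have Lx := lies_diagram x; have Ly := lies_diagram y; have Lz := lies_diagram z.
have Lt := lies_diagram t; rewrite -h1 in Ly; rewrite -h2 in Lz; rewrite h3 h4 in Lt.
have := arc_assoc charK Wdown (@clL_closed _) (@clL_closed _) (@clL_closed _)
  (@clL_closed _) Lx Ly Lz Lt.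
clear Lx Ly Lz Lt; rewrite -!sum_diagrams => ->.
rewrite -h1; apply: eq_bigr => s /andP[/eqP e1 /eqP e2].
rewrite !mulKE ?e1 ?e2; first by rewrite h1 h2.
all: by rewrite ?h1 ?h2 ?h3 ?h4.
Qed.

Lemma weight_self_l x : orients (val (dweight x)) (val (dcup x))
  && orients (val (dweight x)) (val (dweight x)).
Proof. by apply: lies_self; case/andP: (valP x). Qed.

Lemma weight_self_r x : orients (val (dweight x)) (val (dweight x))
  && orients (val (dweight x)) (val (dcap x)).
Proof.
have [_ o] := andP (valP x); rewrite [X in _ && X]o andbT.
by have /andP[] := lies_self o.
Qed.

Definition lpart x : B := mkdiag (weight_self_l x).
Definition rpart x : B := mkdiag (weight_self_r x).

Lemma orients_self e : orients (val e) (val e) && orients (val e) (val e).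
Proof. by rewrite -fits_clL fits_self //; apply: clL_closed. Qed.

Definition idem e : B := mkdiag (orients_self e).

Lemma mulK_parts x : mulK (lpart x) (rpart x) x = 1.
Proof.
rewrite mulKE //; have /and3P[W1 f1 f2] := lies_diagram x.
by apply: (arc_unit charK Wdown) => //; apply: clL_closed.
Qed.

Lemma card_Lambda : #|{: L}| = 'C(m, n).
Proof.
rewrite -[in RHS](card_ord m) -card_draws card_sig.
rewrite -(card_imset _ (f := fun l : weight m => [set i | l i])).
  apply: eq_card => A; rewrite inE; apply/imsetP/idP => [[l + ->] //|cA].
  exists [ffun i => i \in A]; last by apply/setP => i; rewrite inE ffunE.
  by rewrite inE; congr (_ == _): cA; apply: eq_card => i; rewrite inE ffunE.
by move=> l l' /setP e; apply/ffunP => i; have := e i; rewrite !inE.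
Qed.

End ArcAlgebra.

(** * The Hochschild complex *)

Lemma sum_scale_sum (K : fieldType) (V : lmodType K) (I J : finType) (c : I -> K)
    (g : I -> J -> K) (F : J -> V) :
  \sum_i c i *: \sum_j g i j *: F j = \sum_j (\sum_i c i * g i j) *: F j.
Proof.
rewrite (eq_bigr (fun i => \sum_j (c i * g i j) *: F j)) => [|i _]; last first.
  by rewrite scaler_sumr; apply: eq_bigr => j _; rewrite scalerA.
by rewrite exchange_big; apply: eq_bigr => j _; rewrite scaler_suml.
Qed.

Lemma sum_scale_exchange (K : fieldType) (V : lmodType K) (I J : finType) (c : I -> K)
    (g : J -> K) (F : I -> J -> V) :
  \sum_i c i *: \sum_j g j *: F i j = \sum_j g j *: \sum_i c i *: F i j.
Proof.
rewrite (eq_bigr (fun i => \sum_j c i *: (g j *: F i j))) => [|i _]; last first.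
  by rewrite scaler_sumr.
rewrite exchange_big; apply: eq_bigr => j _; rewrite scaler_sumr.
by apply: eq_bigr => i _; rewrite !scalerA mulrC.
Qed.

Lemma eq_scale (K : fieldType) (V : lmodType K) (c : K) (u v : V) :
  (c != 0 -> u = v) -> c *: u = c *: v.
Proof. by have [->|_ ->] := eqVneq c 0; rewrite ?scale0r. Qed.

Lemma eq_sum_scale (K : fieldType) (V : lmodType K) (I : finType) (c : I -> K) (F G : I -> V) :
  (forall i, c i != 0 -> F i = G i) -> \sum_i c i *: F i = \sum_i c i *: G i.
Proof. by move=> e; apply: eq_bigr => i _; apply/eq_scale/e. Qed.

Lemma sum_scale_const (K : fieldType) (V : lmodType K) (I : finType) (c k : I -> K) (k0 : K)
    (F : I -> V) : (forall i, c i != 0 -> k i = k0) ->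
  \sum_i c i *: (k i *: F i) = k0 *: \sum_i c i *: F i.
Proof.
move=> e; rewrite scaler_sumr; apply: eq_bigr => i _; rewrite !scalerA mulrC.
by have [->|/e ->] := eqVneq (c i) 0; rewrite ?mulr0.
Qed.

Lemma scale_sum_exchange (K : fieldType) (V : lmodType K) (I : finType) (J : Type) (r : seq J)
    (c : I -> K) (g : J -> K) (F : J -> I -> V) :
  \sum_i c i *: \sum_(j <- r) g j *: F j i = \sum_(j <- r) g j *: \sum_i c i *: F j i.
Proof.
rewrite (eq_bigr (fun i => \sum_(j <- r) c i *: (g j *: F j i))) => [|i _]; last first.
  by rewrite scaler_sumr.
rewrite exchange_big; apply: eq_bigr => j _; rewrite scaler_sumr.
by apply: eq_bigr => i _; rewrite !scalerA mulrC.
Qed.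

Section LinearExtension.
Variables (K : fieldType) (B : finType).
Local Notation chain := {malg K[seq B]}.
Implicit Types (c : chain) (w : seq B) (phi : seq B -> chain).

Definition lin phi c : chain := \sum_(w <- msupp c) c@_w *: phi w.

Lemma lin_sub phi (D : {fset seq B}) c : (msupp c `<=` D)%fset ->
  lin phi c = \sum_(w <- D) c@_w *: phi w.
Proof.
move=> cD; rewrite [RHS](big_fsetID _ (mem (msupp c))) /=.
rewrite [X in _ + X]big1_fset ?addr0; last first.
  by move=> w; rewrite !inE /= => /andP[_ wc] _; rewrite mcoeff_outdom ?scale0r.
by apply: eq_fbigl => w; rewrite !inE /= andb_idl // => /(fsubsetP cD).
Qed.

Fact lin_linear phi : linear (lin phi).
Proof.
move=> a u v; set D := (msupp u `|` msupp v)%fset.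
rewrite (@lin_sub _ D) ?(@lin_sub _ D u) ?(@lin_sub _ D v) ?fsubsetUl ?fsubsetUr //; last first.
  apply: fsubset_trans (msuppD_le _ _) _.
  exact: fsetSU (msuppZ_le _ _).
rewrite scaler_sumr -big_split /=; apply: eq_bigr => w _.
by rewrite mcoeffD mcoeffZ scalerDl scalerA.
Qed.

HB.instance Definition _ phi := GRing.isLinear.Build K chain chain *:%R
  (lin phi) (lin_linear phi).

Lemma lin_word phi w : lin phi << w >> = phi w.
Proof. by rewrite /lin msuppU oner_eq0 big_seq_fset1 mcoeffUU scale1r. Qed.

Lemma chainE c : c = \sum_(w <- msupp c) c@_w *: (<< w >> : chain).
Proof.
rewrite {1}(monalgE c); apply: eq_bigr => w _.
by apply/malgP => k; rewrite mcoeffZ !mcoeffU mulrnAr mulr1.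
Qed.

Definition supported (P : seq B -> Prop) c : Prop := forall w, w \in msupp c -> P w.

Section Supported.
Variable P : seq B -> Prop.

Lemma supported0 : supported P 0. Proof. by move=> w; rewrite msupp0. Qed.

Lemma supportedD c c' : supported P c -> supported P c' -> supported P (c + c').
Proof.
by move=> h h' w /(fsubsetP (msuppD_le _ _)); rewrite inE => /orP[/h|/h'].
Qed.

Lemma supportedZ (a : K) c : supported P c -> supported P (a *: c).
Proof. by move=> h w /(fsubsetP (msuppZ_le _ _))/h. Qed.

Lemma supportedN c : supported P c -> supported P (- c).
Proof. by move=> h w; rewrite msuppN => /h. Qed.

Lemma supportedB c c' : supported P c -> supported P c' -> supported P (c - c').
Proof. by move=> h h'; apply: supportedD h (supportedN h'). Qed.

Lemma supported_sum (I : Type) (r : seq I) (Q : pred I) (F : I -> chain) :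
  (forall i, Q i -> supported P (F i)) -> supported P (\sum_(i <- r | Q i) F i).
Proof.
by move=> h; elim/big_ind: _ => //; [exact: supported0|exact: supportedD].
Qed.

Lemma supported_word w : P w -> supported P << w >>.
Proof. by move=> Pw u; rewrite msuppU oner_eq0 inE => /eqP->. Qed.

End Supported.

Lemma supported_sub (P Q : seq B -> Prop) c : (forall w, P w -> Q w) ->
  supported P c -> supported Q c.
Proof. by move=> h hc w /hc/h. Qed.

Lemma supported_lin (P Q : seq B -> Prop) phi c :
  (forall w, P w -> supported Q (phi w)) -> supported P c -> supported Q (lin phi c).
Proof.
move=> h hc; rewrite /lin big_seq; apply: supported_sum => w /hc/h.
exact: supportedZ.
Qed.

End LinearExtension.

Section Hochschild.
Variables (K : fieldType) (B : finType) (deg : B -> nat) (mul : B -> B -> B -> K).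
Local Notation chain := {malg K[seq B]}.
Implicit Types (a b x y z : B) (w s : seq B).

Definition koszul a s : K := (-1) ^+ (deg a * \sum_(b <- s) deg b).

(** The last face absorbs its Koszul sign, so that the differential becomes the plain alternating
    sum of the faces of a simplicial object. *)
Definition pface w (i : nat) : chain :=
  if w is a0 :: _ then
    if (i < (size w).-1)%N then face mul a0 w i
    else koszul (nth a0 w (size w).-1) (take (size w).-1 w) *: last_face mul a0 w
  else 0.

Arguments pface : simpl never.

Lemma pface_inner s1 a b s2 : pface (s1 ++ a :: b :: s2) (size s1)
  = \sum_z mul a b z *: << s1 ++ z :: s2 >>.
Proof.
have E a0 : face mul a0 (s1 ++ a :: b :: s2) (size s1)
    = \sum_z mul a b z *: << s1 ++ z :: s2 >>.
  rewrite /face; apply: eq_bigr => z _.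
  rewrite !nth_cat ltnn subnn ltnNge leqnSn /= subSnn /= take_size_cat //.
  by rewrite drop_cat ltnNge (leq_trans (leqnSn _)) //= -addn2 addKn /= drop0.
have lt : (size s1 < (size (s1 ++ a :: b :: s2)).-1)%N by rewrite size_cat /= addnS /= addnS ltnS leq_addr.
rewrite /pface lt; by case: s1 lt E => [|a0 s1] _ E; apply: E.
Qed.

Lemma pface_last a s b : pface (a :: rcons s b) (size s).+1
  = koszul b (a :: s) *: \sum_z mul b a z *: << z :: s >>.
Proof.
have sE : (size (a :: rcons s b)).-1 = (size s).+1 by rewrite /= size_rcons.
have tE : take (size s).+1 (a :: rcons s b) = a :: s.
  by rewrite -cats1 -cat_cons take_size_cat.
have nE : nth a (a :: rcons s b) (size s).+1 = b by rewrite /= nth_rcons ltnn eqxx.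
have lE : last_face mul a (a :: rcons s b) = \sum_z mul b a z *: << z :: s >>.
  rewrite /last_face sE tE nE.
  by [].
by rewrite /pface sE ltnn tE nE lE.
Qed.

Lemma hochschild_wordE w : (1 < size w)%N ->
  hochschild_word deg mul w = \sum_(i < size w) (-1) ^+ i *: pface w i.
Proof.
case: w => [//|a0 [//|a1 w]] _; rewrite /hochschild_word [RHS]big_ord_recr /=.
rewrite [pface _ (size w).+1]/pface /= ltnn /koszul exprD scalerA; congr (_ + _).
by apply: eq_bigr => i _; rewrite /pface ltn_ord.
Qed.

Lemma hochschild_word1 w : (size w <= 1)%N -> hochschild_word deg mul w = 0.
Proof. by case: w => [//|a0 [//|a1 w]]. Qed.

Lemma hochschild_dE : hochschild_d deg mul =1 lin (hochschild_word deg mul).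
Proof. by []. Qed.

Lemma word_ends w : (1 < size w)%N -> exists a s b, w = a :: rcons s b.
Proof.
case: w => // a w; case/lastP: w => // s b _.
by exists a, s, b.
Qed.

Lemma pface_size w i : (1 < size w)%N -> (i < size w)%N ->
  supported (fun w' => size w' = (size w).-1) (pface w i).
Proof.
move=> sw iw; have [lt|ge] := ltnP i (size w).-1.
  have [s1 [a [b [s2 [ew es]]]]] : exists s1 a b s2, w = s1 ++ a :: b :: s2 /\ size s1 = i.
    have i1 : (i.+1 < size w)%N by lia.
    case: w {sw} iw lt i1 => // a0 w0 iw lt i1; set w := a0 :: w0.
    exists (take i w), (nth a0 w i), (nth a0 w i.+1), (drop i.+2 w); split.
      by rewrite -(drop_nth a0 i1) -(drop_nth a0 iw) cat_take_drop.
    by rewrite size_takel // ltnW.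
  rewrite ew -es pface_inner; apply: supported_sum => z _; apply: supportedZ; apply: supported_word.
  by rewrite /= !size_cat /= !addnS.
have {ge iw}-> : i = (size w).-1 by lia.
case: w sw => // a w /=; case/lastP: w => [//|s b] _.
have -> : (size (rcons s b)) = (size s).+1 by rewrite size_rcons.
rewrite pface_last; apply: supportedZ; apply: supported_sum => z _.
by apply: supportedZ; apply: supported_word.
Qed.

Hypothesis assoc : forall x y z t,
  \sum_s mul x y s * mul s z t = \sum_s mul y z s * mul x s t.
Hypothesis mul_deg : forall x y z, mul x y z != 0 -> deg z = (deg x + deg y)%N.

Definition dface i : chain -> chain := lin (pface^~ i).

Lemma dfaceZ i (k : K) c : dface i (k *: c) = k *: dface i c.
Proof. exact: linearZ. Qed.

Lemma dface_bigsum p i (c : 'I_p -> K) (F : 'I_p -> chain) :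
  dface i (\sum_j c j *: F j) = \sum_j c j *: dface i (F j).
Proof. by rewrite /dface linear_sum; apply: eq_bigr => j _; exact: linearZ. Qed.

Lemma dface_sum (F : B -> seq B) (c : B -> K) i :
  dface i (\sum_z c z *: << F z >>) = \sum_z c z *: pface (F z) i.
Proof.
rewrite /dface linear_sum; apply: eq_bigr => z _.
by rewrite linearZ /= lin_word.
Qed.

Lemma assoc_words x y z (F : B -> chain) :
  \sum_s mul x y s *: \sum_t mul s z t *: F t
  = \sum_s mul y z s *: \sum_t mul x s t *: F t.
Proof.
by rewrite !sum_scale_sum; apply: eq_bigr => t _; rewrite assoc.
Qed.

Lemma koszul_merge z t y : mul z t y != 0 ->
  forall (u : B) r1 r2, koszul u (r1 ++ y :: r2) = koszul u (r1 ++ z :: t :: r2).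
Proof.
by move=> /mul_deg e u r1 r2; rewrite /koszul !big_cat !big_cons /= e !addnA.
Qed.

Lemma pface_far s1 a b s2 c d s3 :
  dface (size s1) (pface (s1 ++ a :: b :: s2 ++ c :: d :: s3) (size s1 + size s2).+2)
  = dface (size s1 + size s2).+1 (pface (s1 ++ a :: b :: s2 ++ c :: d :: s3) (size s1)).
Proof.
have e1 : (size s1 + size s2).+2 = size (s1 ++ a :: b :: s2) by rewrite size_cat /=; lia.
have e2 z : (size s1 + size s2).+1 = size (s1 ++ z :: s2) by rewrite size_cat /=; lia.
have E1 : pface (s1 ++ a :: b :: s2 ++ c :: d :: s3) (size s1 + size s2).+2
    = \sum_z mul c d z *: << s1 ++ a :: b :: s2 ++ z :: s3 >>.
  rewrite e1 -[s1 ++ _]/(s1 ++ (a :: b :: s2) ++ c :: d :: s3) catA pface_inner.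
  by apply: eq_bigr => z _; rewrite -catA.
have E2 t : pface (s1 ++ t :: s2 ++ c :: d :: s3) (size s1 + size s2).+1
    = \sum_z mul c d z *: << s1 ++ t :: s2 ++ z :: s3 >>.
  rewrite (e2 t) -[s1 ++ _]/(s1 ++ (t :: s2) ++ c :: d :: s3) catA pface_inner.
  by apply: eq_bigr => z _; rewrite -catA.
rewrite E1 pface_inner !dface_sum.
transitivity (\sum_z mul c d z *: \sum_t mul a b t *: (<< s1 ++ t :: s2 ++ z :: s3 >> : chain)).
  by apply: eq_sum_scale => z _; apply: pface_inner.
by rewrite sum_scale_exchange; apply: eq_sum_scale => t _; rewrite E2.
Qed.

Lemma pface_near s1 a b c s2 :
  dface (size s1) (pface (s1 ++ a :: b :: c :: s2) (size s1).+1)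
  = dface (size s1) (pface (s1 ++ a :: b :: c :: s2) (size s1)).
Proof.
have E1 : pface (s1 ++ a :: b :: c :: s2) (size s1).+1
    = \sum_z mul b c z *: << s1 ++ a :: z :: s2 >>.
  rewrite -cat_rcons -(size_rcons s1 a) pface_inner.
  by apply: eq_bigr => z _; rewrite cat_rcons.
rewrite E1 pface_inner !dface_sum.
transitivity (\sum_z mul b c z *: \sum_t mul a z t *: (<< s1 ++ t :: s2 >> : chain)).
  by apply: eq_sum_scale => z _; apply: pface_inner.
by rewrite -assoc_words; apply: eq_sum_scale => z _; rewrite pface_inner.
Qed.

Lemma pface_wrap_first a c s b :
  dface 0 (pface (a :: c :: rcons s b) (size s).+2)
  = dface (size s).+1 (pface (a :: c :: rcons s b) 0).
Proof.
have E1 : pface (a :: c :: rcons s b) (size s).+2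
  = koszul b (a :: c :: s) *: \sum_z mul b a z *: << z :: c :: s >> := pface_last a (c :: s) b.
have E2 : pface (a :: c :: rcons s b) 0 = \sum_z mul a c z *: << z :: rcons s b >> :=
  pface_inner [::] a c (rcons s b).
have E3 z : pface (z :: c :: s) 0 = \sum_t mul z c t *: << t :: s >> := pface_inner [::] z c s.
rewrite E1 E2 dfaceZ !dface_sum.
transitivity (koszul b (a :: c :: s) *:
    \sum_z mul b a z *: \sum_t mul z c t *: (<< t :: s >> : chain)).
  by apply: eq_scale => _; apply: eq_sum_scale => z _; apply: E3.
transitivity (\sum_z mul a c z *: (koszul b (z :: s) *:
    \sum_t mul b z t *: (<< t :: s >> : chain))).
  rewrite assoc_words (sum_scale_const (k0 := koszul b (a :: c :: s))); first by [].
  by move=> z /koszul_merge/(_ b [::] s).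
by apply: eq_sum_scale => z _; apply/esym/pface_last.
Qed.

Lemma pface_wrap_inner a s1 b c s2 e :
  dface (size s1).+1 (pface (a :: rcons (s1 ++ b :: c :: s2) e) (size s1 + size s2).+3)
  = dface (size s1 + size s2).+2 (pface (a :: rcons (s1 ++ b :: c :: s2) e) (size s1).+1).
Proof.
have e1 : (size s1 + size s2).+3 = (size (s1 ++ b :: c :: s2)).+1 by rewrite size_cat /=; lia.
have e2 z : (size s1 + size s2).+2 = (size (s1 ++ z :: s2)).+1 by rewrite size_cat /=; lia.
have E2 : pface (a :: rcons (s1 ++ b :: c :: s2) e) (size s1).+1
    = \sum_z mul b c z *: << a :: rcons (s1 ++ z :: s2) e >>.
  rewrite rcons_cat -cat_cons (pface_inner (a :: s1) b c (rcons s2 e)).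
  by apply: eq_bigr => z _; rewrite rcons_cat.
have E3 z : pface (z :: s1 ++ b :: c :: s2) (size s1).+1
    = \sum_t mul b c t *: << z :: s1 ++ t :: s2 >> := pface_inner (z :: s1) b c s2.
rewrite E2 e1 pface_last dfaceZ !dface_sum.
transitivity (koszul e (a :: s1 ++ b :: c :: s2) *:
    \sum_z mul e a z *: \sum_t mul b c t *: (<< z :: s1 ++ t :: s2 >> : chain)).
  by apply: eq_scale => _; apply: eq_sum_scale => z _; apply: E3.
transitivity (\sum_t mul b c t *: (koszul e (a :: s1 ++ t :: s2) *:
    \sum_z mul e a z *: (<< z :: s1 ++ t :: s2 >> : chain))).
  rewrite sum_scale_exchange (sum_scale_const (k0 := koszul e (a :: s1 ++ b :: c :: s2))); first by [].
  by move=> z /koszul_merge/(_ e (a :: s1) s2).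
by apply: eq_sum_scale => z _; rewrite (e2 z); apply/esym/pface_last.
Qed.

(** Here the Koszul signs agree only modulo 2: moving [b] and then [c] to the front, past [b] and
    back into its place, costs an additional even exponent [2 deg b deg c] compared with moving
    their product. *)
Lemma pface_wrap_last a s c b :
  dface (size s).+1 (pface (a :: rcons (rcons s c) b) (size s).+2)
  = dface (size s).+1 (pface (a :: rcons (rcons s c) b) (size s).+1).
Proof.
have e1 : (size s).+2 = (size (rcons s c)).+1 by rewrite size_rcons.
have E2 : pface (a :: rcons (rcons s c) b) (size s).+1
    = \sum_z mul c b z *: << a :: rcons s z >>.
  rewrite -cats1 cat_rcons -cat_cons (pface_inner (a :: s) c b [::]).
  by apply: eq_bigr => z _; rewrite cats1.
rewrite E2 e1 pface_last dfaceZ !dface_sum.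
transitivity (koszul b (a :: rcons s c) *: \sum_z mul b a z *:
    (koszul c (z :: s) *: \sum_t mul c z t *: (<< t :: s >> : chain))).
  by apply: eq_scale => _; apply: eq_sum_scale => z _; apply: pface_last.
rewrite (sum_scale_const (k0 := koszul c (b :: a :: s))); last first.
  by move=> z /koszul_merge/(_ c [::] s).
transitivity (\sum_z mul c b z *: (koszul z (a :: s) *:
    \sum_t mul z a t *: (<< t :: s >> : chain))); last first.
  by apply: eq_sum_scale => z _; apply/esym/pface_last.
rewrite scalerA -assoc_words.
rewrite (sum_scale_const (k0 := koszul b (a :: rcons s c) * koszul c [:: b, a & s])); first by [].
move=> z /mul_deg ez; rewrite /koszul -exprD -signr_odd -[RHS]signr_odd; congr (_ ^+ _).
rewrite !big_cons -cats1 big_cat big_seq1 ez !(oddD, oddM) /=.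
move: (\sum_(_ <- s) _)%N => u.
by case: (odd (deg b)); case: (odd (deg c)); case: (odd (deg a)); case: (odd u).
Qed.

Lemma split_word1 w i : (i.+1 < size w)%N ->
  exists s1 a b s2, w = s1 ++ a :: b :: s2 /\ size s1 = i.
Proof.
case: w => // a0 w0; set w := a0 :: w0 => iw.
exists (take i w), (nth a0 w i), (nth a0 w i.+1), (drop i.+2 w).
by split; [rewrite -!drop_nth ?cat_take_drop // ltnW|rewrite size_takel //; lia].
Qed.

(** The simplicial identities: disjoint merges commute and adjacent ones use associativity. The last
    face is treated apart, since it merges across the end of the word and carries a sign. *)
Lemma pface_pface w i j : (2 < size w)%N -> (i < j)%N -> (j < size w)%N ->
  dface i (pface w j) = dface j.-1 (pface w i).
Proof.
move=> sw ij jw; have [lt|ge] := ltnP j.+1 (size w).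
  have i1 : (i.+1 < size w)%N by lia.
  have [s1 [a [b [s2 [ew es]]]]] := split_word1 i1.
  have [ej|nej] := eqVneq j i.+1.
    have [c [s2' e2]] : exists c s2', s2 = c :: s2'.
      move: lt; rewrite ew ej size_cat es; case: (s2) => [|c s2']; last by exists c, s2'.
      by rewrite /=; lia.
    by rewrite ew ej e2 -es; apply: pface_near.
  have lt2 : ((j - i.+2).+1 < size s2)%N by move: lt; rewrite ew size_cat /= es; lia.
  have [s3 [c [d [s4 [e2 es3]]]]] := split_word1 lt2.
  have -> : j = (size s1 + size s3).+2 by lia.
  by rewrite ew e2 -es; apply: pface_far.
have {ge jw}ej : j = (size w).-1 by lia.
have [a [s [b ew]]] := word_ends (ltnW sw).
have es : j = (size s).+1 by rewrite ej ew /= size_rcons.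
have s0 : (0 < size s)%N by move: sw; rewrite ew /= size_rcons; lia.
rewrite ew es /=; case: i ij => [|i] ij.
  have [c [s' es']] : exists c s', s = c :: s' by case: (s) s0 => // c s' _; exists c, s'.
  by rewrite es' /=; apply: pface_wrap_first.
have [ei|nei] := eqVneq i.+1 (size s).
  have [s' [c es']] : exists s' c, s = rcons s' c.
    by case/lastP: (s) s0 => // s' c _; exists s', c.
  have [ei'] : i.+1 = (size s').+1 by rewrite ei es' size_rcons.
  by rewrite ei' es' size_rcons; apply: pface_wrap_last.
have i1 : (i.+1 < size s)%N by lia.
have [s1 [c [d [s2 [es' ei]]]]] := split_word1 i1.
have -> : size s = (size s1 + size s2).+2 by rewrite es' size_cat /=; lia.
by rewrite es' -ei; apply: pface_wrap_inner.
Qed.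

(** The term at [(i, j)] with [i < j] is the opposite of the one at [(j.-1, i)], whose first index
    is at least the second. *)
Lemma alternating_sum (V : lmodType K) p (F : nat -> nat -> V) :
  (forall i j, (i < j)%N -> (j <= p)%N -> F i j = F j.-1 i) ->
  \sum_(j < p.+1) \sum_(i < p) (-1) ^+ (i + j) *: F i j = 0.
Proof.
move=> e; pose G (i j : nat) : V := (-1) ^+ (i + j) *: F i j.
transitivity (\sum_(j < p.+1) \sum_(i < p | (i < j)%N) G i j
    + \sum_(j < p.+1) \sum_(i < p | (j <= i)%N) G i j).
  rewrite -big_split; apply: eq_bigr => j _ /=.
  by rewrite (bigID (fun i : 'I_p => (i < j)%N)) /=; congr (_ + _); apply: eq_bigl => i; rewrite -leqNgt.
rewrite [X in _ + X]big_ord_recr /= [X in _ + (_ + X)]big_pred0 ?addr0; last first.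
  by move=> i; rewrite leqNgt ltn_ord.
suff -> : \sum_(j < p.+1) \sum_(i < p | (i < j)%N) G i j
    = - \sum_(j < p) \sum_(i < p | (j <= i)%N) G i j by rewrite addNr.
rewrite big_ord_recl big_pred0 // add0r -sumrN.
rewrite (exchange_big_dep predT) //=; apply: eq_bigr => i _.
rewrite -sumrN; apply: eq_big => [j|j ij]; first by rewrite /bump /= add1n ltnS.
by rewrite /G e ?add1n //= addnS exprS mulN1r scaleNr addnC.
Qed.

End Hochschild.

(** * The differential: square zero and compatibility with degrees *)

Section HochschildSquare.
Variables (K : fieldType) (B : finType) (deg : B -> nat) (mul : B -> B -> B -> K).
Local Notation chain := {malg K[seq B]}.
Local Notation pface := (pface deg mul).
Local Notation dface := (dface deg mul).
Implicit Types (a b x y z : B) (w s : seq B).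
Hypothesis assoc : forall x y z t,
  \sum_s mul x y s * mul s z t = \sum_s mul y z s * mul x s t.
Hypothesis mul_deg : forall x y z, mul x y z != 0 -> deg z = (deg x + deg y)%N.

Lemma hochschild_sized n c : (1 < n)%N -> supported (fun w => size w = n) c ->
  hochschild_d deg mul c = \sum_(i < n) (-1) ^+ i *: dface i c.
Proof.
move=> n1 hc; rewrite hochschild_dE /dface /lin.
rewrite scale_sum_exchange !big_seq; apply: eq_bigr => w /hc sw; apply: eq_scale => _.
by rewrite hochschild_wordE sw.
Qed.

Lemma hochschild_d_word w : hochschild_d deg mul (hochschild_word deg mul w) = 0.
Proof.
(* Short words are treated apart: on a single letter the differential is 0, not a sum of faces. *)
have [sw|sw] := leqP (size w) 2.
  have [s1|s2] := leqP (size w) 1; first by rewrite hochschild_word1 // raddf0.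
  rewrite hochschild_dE hochschild_wordE //.
  have hs : supported (fun w' => size w' = 1%N) (\sum_(i < size w) (-1) ^+ i *: pface w i).
    apply: supported_sum => i _; apply: supportedZ.
    apply: supported_sub (pface_size s2 (ltn_ord i)) => w' ->.
    by move: sw s2; case: (size w) => [//|[//|[|//]]].
  rewrite /lin big_seq big1 // => w' /hs s1.
  by rewrite hochschild_word1 ?s1 // scaler0.
have [p ep] : exists p, size w = p.+1 by exists (size w).-1; lia.
rewrite hochschild_wordE; last by lia.
rewrite (hochschild_sized (n := p)); first last.
- apply: supported_sum => i _; apply: supportedZ.
  apply: supported_sub (pface_size _ (ltn_ord i)); last by lia.
  by move=> w' ->; rewrite ep.
- by lia.
rewrite ep; transitivity (\sum_(j < p.+1) \sum_(i < p) (-1) ^+ (i + j) *: dface i (pface w j)).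
  rewrite exchange_big; apply: eq_bigr => i _ /=.
  rewrite dface_bigsum.
  transitivity (\sum_(j < p.+1) (-1) ^+ i *: ((-1) ^+ j *: dface i (pface w j)));
    first exact: scaler_sumr.
  by apply: eq_bigr => j _; rewrite scalerA exprD.
apply: (alternating_sum (F := fun i j => dface i (pface w j))) => i j ij jp.
by apply: (pface_pface assoc mul_deg); rewrite ?ep; lia.
Qed.

Lemma hochschild_dd c : hochschild_d deg mul (hochschild_d deg mul c) = 0.
Proof.
rewrite [in X in hochschild_d _ _ X]hochschild_dE /lin linear_sum big1 // => w _.
by rewrite linearZ /= hochschild_d_word scaler0.
Qed.

Lemma pface_degree w i : (1 < size w)%N -> (i < size w)%N ->
  supported (fun w' => (\sum_(x <- w') deg x = \sum_(x <- w) deg x)%N) (pface w i).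
Proof.
move=> sw iw; have supp_mul (a b : B) (F : B -> seq B) P :
    (forall z, mul a b z != 0 -> P (F z)) ->
    supported P (\sum_z mul a b z *: (<< F z >> : chain)).
  move=> h; apply: supported_sum => z _; have [->|nz] := eqVneq (mul a b z) 0.
    by rewrite scale0r; apply: supported0.
  by apply: supportedZ; apply: supported_word; apply: h.
have [lt|ge] := ltnP i.+1 (size w).
  have [s1 [a [b [s2 [ew es]]]]] := split_word1 lt.
  rewrite -es {2}ew pface_inner.
  apply: (supp_mul a b (fun z => s1 ++ z :: s2)) => z /mul_deg ez.
  rewrite ew !big_cat !big_cons ez /=; move: (\sum_(_ <- s1) _)%N (\sum_(_ <- s2) _)%N => u v.
  lia.
have [a [s [b ew]]] := word_ends sw.
have -> : i = (size s).+1 by move: ge iw; rewrite ew /= size_rcons; lia.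
rewrite {2}ew pface_last; apply: supportedZ.
apply: (supp_mul b a (fun z => z :: s)) => z /mul_deg ez.
by rewrite ew !big_cons -cats1 big_cat big_seq1 ez /=; lia.
Qed.

Lemma homogeneousP t c : reflect (supported (K := K) (fun w => w != [::] /\ total_degree deg w = t) c)
  (c \in homogeneous deg t).
Proof.
apply: (iffP allP) => h w wc; first by case/andP: (h w wc) => ? /eqP.
by have [-> ->] := h w wc; rewrite eqxx.
Qed.

Lemma hochschild_d_homogeneous t c :
  c \in homogeneous deg (t + 1) -> hochschild_d deg mul c \in homogeneous deg t.
Proof.
move=> /homogeneousP hc; apply/homogeneousP; rewrite hochschild_dE.
apply: supported_lin hc => w [w0 wt].
have [sw|sw] := leqP (size w) 1.
  by rewrite hochschild_word1 //; apply: supported0.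
rewrite hochschild_wordE //; apply: supported_sum => i _; apply: supportedZ.
move=> w' w'i; have := pface_size sw (ltn_ord i) w'i.
have := pface_degree sw (ltn_ord i) w'i => /= dw' sw'; split.
  by rewrite -size_eq0 sw'; lia.
by move: wt; rewrite /total_degree dw' sw'; lia.
Qed.

End HochschildSquare.

Lemma sum_minus1 (K : fieldType) (V : lmodType K) (I : finType) (c : I -> K) (F : I -> V) i0 :
  \sum_i c i *: F i - c i0 *: F i0 = \sum_(i | i != i0) c i *: F i.
Proof. by rewrite (bigD1 i0) //= addrAC subrr add0r. Qed.

Section SupportedSums.
Variables (K : fieldType) (B : finType).
Local Notation chain := {malg K[seq B]}.
Variable P : seq B -> Prop.

Lemma lin_words phi (c : B -> K) (F : B -> seq B) :
  lin phi (\sum_z c z *: << F z >>) = \sum_z c z *: phi (F z).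
Proof.
rewrite linear_sum; apply: eq_bigr => z _.
by rewrite linearZ /= lin_word.
Qed.

Lemma supported_scaled_sum (I : finType) (c : I -> K) (F : I -> chain) :
  (forall z, c z != 0 -> supported P (F z)) -> supported P (\sum_z c z *: F z).
Proof.
move=> h; apply: supported_sum => z _; have [->|nz] := eqVneq (c z) 0.
  by rewrite scale0r; apply: supported0.
exact: supportedZ (h z nz).
Qed.

Lemma supported_sum1 (c : B -> K) (F : B -> chain) z0 :
  (forall z, z != z0 -> c z != 0 -> supported P (F z)) ->
  supported P (\sum_z c z *: F z - c z0 *: F z0).
Proof.
move=> h; rewrite sum_minus1; apply: supported_sum => z /h hz.
have [->|nz] := eqVneq (c z) 0; first by rewrite scale0r; apply: supported0.
exact: supportedZ (hz nz).
Qed.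

Lemma supported_trans (c1 c2 c3 : chain) :
  supported P (c1 - c2) -> supported P (c2 - c3) -> supported P (c1 - c3).
Proof. by move=> h h'; rewrite -(subrKA c2); apply: supportedD. Qed.

Lemma supported_symm (c1 c2 : chain) : supported P (c1 - c2) -> supported P (c2 - c1).
Proof. by move=> h; rewrite -opprB; apply: supportedN. Qed.

(* Here f k and g j stand for the terms of d (h w) and h (d w): the i-th face of
   h w gives back w, and the later ones cancel those of w. *)
Lemma supported_homotopy p i (f g : nat -> chain) c : (i <= p)%N ->
  (forall k, (k < i)%N -> supported P (f k)) ->
  (forall k, (k < i)%N -> supported P (g k)) ->
  supported P (f i - c) ->
  (forall j, (i <= j <= p)%N -> supported P (f j.+1 + g j)) ->
  supported P (\sum_(k < p.+2) f k + \sum_(j < p.+1) g j - c).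
Proof.
move=> ip hf hg hi hj.
have E (V : zmodType) (f' g' : nat -> V) c' :
    \sum_(k < p.+2) f' k + \sum_(j < p.+1) g' j - c'
    = \sum_(0 <= k < i) f' k + \sum_(0 <= k < i) g' k + (f' i - c')
      + \sum_(i <= j < p.+1) (f' j.+1 + g' j).
  rewrite -(big_mkord xpredT f') -(big_mkord xpredT g') /=.
  rewrite (@big_cat_nat _ _ _ i 0 p.+2) //=; last by lia.
  rewrite (@big_cat_nat _ _ _ i 0 p.+1) //=; last by lia.
  rewrite [\sum_(i <= k < p.+2) _]big_nat_recl; last by lia.
  rewrite big_split /=.
  set a := \sum_(0 <= k < i) f' k; set b := \sum_(0 <= k < i) g' k.
  set d := \sum_(i <= k < p.+1) f' k.+1; set e := \sum_(i <= k < p.+1) g' k.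
  by rewrite addrACA -[RHS]addrA -[LHS]addrA -(addrA (f' i)) [_ + _ - c']addrAC.
rewrite E; apply: supportedD; last first.
  by rewrite big_nat; apply: supported_sum => j ij; apply: hj; rewrite -ltnS.
apply: supportedD => //; apply: supportedD; rewrite big_nat; apply: supported_sum => k ki.
  exact: hf.
exact: hg.
Qed.

Lemma linD phi psi (c : chain) : lin (fun w => phi w + psi w) c = lin phi c + lin psi c.
Proof. by rewrite /lin -big_split; apply: eq_bigr => w _; exact: scalerDr. Qed.

Lemma linN phi (c : chain) : lin (fun w => - phi w) c = - lin phi c.
Proof. by rewrite /lin -sumrN; apply: eq_bigr => w _; exact: scalerN. Qed.

Lemma lin_comp (f : {linear chain -> chain}) phi (c : chain) :
  lin (fun w => f (phi w)) c = f (lin phi c).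
Proof.
rewrite /lin linear_sum; apply: eq_bigr => w _; apply/esym.
exact: linearZ.
Qed.

End SupportedSums.

(** * The contracting homotopy *)

Section Letters.
Variables (B : eqType) (ht : B -> nat).
Implicit Types (a b x y z : B) (w s r : seq B).

Definition top w : nat := (\max_(x <- w) ht x)%N.
Definition defect w : nat := count (fun x => ht x != top w) w.

(** For finitely many letters [top] is bounded, and with [top] fixed [defect] decreases, so that
    passing from [w] to [w'] terminates whatever the lengths of the words. *)
Definition lower w w' : Prop :=
  w' != [::] /\ ((top w < top w')%N \/ top w' = top w /\ (defect w' < defect w)%N).

Lemma top_ge w x : x \in w -> (ht x <= top w)%N.
Proof. by move=> xw; apply: leq_bigmax_seq. Qed.

Lemma perm_top w w' : perm_eq w w' -> top w = top w'.
Proof. exact: perm_big. Qed.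

Lemma perm_defect w w' : perm_eq w w' -> defect w = defect w'.
Proof. by move=> e; rewrite /defect (perm_top e); apply/seq.permP. Qed.

Lemma top_cons x w : top (x :: w) = maxn (ht x) (top w).
Proof. exact: big_cons. Qed.

(** If [top] is unchanged, [z] can be below it only when both [a] and [b] are, so at least one
    letter below the top is lost. Working up to permutation covers the inner faces and the cyclic
    one at once. *)
Lemma lower_merge w w' a b z r : perm_eq w [:: a, b & r] -> perm_eq w' (z :: r) ->
  (ht a <= ht z)%N -> (ht b <= ht z)%N -> (ht a != top w) || (ht b != top w) ->
  lower w w'.
Proof.
move=> pw pw' az bz; rewrite /lower (perm_top pw') (perm_defect pw') (perm_top pw) (perm_defect pw).
rewrite -size_eq0 (perm_size pw') /defect.
set t := top [:: a, b & r]; set t' := top (z :: r) => ab; split=> //.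
have tt' : (t <= t')%N.
  rewrite /t /t' !top_cons !geq_max !leq_max az bz leqnn !orbT; by [].
have [lt|ge] := ltnP t t'; [by left|right].
have e : t' = t by lia.
split=> //; rewrite e /=; move: (count _ r) => k.
have zt : (ht z <= t)%N by rewrite -e /t' top_cons leq_max leqnn.
by move: ab; do 3![case: eqP => //=] => *; lia.
Qed.

Lemma top_merge w w' a b z r : perm_eq w [:: a, b & r] -> perm_eq w' (z :: r) ->
  (ht a <= ht z)%N -> (ht b <= ht z)%N -> (ht z <= top w)%N -> top w' = top w.
Proof.
move=> /perm_top -> /perm_top ->; rewrite !top_cons => az bz.
by rewrite !leq_max => h; apply/eqP; rewrite eqn_leq; lia.
Qed.

Lemma lower_raise w w' z : z \in w' -> (top w < ht z)%N -> lower w w'.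
Proof.
move=> zw' lt; split; first by apply: contraTneq zw' => ->.
by left; apply: leq_trans lt (top_ge zw').
Qed.

Lemma eq_lower w1 w2 w' : top w1 = top w2 -> defect w1 = defect w2 ->
  lower w1 w' -> lower w2 w'.
Proof. by rewrite /lower => -> ->. Qed.

Lemma top_split w : w != [::] -> exists s x r,
  [/\ w = s ++ x :: r, ht x = top w & all (fun y => ht y != top w) s].
Proof.
move=> w0; have hw : has (fun y => ht y == top w) w.
  have [x xw e] : exists2 x, x \in w & ht x = top w.
    case: w w0 => // a w _; rewrite /top; elim: w a => [|b w IH] a.
      by exists a; rewrite ?inE // big_seq1.
    have [x xw e] := IH b; rewrite big_cons /maxn; case: ifP => _.
      by exists x; rewrite // inE xw orbT.
    by exists a; rewrite // inE eqxx.
  by apply/hasP; exists x; rewrite ?e.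
move: hw; move: (top w) => t hw; case: (split_find hw) => x s r ex ns.
exists s, x, r; split; [by rewrite cat_rcons|exact/eqP|by rewrite -all_predC in ns].
Qed.

End Letters.

Lemma quotient_pi_eq0 (R : nzRingType) (V : lmodType R) (S : {pred V})
    (closedS : submod_closed S) (u : V) : quotient_pi closedS u = 0 <-> u \in S.
Proof.
have <- : quotient_pi closedS 0 = 0.
  by apply: (addrI (quotient_pi closedS 0)); rewrite -quotient_piD !addr0.
by rewrite quotient_piP subr0.
Qed.

(** * Hochschild homology of an algebra with a cellular basis *)

Section Cellular.
Variables (K : fieldType) (B L : finType) (lft wgt rgt : B -> L) (deg : B -> nat).
Variables (mul : B -> B -> B -> K) (rk : L -> nat).
Variables (lpart rpart : B -> B) (idem : L -> B).
Local Notation chain := {malg K[seq B]}.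
Local Notation pface := (pface deg mul).
Local Notation koszul := (koszul K deg).
Implicit Types (a b x y z : B) (w s r : seq B) (e : L).

Hypothesis rk_inj : injective rk.
Hypothesis label_inj : forall x y, lft x = lft y -> wgt x = wgt y -> rgt x = rgt y -> x = y.
Hypothesis glue : forall x y, wgt x = wgt y ->
  exists z, [/\ lft z = lft x, wgt z = wgt x & rgt z = rgt y].
Hypothesis mul_matched : forall x y z, mul x y z != 0 ->
  [/\ rgt x = lft y, lft z = lft x & rgt z = rgt y].
Hypothesis mul_up : forall x y z, mul x y z != 0 ->
  (rk (wgt x) <= rk (wgt z))%N /\ (rk (wgt y) <= rk (wgt z))%N.
Hypothesis mul_deg : forall x y z, mul x y z != 0 -> deg z = (deg x + deg y)%N.
Hypothesis assoc : forall x y z t,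
  \sum_s mul x y s * mul s z t = \sum_s mul y z s * mul x s t.
Hypothesis lpartP : forall x, [/\ lft (lpart x) = lft x, wgt (lpart x) = wgt x
  & rgt (lpart x) = wgt x].
Hypothesis rpartP : forall x, [/\ lft (rpart x) = wgt x, wgt (rpart x) = wgt x
  & rgt (rpart x) = rgt x].
Hypothesis mul_parts : forall x, mul (lpart x) (rpart x) x = 1.
Hypothesis idemP : forall e, [/\ lft (idem e) = e, wgt (idem e) = e & rgt (idem e) = e].
Hypothesis degree0 : forall x, deg x = 0%N -> x = idem (wgt x).

Definition ht x : nat := rk (wgt x).
Local Notation low w := (lower ht w).
Local Notation top := (top ht).
Local Notation defect := (defect ht).

Lemma ht_lpart x : ht (lpart x) = ht x.
Proof. by rewrite /ht; have [_ ->] := lpartP x. Qed.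

Lemma ht_rpart x : ht (rpart x) = ht x.
Proof. by rewrite /ht; have [_ ->] := rpartP x. Qed.

Lemma lpart_idem e : lpart (idem e) = idem e.
Proof.
by have [h1 h2 h3] := lpartP (idem e); have [k1 k2 k3] := idemP e; apply: label_inj;
  rewrite ?h1 ?h2 ?h3 ?k1 ?k2 ?k3.
Qed.

Lemma rpart_idem e : rpart (idem e) = idem e.
Proof.
by have [h1 h2 h3] := rpartP (idem e); have [k1 k2 k3] := idemP e; apply: label_inj;
  rewrite ?h1 ?h2 ?h3 ?k1 ?k2 ?k3.
Qed.

Lemma parts_neq0 x : mul (lpart x) (rpart x) x != 0.
Proof. by rewrite mul_parts oner_neq0. Qed.

Lemma deg_idem e : deg (idem e) = 0%N.
Proof.
have := mul_deg (parts_neq0 (idem e)); rewrite lpart_idem rpart_idem => d.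
by apply/eqP; rewrite -(eqn_add2l (deg (idem e))) addn0 -d.
Qed.

Lemma split_unique x z : mul (lpart x) (rpart x) z != 0 -> wgt z = wgt x -> z = x.
Proof.
move=> nz e; have [_ l r] := mul_matched nz; apply: label_inj => //.
  by rewrite l; have [] := lpartP x.
by rewrite r; have [] := rpartP x.
Qed.

(* Cellularity: a product of diagrams of the same weight does not depend, in
   that weight, on the outer halves of the factors. *)
Lemma mul_rpart x y z : wgt x = wgt z -> wgt y = wgt z -> lft z = lft x -> rgt z = rgt y ->
  mul (rpart x) y (rpart z) = mul x y z.
Proof.
(* In both bracketings of this triple product the coefficient of [z] reduces to one term, as
   products never lower the height; one factor of that term is the coefficient 1 of a splitting. *)
move=> xz yz lz rz; have := assoc (lpart x) (rpart x) y z.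
have [lx1 lx2 lx3] := lpartP x; have [rx1 rx2 rx3] := rpartP x.
have [lz1 lz2 lz3] := lpartP z; have [rz1 rz2 rz3] := rpartP z.
have lE : lpart x = lpart z by apply: label_inj; rewrite ?lx1 ?lx2 ?lx3 ?lz1 ?lz2 ?lz3.
rewrite [X in X = _ -> _](bigD1 x) //= mul_parts mul1r [X in _ + X = _ -> _]big1 => [|s sx]; last first.
  apply/eqP; apply: contraNT sx; rewrite mulf_eq0 negb_or => /andP[h1 h2].
  apply/eqP/(split_unique h1)/rk_inj/anti_leq.
  by have [h3 _] := mul_up h1; have [h4 _] := mul_up h2; rewrite -{2}lx2 h3 xz h4.
rewrite addr0 [X in _ = X -> _](bigD1 (rpart z)) //= {1}lE mul_parts mulr1 big1 => [|s sz]; last first.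
  apply/eqP; apply: contraNT sz; rewrite mulf_eq0 negb_or => /andP[h1 h2].
  have [_ l1 r1] := mul_matched h1.
  apply/eqP/label_inj; rewrite ?rz1 ?rz2 ?rz3.
  - by rewrite l1 rx1.
  - apply/rk_inj/anti_leq; have [h3 _] := mul_up h1; have [_ ->] := mul_up h2.
    by rewrite -xz -rx2 h3.
  - by rewrite r1.
by rewrite addr0.
Qed.

Lemma mul_lpart x y z : wgt x = wgt z -> wgt y = wgt z -> lft z = lft x -> rgt z = rgt y ->
  mul x (lpart y) (lpart z) = mul x y z.
Proof.
move=> xz yz lz rz; have := assoc x (lpart y) (rpart y) z.
have [ly1 ly2 ly3] := lpartP y; have [ry1 ry2 ry3] := rpartP y.
have [lz1 lz2 lz3] := lpartP z; have [rz1 rz2 rz3] := rpartP z.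
have rE : rpart y = rpart z by apply: label_inj; rewrite ?ry1 ?ry2 ?ry3 ?rz1 ?rz2 ?rz3.
rewrite [X in _ = X -> _](bigD1 y) //= mul_parts mul1r [X in _ = _ + X -> _]big1 => [|s sy]; last first.
  apply/eqP; apply: contraNT sy; rewrite mulf_eq0 negb_or => /andP[h1 h2].
  apply/eqP/(split_unique h1)/rk_inj/anti_leq.
  by have [h3 _] := mul_up h1; have [_ h4] := mul_up h2; rewrite -{2}ly2 h3 yz h4.
rewrite addr0 [X in X = _ -> _](bigD1 (lpart z)) //= {1}rE mul_parts mulr1 big1 => [|s sz]; last first.
  apply/eqP; apply: contraNT sz; rewrite mulf_eq0 negb_or => /andP[h1 h2].
  have [_ l1 r1] := mul_matched h1.
  apply/eqP/label_inj; rewrite ?lz1 ?lz2 ?lz3.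
  - by rewrite l1.
  - apply/rk_inj/anti_leq; have [_ h3] := mul_up h1; have [-> _] := mul_up h2.
    by rewrite -yz -ly2 h3.
  - by rewrite r1 ly3.
by rewrite addr0.
Qed.

(** The sign compensates that of the face merging the two halves again, which thus returns [w] with
    coefficient 1. *)
Definition homotopy w : chain :=
  if w is a0 :: _ then
    let i := find (fun x => ht x == top w) w in
    let x := nth a0 w i in
    (-1) ^+ i *: << take i w ++ lpart x :: rpart x :: drop i.+1 w >>
  else 0.

Lemma homotopyE s x r : ht x = top (s ++ x :: r) ->
  all (fun y => ht y != top (s ++ x :: r)) s ->
  homotopy (s ++ x :: r) = (-1) ^+ size s *: << s ++ lpart x :: rpart x :: r >>.
Proof.
move=> ex ns; set w := s ++ x :: r.
have fE : find (fun x => ht x == top w) w = size s.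
  rewrite {2}/w find_cat /= -/w ex eqxx addn0; case: ifP => // /hasP[y ys].
  by move/allP/(_ y ys): ns => /negPf->.
have nE a0 : nth a0 w (size s) = x by rewrite nth_cat ltnn subnn.
have tE : take (size s) w = s by rewrite take_size_cat.
have dE : drop (size s).+1 w = r.
  by rewrite /w -cat_rcons drop_size_cat // size_rcons.
have [a0 [w' ew]] : exists a0 w', w = a0 :: w' by rewrite /w; case: (s) => [|a0 s']; eexists; eexists.
rewrite ew /homotopy -ew fE nE tE dE; by [].
Qed.

Lemma top_stretch s x r : top (s ++ lpart x :: rpart x :: r) = top (s ++ x :: r).
Proof. by rewrite /top !big_cat !big_cons ht_lpart ht_rpart /= [X in maxn _ X]maxnA maxnn. Qed.

Lemma defect_stretch s x r : ht x = top (s ++ x :: r) ->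
  defect (s ++ lpart x :: rpart x :: r) = defect (s ++ x :: r).
Proof.
by move=> e; rewrite /defect top_stretch !count_cat /= ht_lpart ht_rpart -e eqxx.
Qed.

Lemma low_homotopy w w' : low w w' -> supported (low w) (homotopy w').
Proof.
move=> lw; have [s [x [r [ew ex ns]]]] := top_split ht (proj1 lw).
rewrite ew in ex ns lw *; rewrite homotopyE //.
apply: supportedZ; apply: supported_word; split; first by case: (s).
by case: lw => _; rewrite top_stretch defect_stretch.
Qed.

Lemma low_lin_homotopy w c : supported (low w) c -> supported (low w) (lin homotopy c).
Proof. by apply: supported_lin => w' /low_homotopy. Qed.

Lemma perm_inner s a b r : perm_eq (s ++ a :: b :: r) [:: a, b & s ++ r].
Proof. by rewrite (perm_catCA s [:: a; b] r). Qed.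

Lemma perm_inner1 s z r : perm_eq (s ++ z :: r) (z :: s ++ r).
Proof. by rewrite (perm_catCA s [:: z] r). Qed.

Lemma perm_last s a b : perm_eq (a :: rcons s b) [:: b, a & s].
Proof. by rewrite -rcons_cons perm_rcons. Qed.

Lemma low_inner s a b r w : w = s ++ a :: b :: r ->
  (ht a != top w) || (ht b != top w) -> supported (low w) (pface w (size s)).
Proof.
move=> ew ab; rewrite {2}ew pface_inner; apply: supported_scaled_sum => z /mul_up[az bz].
apply: supported_word; apply: (lower_merge (r := s ++ r)) az bz ab; first by rewrite ew perm_inner.
exact: perm_inner1.
Qed.

Lemma low_last s a b w : w = a :: rcons s b ->
  (ht a != top w) || (ht b != top w) -> supported (low w) (pface w (size s).+1).
Proof.
move=> ew; rewrite orbC {4}ew pface_last => ab; apply: supportedZ.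
apply: supported_scaled_sum => z /mul_up[bz az].
apply: supported_word; apply: (lower_merge (r := s)) bz az ab; last exact: perm_refl.
by rewrite ew perm_last.
Qed.

Lemma low_nth a0 w k : (k.+1 < size w)%N -> ht (nth a0 w k) != top w ->
  supported (low w) (pface w k).
Proof.
move=> kw; have [s [a [b [r [ew <-]]]]] := split_word1 kw.
rewrite {1}ew nth_cat ltnn subnn /= => ha.
by apply: low_inner ew _; rewrite ha.
Qed.

Lemma merge_label x y z z1 : mul x y z != 0 -> ht x = ht z ->
  lft z1 = lft x -> wgt z1 = wgt x -> rgt z1 = rgt y -> z = z1.
Proof.
move=> /mul_matched[_ lz rz] /rk_inj wz l1 w1 r1.
by apply: label_inj; rewrite ?l1 ?w1 ?r1.
Qed.

Section TopLetter.
Variables (s r : seq B) (x : B).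
Let w := s ++ x :: r.
Hypothesis topx : ht x = top w.

Lemma low_stretch w' : low (s ++ lpart x :: rpart x :: r) w' -> low w w'.
Proof. by apply: eq_lower; rewrite ?top_stretch ?defect_stretch. Qed.

Lemma low_stretch_supported (c : chain) :
  supported (low (s ++ lpart x :: rpart x :: r)) c -> supported (low w) c.
Proof. by apply: supported_sub => w'; apply: low_stretch. Qed.

(** Any other term in the product of the two halves has a weight of greater height than [x], whose
    height was maximal. *)
Lemma homotopy_split :
  supported (low w) (pface (s ++ lpart x :: rpart x :: r) (size s) - << w >>).
Proof.
have -> : << w >> = mul (lpart x) (rpart x) x *: (<< w >> : chain).
  by rewrite mul_parts scale1r.
rewrite pface_inner.
apply: (supported_sum1 (F := fun z => << s ++ z :: r >>)) => z zx nz; apply: supported_word.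
have [le _] := mul_up nz.
have lt : (top w < ht z)%N.
  rewrite -topx ltn_neqAle; apply/andP; split; last first.
    by rewrite -(ht_lpart x).
  by apply: contraNneq zx => /rk_inj e; apply/eqP/(split_unique nz)/esym.
by apply: lower_raise lt; rewrite mem_cat inE eqxx orbT.
Qed.

End TopLetter.

(** If [y] is below the top, both terms are lower. Otherwise the only product of the same height is
    [z1], glued from [x] and [y]; by cellularity its coefficient in [x y] is that of [rpart z1] in
    [rpart x] times [y], and the leading terms cancel. *)
Lemma homotopy_near s x y r (w := s ++ x :: y :: r) : ht x = top w ->
  all (fun z => ht z != top w) s ->
  supported (low w) ((-1) ^+ size s *: pface (s ++ lpart x :: rpart x :: y :: r) (size s).+1
    - lin homotopy (pface w (size s))).
Proof.
move=> ex ns; have [ey|ny] := eqVneq (ht y) (top w); last first.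
  apply: supportedB; last first.
    by apply: low_lin_homotopy; apply: (@low_inner s x y r w (erefl w)); rewrite ny orbT.
  apply: supportedZ; apply: low_stretch_supported => //.
  have e : s ++ lpart x :: rpart x :: y :: r = rcons s (lpart x) ++ rpart x :: y :: r.
    by rewrite cat_rcons.
  rewrite -(size_rcons s (lpart x)); apply: low_inner e _.
  by rewrite top_stretch ny orbT.
have [z1 [l1 w1 r1]] : exists z, [/\ lft z = lft x, wgt z = wgt x & rgt z = rgt y].
  by apply/glue/rk_inj; rewrite -/(ht x) ex -ey.
have xz1 : wgt x = wgt z1 by rewrite w1.
have yz1 : wgt y = wgt z1 by rewrite w1; apply: rk_inj; rewrite -/(ht y) ey -ex.
have [lx lx' lx''] := lpartP x; have [rx rx' rx''] := rpartP x.
have [lz lz' lz''] := lpartP z1; have [rz rz' rz''] := rpartP z1.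
have ez1 : lpart z1 = lpart x by apply: label_inj; rewrite ?lx ?lz ?lx' ?lz' ?lx'' ?lz''.
pose F z := << s ++ lpart x :: z :: r >> : chain.
have E1 : pface (s ++ lpart x :: rpart x :: y :: r) (size s).+1
    = \sum_z mul (rpart x) y z *: F z.
  rewrite -cat_rcons -(size_rcons s (lpart x)) pface_inner.
  by apply: eq_bigr => z _; rewrite cat_rcons.
rewrite E1 pface_inner lin_words.
have top1 : top (s ++ z1 :: r) = top w.
  apply: (@top_merge _ _ _ _ x y z1 (s ++ r)); [exact: perm_inner|exact: perm_inner1| | |].
  - by rewrite /ht xz1.
  - by rewrite /ht yz1.
  - by rewrite /ht -xz1 -/(ht x) ex.
have E2 : mul x y z1 *: homotopy (s ++ z1 :: r)
    = (-1) ^+ size s *: (mul (rpart x) y (rpart z1) *: F (rpart z1)).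
  rewrite homotopyE; [|by rewrite top1 /ht -xz1|by rewrite top1].
  rewrite (mul_rpart xz1 yz1 l1 r1) /F ez1 scalerA [RHS]scalerA [in RHS]mulrC.
  reflexivity.
apply: (@supported_trans _ _ _ _ ((-1) ^+ size s *: (mul (rpart x) y (rpart z1) *: F (rpart z1)))).
  rewrite -scalerBr; apply: supportedZ; apply: (supported_sum1 (F := F)) => z zz1 nz.
  have [le _] := mul_up nz; apply: supported_word.
  have lt : (top w < ht z)%N.
    rewrite -ex ltn_neqAle; apply/andP; split; last by rewrite -(ht_rpart x).
    apply: contraNneq zz1 => e; apply/eqP/(merge_label nz); rewrite ?ht_rpart //.
    - by rewrite rz rx xz1.
    - by rewrite rz' rx' xz1.
    - by rewrite rz''.
  by apply: lower_raise lt; rewrite mem_cat !inE eqxx !orbT.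
rewrite -E2; apply: supported_symm.
apply: (supported_sum1 (F := fun z => homotopy (s ++ z :: r))) => z zz1 nz.
have [le _] := mul_up nz; apply: low_homotopy.
have lt : (top w < ht z)%N.
  rewrite -ex ltn_neqAle; apply/andP; split; last by [].
  by apply: contraNneq zz1 => e; apply/eqP/(merge_label nz).
by apply: lower_raise lt; rewrite mem_cat !inE eqxx !orbT.
Qed.

(** The merge takes place to the right of [x], so it commutes with the splitting of [x] unless it
    raises the maximal height, and then both terms are lower. *)
Lemma homotopy_far s x r1 a b r2 (w := s ++ x :: r1 ++ a :: b :: r2) : ht x = top w ->
  all (fun z => ht z != top w) s ->
  supported (low w)
    ((-1) ^+ size s *: pface (s ++ lpart x :: rpart x :: r1 ++ a :: b :: r2) (size s + size r1).+2
    - lin homotopy (pface w (size s + size r1).+1)).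
Proof.
move=> ex ns.
have e1 : (size s + size r1).+2 = size (s ++ lpart x :: rpart x :: r1).
  by rewrite size_cat /= !addnS.
have e2 : (size s + size r1).+1 = size (s ++ x :: r1) by rewrite size_cat /= !addnS.
have E1 : pface (s ++ lpart x :: rpart x :: r1 ++ a :: b :: r2) (size s + size r1).+2
    = \sum_z mul a b z *: << s ++ lpart x :: rpart x :: r1 ++ z :: r2 >>.
  have -> : s ++ lpart x :: rpart x :: r1 ++ a :: b :: r2
      = (s ++ lpart x :: rpart x :: r1) ++ a :: b :: r2 by rewrite -catA.
  by rewrite e1 pface_inner; apply: eq_bigr => z _; rewrite -catA.
have E2 : pface w (size s + size r1).+1 = \sum_z mul a b z *: << s ++ x :: r1 ++ z :: r2 >>.
  have -> : w = (s ++ x :: r1) ++ a :: b :: r2 by rewrite -catA.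
  by rewrite e2 pface_inner; apply: eq_bigr => z _; rewrite -catA.
rewrite E1 E2 lin_words scaler_sumr -sumrB.
apply: supported_sum => z _; rewrite [_ *: (_ *: _)]scalerA [_ * mul _ _ _]mulrC -scalerA -scalerBr.
have [->|nz] := eqVneq (mul a b z) 0; first by rewrite scale0r; apply: supported0.
have [az bz] := mul_up nz; apply: supportedZ.
set w1 := s ++ x :: r1 ++ z :: r2.
have [lt|le] := ltnP (top w) (ht z).
  apply: supportedB; last first.
    by apply: low_homotopy; apply: lower_raise lt; rewrite !(mem_cat, inE) eqxx !orbT.
  apply: supportedZ; apply: supported_word; apply: lower_raise lt.
  by rewrite !(mem_cat, inE) eqxx !orbT.
have t1 : top w1 = top w.
  apply: (@top_merge _ _ _ _ a b z ((s ++ x :: r1) ++ r2)) => //.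
    by rewrite /w -cat_cons catA; apply: perm_inner.
  by rewrite /w1 -cat_cons catA; apply: perm_inner1.
rewrite homotopyE; [|by rewrite -/w1 t1|by rewrite -/w1 t1].
by rewrite subrr; apply: supported0.
Qed.

(** When [x] is the first letter, the last face multiplies it from the left, and cellularity is used
    for [lpart]. The Koszul signs agree because the degrees of the two halves add up to that of
    [x]. *)
Lemma homotopy_wrap s x b (w := x :: rcons s b) : ht x = top w ->
  supported (low w) (pface (lpart x :: rpart x :: rcons s b) (size s).+2
    - lin homotopy (pface w (size s).+1)).
Proof.
move=> ex; have [eb|nb] := eqVneq (ht b) (top w); last first.
  apply: supportedB; last first.
    by apply: low_lin_homotopy; apply: (@low_last s x b w (erefl w)); rewrite nb orbT.
  apply: (@low_stretch_supported [::] (rcons s b) x ex).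
  apply: (@low_last (rpart x :: s) (lpart x) b _ (erefl _)).
  by rewrite (top_stretch [::]) nb orbT.
have [z1 [l1 w1 r1]] : exists z, [/\ lft z = lft b, wgt z = wgt b & rgt z = rgt x].
  by apply/glue/rk_inj; rewrite -/(ht b) eb -ex.
have bz1 : wgt b = wgt z1 by rewrite w1.
have xz1 : wgt x = wgt z1 by rewrite w1; apply: rk_inj; rewrite -/(ht x) ex -eb.
have [lx lx' lx''] := lpartP x; have [rx rx' rx''] := rpartP x.
have [lz lz' lz''] := lpartP z1; have [rz rz' rz''] := rpartP z1.
have ez1 : rpart z1 = rpart x.
  by apply: label_inj; rewrite ?rx ?rz ?rx' ?rz' ?rx'' ?rz''.
pose F z := << z :: rpart x :: s >> : chain.
have E1 : pface (lpart x :: rpart x :: rcons s b) (size s).+2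
    = koszul b (x :: s) *: \sum_z mul b (lpart x) z *: F z.
  rewrite (koszul_merge mul_deg (parts_neq0 x) b [::] s).
  exact: (pface_last _ _ (lpart x) (rpart x :: s) b).
have E2 : pface w (size s).+1 = koszul b (x :: s) *: \sum_z mul b x z *: << z :: s >>.
  exact: pface_last.
rewrite E1 E2 [lin _ (_ *: _)]linearZ [X in _ - X]/= lin_words -scalerBr; apply: supportedZ.
have top1 : top (z1 :: s) = top w.
  apply: (@top_merge _ _ _ _ b x z1 s); [|exact: perm_refl| | |].
  - by rewrite /w perm_last.
  - by rewrite /ht bz1.
  - by rewrite /ht xz1.
  - by rewrite /ht -xz1 -/(ht x) ex.
have E3 : mul b x z1 *: homotopy (z1 :: s) = mul b (lpart x) (lpart z1) *: F (lpart z1).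
  rewrite (homotopyE (s := [::])); [|by rewrite top1 /ht -xz1|by []].
  rewrite (mul_lpart bz1 xz1 l1 r1) /F ez1 /= expr0 scale1r.
  reflexivity.
apply: (@supported_trans _ _ _ _ (mul b (lpart x) (lpart z1) *: F (lpart z1))).
  apply: (supported_sum1 (F := F)) => z zz1 nz.
  have [_ le] := mul_up nz; apply: supported_word.
  have lt : (top w < ht z)%N.
    rewrite -ex ltn_neqAle; apply/andP; split; last by rewrite -(ht_lpart x).
    apply: contraNneq zz1 => e; apply/eqP/(merge_label nz).
    - by rewrite eb -ex.
    - by rewrite lz l1.
    - by rewrite lz' w1.
    - by rewrite lz'' lx'' xz1.
  by apply: lower_raise lt; rewrite !inE eqxx.
rewrite -E3; apply: supported_symm.
apply: (supported_sum1 (F := fun z => homotopy (z :: s))) => z zz1 nz.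
have [_ le] := mul_up nz; apply: low_homotopy.
have lt : (top w < ht z)%N.
  rewrite -ex ltn_neqAle; apply/andP; split; last by [].
  apply: contraNneq zz1 => e; apply/eqP/(merge_label nz) => //.
  by rewrite eb -ex.
by apply: lower_raise lt; rewrite !inE eqxx.
Qed.

Definition is_idem w : bool := [exists e, w == [:: idem e]].

Definition idem_part w : chain := if is_idem w then << w >> else 0.

(** The second face is the product of the halves in the wrong order. Its only possible term of the
    same weight is the idempotent, of degree 0; this forces [x] to have degree 0 and so to be that
    idempotent, in which case the two faces cancel. *)
Lemma homotopy_letter x :
  supported (low [:: x]) (hochschild_d deg mul (homotopy [:: x]) - << [:: x] >> + idem_part [:: x]).
Proof.
have topx : ht x = top [:: x] by rewrite top_cons [X in maxn _ X]big_nil maxn0.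
have hE : homotopy [:: x] = << [:: lpart x; rpart x] >>.
  by rewrite (homotopyE (s := [::])) // expr0 scale1r.
have dE : hochschild_d deg mul (homotopy [:: x])
    = pface [:: lpart x; rpart x] 0 - pface [:: lpart x; rpart x] 1.
  rewrite hE hochschild_dE lin_word hochschild_wordE; last by [].
  by rewrite 2!big_ord_recl big_ord0 addr0 expr0 scale1r expr1 scaleN1r.
have E1 : pface [:: lpart x; rpart x] 0 = \sum_z mul (lpart x) (rpart x) z *: << [:: z] >>.
  exact: (pface_inner _ _ [::] (lpart x) (rpart x) [::]).
have E2 : pface [:: lpart x; rpart x] 1 = koszul (rpart x) [:: lpart x]
    *: \sum_z mul (rpart x) (lpart x) z *: << [:: z] >>.
  exact: (pface_last _ _ (lpart x) [::] (rpart x)).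
rewrite dE; have [ex|nx] := altP (x =P idem (wgt x)).
  have -> : idem_part [:: x] = << [:: x] >>.
    by rewrite /idem_part /is_idem; case: existsP => // -[]; exists (wgt x); rewrite -ex.
  have k1 : koszul (rpart x) [:: lpart x] = 1.
    by rewrite ex rpart_idem /koszul deg_idem mul0n expr0.
  rewrite E1 E2 k1 ex lpart_idem rpart_idem scale1r subrr sub0r addNr.
  exact: supported0.
have -> : idem_part [:: x] = 0.
  rewrite /idem_part /is_idem; case: existsP => // -[e /eqP[ex]].
  by case/eqP: nx; rewrite ex; have [_ ->] := idemP e.
rewrite addr0 addrAC; apply: supportedB.
  exact: (homotopy_split (s := [::]) (r := [::])).
rewrite E2; apply: supportedZ; apply: supported_scaled_sum => z nz.
apply: supported_word; have [_ le] := mul_up nz.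
apply: (@lower_raise _ _ _ _ z); first by rewrite inE.
rewrite -topx ltn_neqAle; apply/andP; split; last by rewrite -(ht_lpart x).
apply: contraNneq nx => /rk_inj e; have [_ lz rz] := mul_matched nz.
have [rx rx' _] := rpartP x; have [_ lx' lx''] := lpartP x; have [i1 i2 i3] := idemP (wgt x).
have ez : z = idem (wgt x) by apply: label_inj; rewrite ?lz ?rz ?i1 ?i2 ?i3.
have d0 : deg x = 0%N.
  have := mul_deg nz; rewrite ez deg_idem (mul_deg (parts_neq0 x)) => /esym/eqP.
  by rewrite addn_eq0 => /andP[/eqP-> /eqP->].
by apply/eqP/degree0.
Qed.

Lemma homotopy_word w : w != [::] ->
  supported (low w) (hochschild_d deg mul (homotopy w) + lin homotopy (hochschild_word deg mul w)
    - << w >> + idem_part w).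
Proof.
move=> w0; have [s1|s2] := leqP (size w) 1.
  have [x ->] : exists x, w = [:: x] by case: (w) w0 s1 => [//|x [|//]] _ _; exists x.
  rewrite hochschild_word1 // raddf0 addr0.
  exact: homotopy_letter.
have -> : idem_part w = 0.
  by rewrite /idem_part /is_idem; case: existsP => // -[e /eqP ew]; rewrite ew in s2.
rewrite addr0; have [s [x [r [ew topx ns]]]] := top_split ht w0.
have hE : homotopy w = (-1) ^+ size s *: << s ++ lpart x :: rpart x :: r >>.
  by rewrite ew homotopyE -?ew.
have sw : size w = (size s + size r).+1 by rewrite ew size_cat /= addnS.
set p := (size s + size r)%N in sw.
set W := s ++ lpart x :: rpart x :: r.
have sW : size W = p.+2 by rewrite size_cat /= !addnS.
pose f k : chain := (-1) ^+ size s *: ((-1) ^+ k *: pface W k).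
pose g j : chain := (-1) ^+ j *: lin homotopy (pface w j).
have dE : hochschild_d deg mul (homotopy w) = \sum_(k < p.+2) f k.
  rewrite hE hochschild_dE [lin _ (_ *: _)]linearZ [LHS]/= lin_word hochschild_wordE ?sW //.
  exact: scaler_sumr.
have gE : lin homotopy (hochschild_word deg mul w) = \sum_(j < p.+1) g j.
  rewrite hochschild_wordE // sw linear_sum; apply: eq_bigr => j _.
  exact: linearZ.
rewrite dE gE; apply: (supported_homotopy (i := size s)).
- by rewrite leq_addr.
(* A face in front of [x] merges a letter below the top. *)
- move=> k ks; apply: supportedZ; apply: supportedZ.
  rewrite ew; apply: low_stretch_supported; rewrite -?ew //.
  apply: (@low_nth x); first by rewrite sW /p; lia.
  rewrite top_stretch -ew nth_cat ks.
  exact: (all_nthP x ns).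
- move=> k ks; apply: supportedZ; apply: low_lin_homotopy.
  apply: (@low_nth x); first by rewrite sw /p; lia.
  rewrite {1}ew nth_cat ks.
  exact: (all_nthP x ns).
- rewrite /f scalerA -expr2 sqrr_sign scale1r.
  have := @homotopy_split s r x; rewrite -ew; exact.
move=> j /andP[sj jp].
have -> : f j.+1 + g j
    = (-1) ^+ j.+1 *: ((-1) ^+ size s *: pface W j.+1 - lin homotopy (pface w j)).
  rewrite /f /g scalerBr !scalerA [(-1) ^+ size s * _]mulrC exprS mulN1r !scaleNr opprK.
  reflexivity.
apply: supportedZ; have [lt|ge] := ltnP j p.
  have [ej|nj] := eqVneq j (size s).
    have [y [r' er]] : exists y r', r = y :: r'.
      by move: lt; rewrite ej /p; case: (r) => [|y r' _]; [rewrite addn0 ltnn|exists y, r'].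
    have := @homotopy_near s x y r'; rewrite -er -ew ej; exact.
  have lt' : ((j - (size s).+1).+1 < size r)%N by move: lt; rewrite /p; lia.
  have [r1 [a [b [r2 [er e1]]]]] := split_word1 lt'.
  have ej : j = (size s + size r1).+1 by lia.
  have := @homotopy_far s x r1 a b r2; rewrite -er -ew ej; exact.
have {ge jp}ej : j = p by apply/eqP; rewrite eqn_leq jp.
(* There remains the last face. If [x] is not the first letter, that face merges a first letter
   below the top, and both terms are lower. *)
have [s0|[a [s' es]]] : s = [::] \/ exists a s', s = a :: s'.
- by case: (s); [left|right; eexists; eexists].
- have [r' [b er]] : exists r' b, r = rcons r' b.
    move: s2; rewrite sw /p s0; case/lastP: (r) => [//|r' b _]; by exists r', b.
  have := @homotopy_wrap r' x b; rewrite -er.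
  have ew1 : w = x :: r by rewrite ew s0.
  rewrite -ew1 => /(_ topx).
  by rewrite /W ej /p s0 er size_rcons expr0 scale1r.
have na : ht a != top w by move: ns; rewrite es /= => /andP[].
have [a1 [s1 [b1 ew1]]] := word_ends s2.
have ea1 : a1 = a by move: ew1; rewrite ew es => -[].
have [a2 [s3 [b2 ew2]]] : exists a s b, W = a :: rcons s b by apply: word_ends; rewrite sW.
have ea2 : a2 = a by move: ew2; rewrite /W es => -[].
apply: supportedB.
  apply: supportedZ; rewrite ew; apply: low_stretch_supported; rewrite -?ew //.
  have -> : j.+1 = (size s3).+1 by move: sW; rewrite ew2 /= size_rcons ej; lia.
  apply: (@low_last s3 a2 b2 _ ew2); rewrite top_stretch -ew ea2 na.
  by [].
apply: low_lin_homotopy.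
have -> : j = (size s1).+1 by move: sw; rewrite ew1 /= size_rcons ej; lia.
by apply: (@low_last s1 a1 b1 _ ew1); rewrite ea1 na.
Qed.

Notation homogeneous := (homogeneous deg).
Notation hochschild_d := (hochschild_d deg mul).

Lemma homotopy_homogeneous t (c : chain) : c \in homogeneous t ->
  lin homotopy c \in homogeneous (t + 1).
Proof.
move=> /homogeneousP hc; apply/homogeneousP; apply: supported_lin hc => w [w0 wt].
have [s [x [r [ew topx ns]]]] := top_split ht w0.
rewrite ew homotopyE -?ew //; apply: supportedZ; apply: supported_word.
split; first by case: (s).
rewrite -wt ew /total_degree !size_cat /= !big_cat !big_cons /=.
rewrite (mul_deg (parts_neq0 x)) !addnS /= addnA.
by rewrite [(_ + 1)]addrAC; congr (_ - _); lia.
Qed.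

Lemma idem_part_homogeneous t (c : chain) : c \in homogeneous t ->
  lin idem_part c \in homogeneous t.
Proof.
move=> /homogeneousP hc; apply/homogeneousP; apply: supported_lin hc => w ht_.
by rewrite /idem_part; case: ifP => _; [apply: supported_word|apply: supported0].
Qed.

Lemma supported_idem_part (c : chain) : supported is_idem (lin idem_part c).
Proof.
apply: (@supported_lin _ _ (fun=> True)) => [w _|//].
by rewrite /idem_part; case: ifP => h; [apply: supported_word|apply: supported0].
Qed.

Lemma hochschild_d_idem (c : chain) : supported is_idem c -> hochschild_d c = 0.
Proof.
move=> hc; rewrite hochschild_dE /lin big_seq big1 // => w /hc /existsP[e /eqP->].
by rewrite hochschild_word1 // scaler0.
Qed.

Lemma homotopy_chain (c : chain) : (forall w, w \in msupp c -> w != [::]) ->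
  supported (fun w' => exists2 w, w \in msupp c & low w w')
    (hochschild_d (lin homotopy c) + lin homotopy (hochschild_d c) - c + lin idem_part c).
Proof.
move=> c0; pose psi w : chain := hochschild_d (homotopy w)
  + lin homotopy (hochschild_word deg mul w) - << w >> + idem_part w.
have -> : hochschild_d (lin homotopy c) + lin homotopy (hochschild_d c) - c + lin idem_part c
    = lin psi c.
  rewrite /psi !linD linN (lin_comp (lin homotopy)) (lin_comp hochschild_d).
  by rewrite [X in _ - X + _]chainE.
rewrite /lin big_seq; apply: supported_sum => w wc; apply: supportedZ.
by apply: supported_sub (homotopy_word (c0 w wc)) => w' lw; exists w.
Qed.

(** Subtracting the boundary of [lin homotopy c] and the idempotent part of [c] leaves a cycle
    supported on lower words. This is one step of an induction on the gap between [top] and its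
    bound, and inside it on [defect]. *)
Lemma cycle_reduction t (c : chain) : c \in homogeneous t -> hochschild_d c = 0 ->
  exists2 c', c' \in homogeneous (t + 1) & supported is_idem (c - hochschild_d c').
Proof.
have closedD u (a b : chain) : a \in homogeneous u -> b \in homogeneous u ->
    a + b \in homogeneous u.
  by move=> ha hb; have := (@homogeneous_closed K B deg u).2 1 a b ha hb; rewrite scale1r.
have closedB u (a b : chain) : a \in homogeneous u -> b \in homogeneous u ->
    a - b \in homogeneous u.
  move=> ha hb; have := (@homogeneous_closed K B deg u).2 (-1) b a hb ha.
  by rewrite scaleN1r addrC.
pose bound := (\max_(e : L) rk e)%N.
have top_bound w : (top w <= bound)%N.
  by apply/bigmax_leqP_seq => x _ _; apply: leq_bigmax.
suff main k : forall c : chain, supported (fun w => bound < top w + k)%N c ->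
    c \in homogeneous t -> hochschild_d c = 0 ->
    exists2 c', c' \in homogeneous (t + 1) & supported is_idem (c - hochschild_d c').
  by apply: (main bound.+1) => w _; rewrite addnS ltnS leq_addl.
elim: k => [|k IHk] {}c hk.
  have -> : c = 0.
    rewrite (chainE c) big_seq; apply: big1 => w /hk.
    by rewrite addn0 ltnNge top_bound.
  move=> _ _; exists 0; first exact: (@homogeneous_closed K B deg _).1.
  by rewrite raddf0 subr0; apply: supported0.
(* The support of [c] is finite, so the defects of its words are bounded and the inner induction can
   start. *)
have [q hq] : exists q, supported (fun w => bound < top w + k \/
    bound < top w + k.+1 /\ defect w < q)%N c.
  exists (\max_(w <- msupp c) defect w).+1 => w wc; right; split; first exact: hk.
  by rewrite ltnS; apply: leq_bigmax_seq.
elim: q {hk} c hq => [|q IHq] c hq ch dc.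
  by apply: IHk => // w /hq[//|[]].
have c0 w : w \in msupp c -> w != [::] by move/homogeneousP: ch => ch /ch[].
have := homotopy_chain c0; rewrite dc raddf0 addr0 => hlow.
set u := lin homotopy c in hlow; set v := lin idem_part c in hlow.
have uh : u \in homogeneous (t + 1) by apply: homotopy_homogeneous.
have duh : hochschild_d u \in homogeneous t by apply: hochschild_d_homogeneous.
have vh : v \in homogeneous t by apply: idem_part_homogeneous.
have dv : hochschild_d v = 0 by apply/hochschild_d_idem/supported_idem_part.
have [|||c' hc' hs] := IHq (c - hochschild_d u - v).
- move=> w wc; have : w \in msupp (hochschild_d u - c + v).
    by rewrite -msuppN !opprD opprK [- _ + _]addrC.
  move=> /hlow[w' /hq w'q [_ lw]].
  by case: lw => [lt|[-> lt]]; case: w'q => [lt'|[lt' lt'']]; [left|left|left|right]; lia.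
- exact: closedB (closedB _ _ _ ch duh) vh.
- by rewrite !raddfB /= dc dv hochschild_dd // !subr0.
exists (u + c'); first exact: closedD.
rewrite raddfD /= opprD addrA.
have shuffle (V : zmodType) (x y z : V) : x - y = x - z - y + z by rewrite [x - z - y]addrAC subrK.
rewrite (shuffle _ _ _ v).
by apply: supportedD hs _; apply: supported_idem_part.
Qed.

Lemma coef_letters (c : B -> K) y :
  (\sum_z c z *: << [:: z] >> : chain)@_[:: y] = c y.
Proof.
rewrite raddf_sum (bigD1 y) //= mcoeffZ mcoeffUU mulr1 big1 ?addr0 // => z zy.
rewrite mcoeffZ mcoeffU; case: eqP => [[ez]|_]; last by rewrite mulr0.
by rewrite ez eqxx in zy.
Qed.

Lemma coef_outside (c : chain) (P : seq B -> Prop) w : supported P c -> ~ P w -> c@_w = 0.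
Proof. by move=> hc nP; apply: mcoeff_outdom; apply/negP => /hc. Qed.

(** Only words of two letters have one-letter faces. By degrees, an idempotent occurs in a product
    only if both factors have degree 0, hence are idempotents, and the matching of labels makes them
    equal; the two faces then cancel. *)
Lemma coef_hochschild_word w e : (hochschild_word deg mul w)@_[:: idem e] = 0.
Proof.
have [s1|s2] := leqP (size w) 1; first by rewrite hochschild_word1 // mcoeff0.
rewrite hochschild_wordE //; have [le2|gt2] := leqP (size w) 2; last first.
  rewrite raddf_sum big1 //= => i _; rewrite mcoeffZ.
  rewrite (coef_outside (pface_size _ (ltn_ord i))) ?mulr0 // => /eqP /=.
  by rewrite ltn_eqF //; lia.
have [a [b ew]] : exists a b, w = [:: a; b].
  by case: (w) s2 le2 => [//|a [//|b [|//]]] _ _; exists a, b.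
have E1 : pface [:: a; b] 0 = \sum_z mul a b z *: << [:: z] >>.
  exact: (pface_inner _ _ [::] a b [::]).
have E2 : pface [:: a; b] 1 = koszul b [:: a] *: \sum_z mul b a z *: << [:: z] >>.
  exact: (pface_last _ _ a [::] b).
rewrite ew [size _]/= 2!big_ord_recl big_ord0 addr0 expr0 scale1r expr1 scaleN1r.
rewrite [lift _ _]/= E1 E2 raddfB /= mcoeffZ !coef_letters.
have vanish x y : x != y -> mul x y (idem e) = 0.
  move=> xy; apply/eqP; apply: contraNT xy => nz; have [_ lx ry] := mul_matched nz.
  have /esym/eqP := mul_deg nz; rewrite deg_idem addn_eq0 => /andP[/eqP/degree0 ex /eqP/degree0 ey].
  have [l1 _ r1] := idemP e; have [lx' _ _] := idemP (wgt x); have [_ _ ry'] := idemP (wgt y).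
  rewrite l1 ex lx' in lx; rewrite r1 ey ry' in ry.
  by rewrite ex ey -lx -ry.
have [->|ab] := eqVneq a b; last by rewrite !vanish // 1?eq_sym // mulr0 subrr.
have [z0|nz] := eqVneq (mul b b (idem e)) 0; first by rewrite z0 mulr0 subrr.
have d0 : deg b = 0%N.
  by apply/eqP; have /esym/eqP := mul_deg nz; rewrite deg_idem addn_eq0 => /andP[].
by rewrite /koszul d0 mul0n expr0 mul1r subrr.
Qed.

Lemma coef_boundary (c : chain) e : (hochschild_d c)@_[:: idem e] = 0.
Proof.
rewrite hochschild_dE /lin raddf_sum big1 //= => w _.
by rewrite mcoeffZ coef_hochschild_word mulr0.
Qed.

Lemma supported_idemE (c : chain) : supported is_idem c ->
  c = \sum_e c@_[:: idem e] *: << [:: idem e] >>.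
Proof.
move=> hc; apply/malgP => w; rewrite raddf_sum /=.
have inj e e' : [:: idem e] = [:: idem e'] -> e = e'.
  by case=> /(congr1 wgt); have [_ -> _] := idemP e; have [_ -> _] := idemP e'.
have [/existsP[e /eqP->]|nw] := boolP (is_idem w).
  rewrite (bigD1 e) //= mcoeffZ mcoeffUU mulr1 big1 ?addr0 // => e' ne.
  rewrite mcoeffZ mcoeffU; case: eqP => [/inj ee|_]; last by rewrite mulr0.
  by rewrite ee eqxx in ne.
rewrite (coef_outside hc); last exact/negP.
rewrite big1 // => e _; rewrite mcoeffZ mcoeffU; case: eqP => [ew|_]; last by rewrite mulr0.
by case/negP: nw; apply/existsP; exists e; rewrite ew.
Qed.

Lemma cycle_homogeneous t (c : cycles deg mul t) :
  val c \in homogeneous t /\ hochschild_d (val c) = 0.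
Proof. by have := valP c; rewrite unfold_in => /andP[? /eqP]. Qed.

Lemma homology_vanishes t (x : HH deg mul t) : t != 0 -> x = 0.
Proof.
move=> t0; have [c ->] := quotient_pi_surj x; apply/quotient_pi_eq0.
have [ch dc] := cycle_homogeneous c.
apply/asboolP; have [c' c'h hs] := cycle_reduction ch dc; exists c' => //.
apply/esym/eqP; rewrite -subr_eq0; apply/eqP.
have hd : hochschild_d c' \in homogeneous t by apply: hochschild_d_homogeneous.
rewrite (supported_idemE hs) big1 // => e _.
rewrite raddfB /= coef_boundary subr0 (coef_outside (P := fun w => w != [::] /\ total_degree deg w = t)) ?scale0r //.
  exact/homogeneousP.
by case=> _; rewrite /total_degree big_seq1 deg_idem => /esym/eqP; rewrite (negPf t0).
Qed.

Section DegreeZero.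
Variables (N : nat) (cardL : #|{: L}| = N).

Definition label_of (i : 'I_N) : L := enum_val (cast_ord (esym cardL) i).

(** The coefficients are read on an arbitrary representative; since they vanish on boundaries, the
    choice does not matter. *)
Definition idem_coefs (x : HH deg mul 0) : 'rV[K]_N :=
  \row_i (val (projT1 (cid (quotient_pi_surj x))))@_[:: idem (label_of i)].

Lemma idem_coefsE (c : cycles deg mul 0) (x : HH deg mul 0) :
  x = quotient_pi (@boundary_closed K B deg mul 0) c ->
  idem_coefs x = \row_i (val c)@_[:: idem (label_of i)].
Proof.
move=> ex; apply/rowP => i; rewrite !mxE; case: cid => c1 /= ec1.
have /quotient_piP/asboolP[c' _ dc'] : quotient_pi (@boundary_closed K B deg mul 0) c1
  = quotient_pi (@boundary_closed K B deg mul 0) c by rewrite -ex.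
have := coef_boundary c' (label_of i); rewrite dc' GRing.valB mcoeffB => /eqP.
by rewrite subr_eq0 => /eqP.
Qed.

Lemma idem_coefs_linear : linear idem_coefs.
Proof.
move=> a x y; have [c ex] := quotient_pi_surj x; have [c' ey] := quotient_pi_surj y.
have exy : a *: x + y = quotient_pi (@boundary_closed K B deg mul 0) (a *: c + c').
  by rewrite quotient_piD -quotient_piZ -ex -ey.
rewrite (idem_coefsE exy) (idem_coefsE ex) (idem_coefsE ey).
by apply/rowP => i; rewrite !mxE GRing.valD mcoeffD GRing.valZ mcoeffZ.
Qed.

Lemma idem_coefs_bijective : bijective idem_coefs.
Proof.
pose lift_row (v : 'rV[K]_N) : chain := \sum_i v 0 i *: << [:: idem (label_of i)] >>.
have lift_cycle v : lift_row v \in cycle deg mul 0.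
  have hs (P : seq B -> Prop) : (forall e, P [:: idem e]) -> supported P (lift_row v).
    by move=> h; apply: supported_sum => i _; apply: supportedZ; apply: supported_word.
  rewrite unfold_in hochschild_d_idem ?eqxx ?andbT.
    apply/homogeneousP; apply: hs => e; split; first by [].
    by rewrite /total_degree big_seq1 deg_idem.
  by apply: hs => e; apply/existsP; exists e.
have label_bij : bijective label_of.
  apply: bij_comp (enum_val_bij _) _.
  by exists (cast_ord cardL) => i; rewrite ?cast_ordK ?cast_ordKV.
pose back (v : 'rV[K]_N) : HH deg mul 0 :=
  quotient_pi (@boundary_closed K B deg mul 0) (Sub (lift_row v) (lift_cycle v)).
have coef_lift v i : (lift_row v)@_[:: idem (label_of i)] = v 0 i.
  rewrite raddf_sum (bigD1 i) //= mcoeffZ mcoeffUU mulr1 big1 ?addr0 // => j ji.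
  rewrite mcoeffZ mcoeffU; case: eqP => [[/(congr1 wgt)]|_]; last by rewrite mulr0.
  have [_ -> _] := idemP (label_of j); have [_ -> _] := idemP (label_of i).
  by move/(bij_inj label_bij)/eqP; rewrite (negPf ji).
have K2 : cancel back idem_coefs.
  move=> v; rewrite (idem_coefsE (erefl (back v))).
  by apply/rowP => i; rewrite mxE SubK coef_lift.
exists back => // x; have [c ex] := quotient_pi_surj x.
rewrite [RHS]ex; apply/quotient_piP/asboolP.
have [ch dc] := cycle_homogeneous c; have [c' c'h hs] := cycle_reduction ch dc.
(* The lift of the coefficients is [val c - hochschild_d c'], and its difference with [val c] has to
   be a boundary. *)
exists (- c').
  have := (@homogeneous_closed K B deg (0 + 1)).2 (-1) c' 0 c'h (@homogeneous_closed K B deg (0 + 1)).1.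
  by rewrite scaleN1r addr0.
rewrite GRing.valB SubK raddfN /=.
suff -> : lift_row (idem_coefs x) = val c - hochschild_d c' by rewrite addrAC subrr sub0r.
rewrite (supported_idemE hs) /lift_row (reindex label_of); last exact: onW_bij.
apply: eq_bigr => i _; rewrite (idem_coefsE ex) mxE mcoeffB coef_boundary subr0.
by [].
Qed.

End DegreeZero.

End Cellular.

Lemma glue_diagrams (n m : nat) (x y : circle_diagram n m) : dweight x = dweight y ->
  exists z, [/\ dcup z = dcup x, dweight z = dweight x & dcap z = dcap y].
Proof.
move=> e; have h : orients (val (dweight x)) (val (dcup x))
    && orients (val (dweight x)) (val (dcap y)).
  have /andP[ox _] := valP x; have /andP[_ oy] := valP y.
  by rewrite [X in X && _]ox e [X in _ && X]oy.
by exists (mkdiag h).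
Qed.

Transparent mulK.

Theorem corollary1p6 (K : fieldType) (charK : [pchar K] =i pred0)
    (n m : nat) (le_nm : (n <= m)%N) :
  (forall t : int, t != 0 -> forall x : HH_arc K n m t, x = 0)
  /\ exists f : {linear HH_arc K n m 0 -> 'rV[K]_('C(m, n))}, bijective f.
Proof.
have lp (x : circle_diagram n m) : [/\ dcup (lpart le_nm x) = dcup x,
  dweight (lpart le_nm x) = dweight x & dcap (lpart le_nm x) = dweight x] by [].
have rp (x : circle_diagram n m) : [/\ dcup (rpart le_nm x) = dweight x,
  dweight (rpart le_nm x) = dweight x & dcap (rpart le_nm x) = dcap x] by [].
have ip (e : Lambda n m) : [/\ dcup (idem le_nm e) = e, dweight (idem le_nm e) = e
  & dcap (idem le_nm e) = e] by [].
have d0 (x : circle_diagram n m) : degree x = 0%N -> x = idem le_nm (dweight x).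
  by move=> /(degree0 le_nm)[e1 e2]; apply: diagram_inj.
have rk_inj := @height_inj n m le_nm.
pose V := homology_vanishes rk_inj (@diagram_inj n m) (@glue_diagrams n m)
  (@mulK_matched K n m) (mulK_height charK le_nm) (mulK_degree (K := K) le_nm)
  (mulK_assoc charK le_nm) lp rp (mulK_parts charK le_nm) ip d0.
pose lin_f := idem_coefs_linear (@diagram_inj n m) (@mulK_matched K n m)
  (mulK_degree (K := K) le_nm) lp rp (mulK_parts charK le_nm) ip d0 (card_Lambda n m).
pose bij_f := idem_coefs_bijective rk_inj (@diagram_inj n m) (@glue_diagrams n m)
  (@mulK_matched K n m) (mulK_height charK le_nm) (mulK_degree (K := K) le_nm)
  (mulK_assoc charK le_nm) lp rp (mulK_parts charK le_nm) ip d0 (card_Lambda n m).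
split; first by move=> t t0 x; apply: V.
pose f : {linear HH_arc K n m 0 -> 'rV[K]_('C(m, n))} :=
  HB.pack (idem_coefs (idem le_nm) (card_Lambda n m)) (GRing.isLinear.Build _ _ _ _ _ lin_f).
by exists f.
Qed.
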